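(* For every $s\in(0,\infty)$, $\mathrm J_s(\mathrm{bmo})\subsetneqq\overline{\mathrm J_s(\mathrm{bmo})}^{\Lambda_s}\subsetneqq\Lambda_s$, where the closure is taken in the norm of $\Lambda_s$.
   Context: $\Lambda_s$: bounded continuous $f$ on $\mathbb R^n$ with $\|f\|_{\Lambda_s}:=\|f\|_{L^\infty}+\sup_{x\in\mathbb R^n,y\in(0,1]}\sup_{|h|=y}|\Delta^{\lfloor s\rfloor+1}_hf(x)|/y^s<\infty$, where $\Delta_hf(x)=f(x+h/2)-f(x-h/2)$ and $\Delta^{k+1}_h=\Delta^k_h\Delta_h$. $\mathrm{bmo}$ is the space of $f\in L^1_{\rm loc}(\mathbb R^n)$ with $\|f\|_{\rm bmo}:=\sup_B\frac1{|B|}\int_B|f-f_B|+\sup_{k\in\mathbb Z^n}(\int_{k+[0,1)^n}|f|^2)^{1/2}<\infty$; $\mathrm J_s(\mathrm{bmo}):=(I-\Delta)^{-s/2}(\mathrm{bmo})$ with norm $\|(I-\Delta)^{s/2}f\|_{\rm bmo}$ (equal to $F^s_{\infty,2}$ with equivalent norms), a subspace of $\Lambda_s$. *)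

(* Defs.v *)
From HB Require Import structures.
From mathcomp Require Import all_boot all_order all_algebra.
From mathcomp Require Import all_classical all_reals all_analysis.
Set Implicit Arguments. Unset Strict Implicit. Unset Printing Implicit Defensive.
Import Order.TTheory GRing.Theory Num.Theory.
Import numFieldNormedType.Exports.
Local Open Scope classical_set_scope.
Local Open Scope ring_scope.

Section Defs.
Variable R : realType.

Definition enorm n (v : 'rV[R]_n) : R := Num.sqrt (\sum_i v ord0 i ^+ 2).

(* n-dimensional Lebesgue integral of a nonnegative extended function,
   realized as an iterated one-dimensional Lebesgue integral (Tonelli). *)
Fixpoint iint (n : nat) : ('rV[R]_n -> \bar R) -> \bar R :=
  match n return ('rV[R]_n -> \bar R) -> \bar R with
  | 0 => fun f => f 0
  | n'.+1 => fun f =>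
      (\int[lebesgue_measure]_x iint (fun v : 'rV[R]_n' =>
                                   f (row_mx (const_mx x : 'rV[R]_1) v)))%E
  end.

(* signed integral of a real function (meaningful for integrable f) *)
Definition iint_s n (f : 'rV[R]_n -> R) : R :=
  fine (iint (fun x => (Num.max (f x) 0)%:E)) -
  fine (iint (fun x => (Num.max (- f x) 0)%:E)).

Definition borel_fun n (f : 'rV[R]_n -> R) : Prop :=
  forall B : set R, measurable B -> <<s (@open 'rV[R]_n) >> (f @^-1` B).

Definition eball n (x : 'rV[R]_n) (r : R) : set 'rV[R]_n :=
  [set y | enorm (y - x) < r].

Definition vol n (A : set 'rV[R]_n) : R := fine (iint (fun y => (\1_A y)%:E)).

Definition avg n (A : set 'rV[R]_n) (f : 'rV[R]_n -> R) : R :=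
  iint_s (fun y => \1_A y * f y) / vol A.

Definition locally_integrable n (f : 'rV[R]_n -> R) : Prop :=
  borel_fun f /\
  forall (x : 'rV[R]_n) (r : R), 0 < r ->
    (iint (fun y => (\1_(eball x r) y * `|f y|)%:E) < +oo)%E.

Definition esqrt (x : \bar R) : \bar R :=
  match x with
  | EFin r => (Num.sqrt r)%:E
  | +oo%E => +oo%E
  | -oo%E => 0%E
  end.

Definition ucube n (k : 'rV[int]_n) : set 'rV[R]_n :=
  [set x | forall i, (k ord0 i)%:~R <= x ord0 i < (k ord0 i)%:~R + 1].

Definition bmo_norm n (f : 'rV[R]_n -> R) : \bar R :=
  (ereal_sup [set z | exists (x : 'rV[R]_n) (r : R), (0 < r)%R /\
       z = ((vol (eball x r))^-1)%:E *
           iint (fun y => (\1_(eball x r) y * `|f y - avg (eball x r) f|)%:E)]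
   + ereal_sup [set z | exists k : 'rV[int]_n,
       z = esqrt (iint (fun y => (\1_(ucube k) y * `|f y| ^+ 2)%:E))])%E.

Definition bmo n : set ('rV[R]_n -> R) :=
  [set f | locally_integrable f /\ (bmo_norm f < +oo)%E].

Definition Gamma (a : R) : R :=
  fine (\int[lebesgue_measure]_(t in [set t : R | (0 < t)%R]) (t `^ (a - 1) * expR (- t))%:E)%E.

(* Bessel kernel G_s (Stein, Singular Integrals, V.3) *)
Definition bessel_kernel n (s : R) (x : 'rV[R]_n) : R :=
  ((4 * pi) `^ (s / 2) * Gamma (s / 2))^-1 *
  fine (\int[lebesgue_measure]_(d in [set d : R | (0 < d)%R])
          (expR (- pi * enorm x ^+ 2 / d) * expR (- d / (4 * pi)) *
           d `^ ((s - n%:R) / 2) / d)%:E)%E.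

(* Bessel potential (I - Delta)^(-s/2) g = G_s * g *)
Definition bessel_potential n (s : R) (g : 'rV[R]_n -> R) : 'rV[R]_n -> R :=
  fun x => iint_s (fun y => bessel_kernel s (x - y) * g y).

Definition Jbmo n (s : R) : set ('rV[R]_n -> R) :=
  [set f | exists g, bmo g /\ f = bessel_potential s g].

Definition Delta n (h : 'rV[R]_n) (f : 'rV[R]_n -> R) : 'rV[R]_n -> R :=
  fun x => f (x + 2^-1 *: h) - f (x - 2^-1 *: h).

Definition lambda_norm n (s : R) (f : 'rV[R]_n -> R) : \bar R :=
  (ereal_sup [set (`|f x|)%:E | x in [set: 'rV[R]_n]] +
   ereal_sup [set z | exists (x h : 'rV[R]_n) (y : R),
      (0 < y <= 1)%R /\ enorm h = y /\
      z = (`|iter (Num.truncn s).+1 (Delta h) f x| / y `^ s)%:E])%E.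

Definition Lambda n (s : R) : set ('rV[R]_n -> R) :=
  [set f | continuous f /\ (lambda_norm s f < +oo)%E].

Definition lambda_closure n (s : R) (A : set ('rV[R]_n -> R)) : set ('rV[R]_n -> R) :=
  [set f : 'rV[R]_n -> R | Lambda s f /\
     forall eps : R, 0 < eps ->
       exists g, A g /\ (lambda_norm s (fun x => f x - g x)%R < eps%:E)%E].

End Defs.

Arguments Jbmo {R} n s.
Arguments Lambda {R} n s.

(* Main.v *)
(** The Bessel potential is an average of Gaussian means,
    [G_s * g = c * \int_0^oo e^(-d/4pi) d^(s/2-1) (P_d * g) dd], and for [g] in bmo the [m]-th
    differences of [P_d * g] with step [h] are [O((|h| / sqrt d)^m)] once [|h| <= sqrt d] and grow
    slower than any power of [|h| / sqrt d] otherwise; hence [J_s(bmo)] lies in [Lambda_s].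

    Strictness is tested on the lacunary series [f_a = \sum_j a_j 2^(-js) cos (pi 2^j x_0)], whose
    [Lambda_s] norm is at most [C sup |a_j|].  As [d -> +oo] the Gaussian means
    [\int P_d u] behave like the mean value of almost periodic functions: the waves become
    orthogonal, convolution with [G_s] becomes self-adjoint with the waves as eigenfunctions, of
    eigenvalue at most [C 2^(-js)], differences can be moved from one factor to the other, and
    [\int P_d g^2] stays bounded for [g] in bmo.  Bessel's inequality then shows that
    [\sum_j a_j^2] converges as soon as the [2^(-j)]-step differences of [f_a - G_s * g] are at most
    [2^(-js) a_j / 4].  The coefficients [a_j = (j+1)^(-1/2)] therefore give an element of the
    closure outside [J_s(bmo)], and [a_j = 1] an element of [Lambda_s] outside the closure. *)
Require Import Defs.
From HB Require Import structures.
From mathcomp Require Import all_boot all_order all_algebra.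
From mathcomp Require Import all_classical all_reals all_analysis.
From mathcomp Require Import measurable_realfun ring lra.
Set Implicit Arguments. Unset Strict Implicit. Unset Printing Implicit Defensive.
Import Order.TTheory GRing.Theory Num.Theory.
Import numFieldNormedType.Exports.
Local Open Scope classical_set_scope.
Local Open Scope ring_scope.

(** Waves and bmo functions are not integrable over the whole space, so their pairing gets a meaning
    only through a Gaussian weight of width sqrt d. Such a weight commutes with nothing exactly, but
    it varies by about 1/sqrt d per unit length. Moving a translation across it costs d^(-1/2) on
    bounded functions; moving the convolution with G_s across it costs d^(-1/2) times the possible
    growth of the means of |g|, taken here as d^(1/4). This is the origin of the common rate
    d^(-1/4) of the error terms. Their constants depend on the waves involved, so orthogonality is
    available only for finitely many waves at a time: the number of waves is fixed before d, and
    Bessel's inequality must give a bound independent of that number.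

    No Fourier transform is computed. Of the multipliers of the Gaussian and of G_s only positivity
    and upper bounds are needed, and the upper bounds are read off from the difference estimates for
    bmo functions. One condition, [tame], covers bmo functions and waves alike. *)

Notation borelV R n := (g_sigma_algebraType (@open 'rV[R]_n)).

(** * Borel structure on row vectors and the measure behind [iint] *)

Section BorelVectors.
Variable R : realType.

Lemma continuous_borelV_measurable n (f : 'rV[R]_n -> R) :
  continuous f -> measurable_fun setT (f : borelV R n -> R).
Proof.
move=> /continuousP cf; apply: (measurability _ (RGenOInfty.measurableE R)).
move=> _ [_ [a ->] <-]; rewrite setTI; apply: sub_sigma_algebra.
exact/cf/rray_open.
Qed.

Lemma borel_funP n (f : 'rV[R]_n -> R) :
  borel_fun f <-> measurable_fun setT (f : borelV R n -> R).
Proof.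
split=> [bf _ B mB|mf B mB]; first by rewrite setTI; exact: bf.
by have := mf measurableT B mB; rewrite setTI.
Qed.

Lemma measurable_coord n (i : 'I_n) :
  measurable_fun setT (fun v : borelV R n => (v : 'rV[R]_n) ord0 i).
Proof. by apply: continuous_borelV_measurable; exact: coord_continuous. Qed.

(** Balls of row vectors are sup-norm boxes, and those with rational centre and radius 1/(k+1) form
    a countable base. Countability is the point: it reduces Borel measurability of a vector-valued
    map to that of its coordinates. *)
Lemma open_rV_rational_boxes n (U : set 'rV[R]_n) : open U ->
  U = \bigcup_(p in [set p : 'rV[rat]_n * nat |
     ball (map_mx ratr p.1 : 'rV[R]_n) (p.2.+1%:R^-1) `<=` U])
     ball (map_mx ratr p.1 : 'rV[R]_n) (p.2.+1%:R^-1).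
Proof.
move=> oU; apply/seteqP; split=> [x Ux|x [p /= pU]]; last exact: pU.
have /nbhs_ballP[e /= e0 exU] : nbhs x U by exact: open_nbhs_nbhs.
have [k ke] : exists k, k.+1%:R^-1 < e / 2.
  have e2 : 0 < e / 2 by rewrite divr_gt0.
  have := near_infty_natSinv_lt (PosNum e2).
  by move=> [k _ /(_ k (leqnn k))] /= ?; exists k.
have k0 : 0 < k.+1%:R^-1 :> R by rewrite invr_gt0.
set r : R := k.+1%:R^-1 in ke k0.
have /choice[q qP] : forall i, exists q : rat, `|x ord0 i - ratr q| < r.
  move=> i; have [q] := @rat_in_itvoo R (x ord0 i - r) (x ord0 i + r) ltac:(lra).
  by rewrite in_itv/= => ?; exists q; rewrite ltr_norml; lra.
exists (\row_i q i, k); rewrite /= -/r.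
  move=> y [_ By]; apply: exU; split=> // i j; rewrite ord1.
  have := qP j; have := By ord0 j; rewrite !mxE/= /ball/= => b1 b2.
  rewrite -(subrKA (ratr (q j))); apply: (le_lt_trans (ler_normD _ _)); lra.
split=> // i j; rewrite ord1 !mxE /ball/= distrC; exact: qP.
Qed.

Lemma measurable_rV d (T : measurableType d) n (F : T -> 'rV[R]_n) :
  (forall i, measurable_fun setT (fun t => F t ord0 i)) ->
  measurable_fun setT (F : T -> borelV R n).
Proof.
move=> mF; apply: (@measurability _ _ T (borelV R n) setT F open) => //.
move=> _ [U oU <-]; rewrite setTI (open_rV_rational_boxes oU) preimage_bigcup.
rewrite bigcup_mkcond; apply: countable_bigcupT_measurable => [|p /=].
  exact: countableP.
case: ifPn => // _.
rewrite [X in measurable X](_ : _ = \bigcap_(i in [set: 'I_n])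
   ((fun t => F t ord0 i) @^-1` ball (ratr (p.1 ord0 i) : R) (p.2.+1%:R^-1))); last first.
  apply/seteqP; split=> t /=.
    by move=> [_ B] i _; have := B ord0 i; rewrite mxE.
  by move=> B; split=> // i j; rewrite ord1 mxE; exact: B.
apply: fin_bigcap_measurable => // i _.
rewrite -[X in measurable X]setTI; apply: mF => //; exact: measurable_ball.
Qed.


Definition consV n (p : measurableTypeR R * borelV R n) : borelV R n.+1 :=
  row_mx (const_mx p.1 : 'rV[R]_1) (p.2 : 'rV[R]_n).
Definition unconsV n (v : borelV R n.+1) : measurableTypeR R * borelV R n :=
  ((v : 'rV[R]_n.+1) ord0 ord0, \row_i (v : 'rV[R]_n.+1) ord0 (lift ord0 i)).

Lemma consV0 n p : (@consV n p : 'rV[R]_n.+1) ord0 ord0 = p.1.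
Proof.
rewrite /consV (_ : ord0 = lshift n (ord0 : 'I_1)); last exact/val_inj.
by rewrite [LHS](row_mxEl (const_mx p.1 : 'rV[R]_1)) mxE.
Qed.

Lemma consV_lift n p i :
  (@consV n p : 'rV[R]_n.+1) ord0 (lift ord0 i) = (p.2 : 'rV[R]_n) ord0 i.
Proof.
rewrite /consV (_ : lift ord0 i = rshift 1 i); last exact/val_inj.
by rewrite [LHS](row_mxEr (const_mx p.1 : 'rV[R]_1)).
Qed.

Lemma consVK n : cancel (@consV n) (@unconsV n).
Proof.
move=> [x v]; rewrite /unconsV consV0; congr pair; apply/rowP => i.
by rewrite mxE consV_lift.
Qed.

Lemma measurable_consV n : measurable_fun setT (@consV n).
Proof.
apply: measurable_rV => i; case: (unliftP ord0 i) => [j|] ->.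
  under eq_fun do rewrite consV_lift.
  exact: (measurableT_comp (measurable_coord j) measurable_snd).
under eq_fun do rewrite consV0.
exact: measurable_fst.
Qed.

Lemma measurable_unconsV n : measurable_fun setT (@unconsV n).
Proof.
apply: measurable_fun_pair; first exact: measurable_coord.
apply: measurable_rV => i; under eq_fun do rewrite mxE.
exact: measurable_coord.
Qed.

Section consV_measure.
Variables (n : nat) (mu : {sigma_finite_measure set (borelV R n) -> \bar R}).

Let leb1 : {sigma_finite_measure set (measurableTypeR R) -> \bar R} := lebesgue_measure.

(** Multiplying by the line and transporting along the Borel isomorphism [consV] stays on the
    sigma-algebra generated by the open sets of vectors, so the construction can be iterated over
    the dimension. *)
Definition consV_measure := pushforward (leb1 \x mu)%E (@consV n).

HB.instance Definition _ := Measure.copy consV_measure (measure_function_pushforward__canonical__measure_function_Measure (leb1 \x mu)%E (@measurable_consV n)).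

Lemma consV_measure_sigma_finite : sigma_finite setT consV_measure.
Proof.
have /sigma_finiteP[F [UF ndF mF]] := sigma_finiteT leb1.
have /sigma_finiteP[G [UG ndG mG]] := sigma_finiteT mu.
(* Products of two increasing covers, pulled back; since both increase, a pair is reached at the
   single index [maxn i j]. *)
exists (fun k => @unconsV n @^-1` (F k `*` G k)).
  rewrite -preimage_bigcup; apply/esym/seteqP; split=> // v _ /=.
  have [i _ Fi] : (\bigcup_i F i) (unconsV v).1 by rewrite -UF.
  have [j _ Gj] : (\bigcup_i G i) (unconsV v).2 by rewrite -UG.
  exists (maxn i j) => //; split=> /=.
  - by apply: (subsetPset _ _ (ndF _ _ (leq_maxl i j))).
  - by apply: (subsetPset _ _ (ndG _ _ (leq_maxr i j))).
move=> k; have [mFk Fk] := mF k; have [mGk Gk] := mG k.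
split; first by rewrite -[X in measurable X]setTI; apply: measurable_unconsV => //; exact: measurableX.
rewrite /consV_measure /pushforward -comp_preimage.
rewrite (_ : _ \o _ = id) ?preimage_id; last by apply/funext => p /=; rewrite consVK.
by rewrite product_measure1E// lte_mul_pinfty// ge0_fin_numE.
Qed.

HB.instance Definition _ := Measure_isSigmaFinite.Build _ _ _ consV_measure consV_measure_sigma_finite.

Lemma integral_consV_measure (f : borelV R n.+1 -> \bar R) :
  measurable_fun setT f -> (forall x, 0 <= f x)%E ->
  (\int[consV_measure]_x f x = \int[leb1 \x mu]_p f (consV p))%E.
Proof.
move=> mf f0; rewrite -[in RHS](preimage_setT (@consV n)).
exact: (@ge0_integral_pushforward _ _ _ _ R (@consV n) (@measurable_consV n) (leb1 \x mu)%E setT f measurableT mf (fun x _ => f0 x)).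
Qed.

Lemma tonelli_consV_measure (f : borelV R n.+1 -> \bar R) :
  measurable_fun setT f -> (forall x, 0 <= f x)%E ->
  (\int[consV_measure]_x f x =
   \int[lebesgue_measure]_x \int[mu]_v f (consV (x, v)))%E.
Proof.
move=> mf f0; rewrite integral_consV_measure//.
apply: (fubini_tonelli1 (f \o @consV n)) => [|p]; last exact: f0.
exact: (measurableT_comp mf (@measurable_consV n)).
Qed.

End consV_measure.

(** [iint] is only a nest of one-dimensional integrals. Tonelli, applied once per dimension from a
    point mass in dimension 0, exhibits a measure behind it, which gives access to Fubini,
    integrability and countable sums. *)
Lemma iint_integral n : exists mu : {sigma_finite_measure set (borelV R n) -> \bar R},
  forall f : borelV R n -> \bar R, measurable_fun setT f ->
  (forall x, 0 <= f x)%E -> iint f = (\int[mu]_x f x)%E.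
Proof.
elim: n => [|n [mu IH]].
  exists (dirac ((0 : 'rV[R]_0) : borelV R 0)) => f mf f0.
  by rewrite integral_dirac//= diracT mul1e.
exists (consV_measure mu) => f mf f0 /=.
rewrite tonelli_consV_measure//; apply: eq_integral => x _; rewrite IH//.
exact: (measurableT_comp mf (measurableT_comp (@measurable_consV n) (measurable_pair1 _))).
Qed.

(** Lebesgue measure, known only through [iintE]: its invariances and the volumes of boxes are read
    off from iterated integrals. *)
Definition lebV n : {sigma_finite_measure set (borelV R n) -> \bar R} :=
  projT1 (cid (iint_integral n)).

Lemma iintE n (f : borelV R n -> \bar R) : measurable_fun setT f ->
  (forall x, 0 <= f x)%E -> iint f = (\int[lebV n]_x f x)%E.
Proof. exact: (projT2 (cid (iint_integral n))). Qed.

Lemma ge0_integral_lebesgue_shift (f : R -> \bar R) a : measurable_fun setT f ->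
  (forall x, 0 <= f x)%E ->
  (\int[lebesgue_measure]_x f (x + a)%R = \int[lebesgue_measure]_x f x)%E.
Proof.
move=> mf f0.
have ms : measurable_fun setT ((fun x => x + a) : measurableTypeR R -> measurableTypeR R).
  exact: measurable_funD.
rewrite -(@ge0_integral_pushforward _ _ _ _ _ _ ms lebesgue_measure setT f)//.
apply: eq_measure_integral => //= A mA _.
apply/esym; apply: lebesgue_measure_unique => //= _ [[x y]] _ <-.
rewrite /pushforward.
rewrite (_ : _ @^-1` _ = `](x - a)%R, (y - a)%R]%classic); last first.
  by apply/seteqP; split=> z/=; rewrite !in_itv/= ltrBlDr lerBrDr.
by rewrite !lebesgue_measure_itv/= !lte_fin ltrD2r -!EFinD; case: ifP => // _; congr EFin; ring.
Qed.

Lemma consV_add n (x : R) (v : 'rV[R]_n) (a : 'rV[R]_n.+1) :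
  consV (x, v : borelV R n) + a =
  consV (x + (unconsV a).1, (v + ((unconsV a).2 : 'rV[R]_n) : borelV R n)).
Proof.
apply/rowP => i; rewrite mxE; case: (unliftP ord0 i) => [j|] ->.
  by rewrite !consV_lift/= !mxE.
by rewrite !consV0.
Qed.

Lemma measurable_addr_borelV n (a : 'rV[R]_n) :
  measurable_fun setT ((fun x => x + a) : borelV R n -> borelV R n).
Proof.
apply: measurable_rV => i; under eq_fun do rewrite mxE.
by apply: measurable_funD => //; exact: measurable_coord.
Qed.

(** The first coordinate and the remaining vector are shifted separately. The one-dimensional
    invariance applies to the inner integral because Tonelli makes it measurable in the first
    coordinate. *)
Lemma iint_shift n (f : borelV R n -> \bar R) (a : 'rV[R]_n) : measurable_fun setT f ->
  (forall x, 0 <= f x)%E -> iint (fun x => f (x + a)) = iint f.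
Proof.
elim: n f a => [|n IH] f a mf f0 /=.
  by rewrite (_ : 0 + a = 0)//; apply/rowP; case.
pose F x := iint (fun v : 'rV[R]_n => f (consV (x, v : borelV R n))).
have mfc : measurable_fun setT (f \o @consV n) by exact: (measurableT_comp mf (@measurable_consV n)).
have F0 x : (0 <= F x)%E.
  rewrite /F iintE//; first exact: integral_ge0.
  exact: (measurableT_comp mfc (measurable_pair1 _)).
have mF : measurable_fun setT F.
  rewrite (_ : F = fubini_F (lebV n) (f \o @consV n)).
    by apply: measurable_fun_fubini_tonelli_F => //= p; exact: f0.
  apply/funext => x; rewrite /F iintE//.
  exact: (measurableT_comp mfc (measurable_pair1 _)).
rewrite -(ge0_integral_lebesgue_shift (unconsV a).1 mF F0).
apply: eq_integral => x _.
rewrite /F -(IH (fun v => f (consV (x + (unconsV a).1, v))) (unconsV a).2)//; last first.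
  exact: (measurableT_comp mfc (measurable_pair1 _)).
by congr iint; apply/funext => v; rewrite -consV_add.
Qed.

Lemma ge0_integral_lebesgue_opp (f : R -> \bar R) : measurable_fun setT f ->
  (forall x, 0 <= f x)%E ->
  (\int[lebesgue_measure]_x f (- x)%R = \int[lebesgue_measure]_x f x)%E.
Proof.
move=> mf f0.
have ms : measurable_fun setT (-%R : measurableTypeR R -> measurableTypeR R) by exact: oppr_measurable.
rewrite -(@ge0_integral_pushforward _ _ _ _ _ _ ms lebesgue_measure setT f)//.
by apply: eq_measure_integral => //= A mA _; exact: lebesgue_measureN.
Qed.

Lemma consV_opp n (x : R) (v : 'rV[R]_n) :
  - consV (x, v : borelV R n) = consV (- x, (- v : borelV R n)) :> 'rV[R]_n.+1.
Proof.
apply/rowP => i; rewrite mxE; case: (unliftP ord0 i) => [j|] ->.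
  by rewrite !consV_lift/= !mxE.
by rewrite !consV0.
Qed.

Lemma iint_opp n (f : borelV R n -> \bar R) : measurable_fun setT f ->
  (forall x, 0 <= f x)%E -> iint (fun x => f (- x)) = iint f.
Proof.
elim: n f => [|n IH] f mf f0 /=.
  by rewrite (_ : - 0 = 0)//; apply/rowP; case.
pose F x := iint (fun v : 'rV[R]_n => f (consV (x, v : borelV R n))).
have mfc : measurable_fun setT (f \o @consV n) by exact: (measurableT_comp mf (@measurable_consV n)).
have F0 x : (0 <= F x)%E.
  rewrite /F iintE//; first exact: integral_ge0.
  exact: (measurableT_comp mfc (measurable_pair1 _)).
have mF : measurable_fun setT F.
  rewrite (_ : F = fubini_F (lebV n) (f \o @consV n)).
    by apply: measurable_fun_fubini_tonelli_F => //= p; exact: f0.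
  apply/funext => x; rewrite /F iintE//.
  exact: (measurableT_comp mfc (measurable_pair1 _)).
rewrite -(ge0_integral_lebesgue_opp mF F0).
apply: eq_integral => x _.
rewrite /F -(IH (fun v => f (consV (- x, v))))//; last first.
  exact: (measurableT_comp mfc (measurable_pair1 _)).
by congr iint; apply/funext => v; rewrite -consV_opp.
Qed.

(** Source of the explicit values used later: the mass of a Gaussian and the volumes of boxes and
    unit cubes are products over the coordinates. *)
Lemma iint_prod n (phi : R -> R) : measurable_fun setT phi -> (forall x, 0 <= phi x) ->
  (iint (fun v : 'rV[R]_n => (\prod_i phi (v ord0 i))%:E) =
   (\int[lebesgue_measure]_x (phi x)%:E) ^+ n)%E.
Proof.
move=> mphi phi0.
have mprod m : measurable_fun setT (fun v : borelV R m => (\prod_i phi ((v : 'rV[R]_m) ord0 i))%:E).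
  apply/measurable_EFinP; apply: measurable_prod => i _.
  exact: (measurableT_comp mphi (measurable_coord i)).
elim: n => [|n IH]; first by rewrite /= big_ord0.
rewrite expeS -IH -ge0_integralZr//=.
- apply: eq_integral => x _; rewrite iintE; last 2 first.
  + exact: (measurableT_comp (mprod n.+1) (measurableT_comp (@measurable_consV n) (measurable_pair1 _))).
  + by move=> v; rewrite lee_fin prodr_ge0.
  rewrite iintE//; last by move=> v; rewrite lee_fin prodr_ge0.
  rewrite -ge0_integralZl//; last 2 first.
  + by move=> v _; rewrite lee_fin prodr_ge0.
  + by rewrite lee_fin.
  apply: eq_integral => v _; rewrite big_ord_recl -EFinM; congr (_ * _)%:E.
    by rewrite -[row_mx _ _]/(consV (x, v)) consV0.
  by apply: eq_bigr => i _; rewrite -[row_mx _ _]/(consV (x, v)) consV_lift.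
- exact/measurable_EFinP.
- by move=> x _; rewrite lee_fin.
- rewrite iintE//; last by move=> v; rewrite lee_fin prodr_ge0.
  by apply: integral_ge0 => v _; rewrite lee_fin prodr_ge0.
Qed.

End BorelVectors.

(** * Real-valued integrals, finite sums and scalar factors *)

Section RealIntegral.
Context d (T : measurableType d) (R : realType) (mu : {measure set T -> \bar R}).
Implicit Types f g : T -> R.

Lemma integrable_dom f g : measurable_fun setT f -> (forall x, `|f x| <= g x) ->
  mu.-integrable setT (EFin \o g) -> mu.-integrable setT (EFin \o f).
Proof.
move=> mf fg ig; apply: le_integrable ig => //; first exact/measurable_EFinP.
by move=> x _ /=; rewrite lee_fin (le_trans (fg x))// ler_norm.
Qed.

Lemma ge0_integrable f : measurable_fun setT f -> (forall x, 0 <= f x) ->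
  (\int[mu]_x (f x)%:E < +oo)%E -> mu.-integrable setT (EFin \o f).
Proof.
move=> mf f0 fi; apply/integrableP; split; first exact/measurable_EFinP.
by under eq_integral do rewrite /= ger0_norm//.
Qed.

Lemma integrable_RZl c f : mu.-integrable setT (EFin \o f) ->
  mu.-integrable setT (EFin \o (fun x => c * f x)).
Proof. by move=> fi; apply: eq_integrable (integrableZl measurableT c fi). Qed.

Lemma integrable_RZr c f : mu.-integrable setT (EFin \o f) ->
  mu.-integrable setT (EFin \o (fun x => f x * c)).
Proof. by move=> fi; apply: eq_integrable (integrableZr measurableT c fi). Qed.

Lemma integrable_RD f g : mu.-integrable setT (EFin \o f) ->
  mu.-integrable setT (EFin \o g) -> mu.-integrable setT (EFin \o (fun x => f x + g x)).
Proof. by move=> fi gi; apply: eq_integrable (integrableD measurableT fi gi). Qed.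

Lemma integrable_RB f g : mu.-integrable setT (EFin \o f) ->
  mu.-integrable setT (EFin \o g) -> mu.-integrable setT (EFin \o (fun x => f x - g x)).
Proof. by move=> fi gi; apply: eq_integrable (integrableB measurableT fi gi). Qed.

Lemma integrable_Rnorm f : mu.-integrable setT (EFin \o f) ->
  mu.-integrable setT (EFin \o (fun x => `|f x|)).
Proof. by move=> fi; apply: eq_integrable (integrable_abse fi). Qed.

Lemma eq_integrableR f g : f =1 g -> mu.-integrable setT (EFin \o f) ->
  mu.-integrable setT (EFin \o g).
Proof. by move=> fg; apply: eq_integrable => // x _ /=; rewrite fg. Qed.

Lemma integrableR_measurable f : mu.-integrable setT (EFin \o f) -> measurable_fun setT f.
Proof. by move=> fi; apply/measurable_EFinP; exact: measurable_int fi. Qed.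

Lemma integrable_EFinK f : mu.-integrable setT (EFin \o f) ->
  (\int[mu]_x (f x)%:E)%E = (\int[mu]_x f x)%:E.
Proof. by move=> fi; rewrite /Rintegral fineK//; exact: integrable_fin_num. Qed.

Lemma Rintegral_le_norm f g : mu.-integrable setT (EFin \o f) ->
  mu.-integrable setT (EFin \o g) -> (forall x, `|f x| <= g x) ->
  `|\int[mu]_x f x| <= \int[mu]_x g x.
Proof.
move=> fi gi fg; apply: (le_trans (le_normr_Rintegral measurableT fi)).
by apply: le_Rintegral => //; exact: integrable_norm.
Qed.

Lemma Rintegral_sum (I : Type) (r : seq I) (P : pred I) (F : I -> T -> R) :
  (forall i, mu.-integrable setT (EFin \o F i)) ->
  \int[mu]_x (\sum_(i <- r | P i) F i x) = \sum_(i <- r | P i) \int[mu]_x F i x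
  /\ mu.-integrable setT (EFin \o (fun x => \sum_(i <- r | P i) F i x)).
Proof.
move=> Fi; elim: r => [|i r [IH1 IH2]].
  split; last by under [X in _.-integrable _ X]eq_fun do rewrite /= big_nil; exact: integrable0.
  by under eq_Rintegral do rewrite big_nil; rewrite big_nil /Rintegral integral0.
case: (boolP (P i)) => Pi; last first.
  have E x : \sum_(j <- i :: r | P j) F j x = \sum_(j <- r | P j) F j x by rewrite big_cons (negPf Pi).
  split; first by rewrite big_cons (negPf Pi) -IH1; apply: eq_Rintegral => x _.
  by apply: eq_integrable IH2 => // x _ /=; rewrite E.
rewrite big_cons Pi -IH1 -RintegralD//; split.
  by apply: eq_Rintegral => x _; rewrite big_cons Pi.
apply: eq_integrable (integrableD measurableT (Fi i) IH2) => //.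
by move=> x _ /=; rewrite big_cons Pi.
Qed.

(** An integrable extended function may be infinite on a null set, where [fine] returns 0; equality
    almost everywhere is enough. It lets Fubini be stated for real-valued partial integrals. *)
Lemma integrable_fine_real (F : T -> \bar R) : mu.-integrable setT F ->
  mu.-integrable setT (EFin \o (fine \o F)) /\
  \int[mu]_x fine (F x) = fine (\int[mu]_x F x)%E.
Proof.
move=> iF; have mF : measurable_fun setT F := measurable_int mu iF.
have mfF : measurable_fun setT (EFin \o (fine \o F)).
  by apply/measurable_EFinP; exact: measurableT_comp.
have E : {ae mu, forall x, setT x -> F x = (fine (F x))%:E}.
  by apply: filterS (integrable_ae measurableT iF) => x Fx _; rewrite fineK//; exact: Fx.
split; last by congr fine; apply: ae_eq_integral => //; apply: filterS E => x H _; rewrite -H.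
apply/integrableP; split=> //; have /integrableP[_] := iF.
rewrite (ae_eq_integral (fun x => `|(EFin \o (fine \o F)) x|)%E)//; do ?exact: measurableT_comp.
by apply: filterS E => x H _ /=; rewrite {1}H.
Qed.

(** Integrability is not assumed: when the integral of [f] is infinite both sides are 0, because
    [fine] sends infinities to 0. The integral defining the Bessel kernel at the origin is such a
    case when [s <= n]. *)
Lemma ge0_RintegralZr (f : T -> R) (c : R) : measurable_fun setT f -> (forall x, 0 <= f x) ->
  \int[mu]_x (f x * c) = (\int[mu]_x f x) * c.
Proof.
move=> mf f0; have mEf : measurable_fun setT (EFin \o f) by exact/measurable_EFinP.
have [fi|fi] := pselect (mu.-integrable setT (EFin \o f)); first exact: RintegralZr.
have fy : (\int[mu]_x (f x)%:E = +oo)%E.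
  by apply/eqP; rewrite eq_le leey/= leNgt; apply/negP => flty; apply: fi; exact: ge0_integrable.
rewrite [\int[mu]_x f x]/Rintegral fy mul0r.
have fz (k : R) : 0 <= k -> fine (\int[mu]_x (f x * k)%:E)%E = 0.
  move=> k0; under eq_integral do rewrite EFinM.
  rewrite ge0_integralZr//; last by move=> x _; rewrite lee_fin.
  rewrite fy; move: k0; rewrite le_eqVlt => /predU1P[<-|k0]; first by rewrite mule0.
  by rewrite gt0_mulye ?lte_fin.
have [c0|/ltW c0] := leP 0 c; first exact: fz.
rewrite /Rintegral (_ : (\int[mu]_x _)%E = - (\int[mu]_x (f x * - c)%:E))%E.
  by rewrite fineN fz ?oppr0// oppr_ge0.
rewrite -integral_ge0N.
  by apply: eq_integral => x _; rewrite mulrN EFinN oppeK.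
by move=> x _; rewrite lee_fin mulr_ge0 ?oppr_ge0.
Qed.

End RealIntegral.

(** * Fubini for real-valued functions *)

Section RealFubini.
Context d1 d2 (T1 : measurableType d1) (T2 : measurableType d2) (R : realType).
Variable m1 : {sigma_finite_measure set T1 -> \bar R}.
Variable m2 : {sigma_finite_measure set T2 -> \bar R}.
Variable f : T1 * T2 -> R.

Hypothesis mf : measurable_fun setT f.
Hypothesis fi : (\int[m1]_x \int[m2]_y `|f (x, y)|%:E < +oo)%E.

Lemma integrable_prod_real : (m1 \x m2)%E.-integrable setT (EFin \o f).
Proof. by apply/integrable12ltyP => //; exact/measurable_EFinP. Qed.

Lemma integrable_Rfubini :
  m1.-integrable setT (EFin \o (fun x => \int[m2]_y f (x, y))).
Proof. exact: (integrable_fine_real (integrable_fubini_F integrable_prod_real)).1. Qed.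

Lemma integrable_fubini_swap : m2.-integrable setT (fubini_G m1 (EFin \o f)).
Proof.
have mEf : measurable_fun setT (EFin \o f) by exact/measurable_EFinP.
apply/integrableP; split; first exact: measurable_fubini_G integrable_prod_real.
have := integrable_prod_real; rewrite integrable21ltyP//; apply: le_lt_trans.
have mnf : measurable_fun setT (abse \o (EFin \o f)) by exact: measurableT_comp.
apply: ge0_le_integral => //.
- by apply: measurableT_comp => //; exact: measurable_fubini_G integrable_prod_real.
- by apply: (measurable_fun_fubini_tonelli_G (abse \o (EFin \o f)) mnf) => p; exact: abse_ge0.
- move=> y _; apply: le_abse_integral => //.
  exact: (measurableT_comp mEf (measurable_pair2 _)).
Qed.

Lemma integrable_Rfubini_swap :
  m2.-integrable setT (EFin \o (fun y => \int[m1]_x f (x, y))).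
Proof. exact: (integrable_fine_real integrable_fubini_swap).1. Qed.

Lemma Rfubini : \int[m1]_x \int[m2]_y f (x, y) = \int[m2]_y \int[m1]_x f (x, y).
Proof.
have [_ E1] := integrable_fine_real (integrable_fubini_F integrable_prod_real).
have [_ E2] := integrable_fine_real integrable_fubini_swap.
by apply: (etrans E1); rewrite (Fubini integrable_prod_real).
Qed.

End RealFubini.

(** * Translation and reflection invariance *)

Section LebV.
Variables (R : realType) (n : nat).
Implicit Types (f g : borelV R n -> R).
Notation mu := (lebV R n).

Lemma ge0_integral_lebV_shift (f : borelV R n -> \bar R) (a : 'rV[R]_n) :
  measurable_fun setT f -> (forall x, 0 <= f x)%E ->
  (\int[mu]_x f ((x : 'rV[R]_n) + a)%R = \int[mu]_x f x)%E.
Proof.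
move=> mf f0; rewrite -!iintE//; first exact: iint_shift.
exact: (measurableT_comp mf (measurable_addr_borelV a)).
Qed.

Lemma integral_lebV_shift (f : borelV R n -> \bar R) (a : 'rV[R]_n) :
  measurable_fun setT f ->
  (\int[mu]_x f ((x : 'rV[R]_n) + a)%R = \int[mu]_x f x)%E.
Proof.
move=> mf; rewrite integralE [RHS]integralE; congr (_ - _)%E.
- rewrite -(ge0_integral_lebV_shift a (measurable_funepos mf))//.
  by apply: eq_integral => x _; rewrite !funeposE.
- rewrite -(ge0_integral_lebV_shift a (measurable_funeneg mf))//.
  by apply: eq_integral => x _; rewrite !funenegE.
Qed.

Lemma Rintegral_shift f (a : 'rV[R]_n) : measurable_fun setT f ->
  \int[mu]_x f ((x : 'rV[R]_n) + a) = \int[mu]_x f x.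
Proof.
move=> mf; rewrite /Rintegral (integral_lebV_shift a (f := EFin \o f))//.
exact/measurable_EFinP.
Qed.

Lemma integrable_shift f (a : 'rV[R]_n) : mu.-integrable setT (EFin \o f) ->
  mu.-integrable setT (fun x => (f ((x : 'rV[R]_n) + a))%:E).
Proof.
move=> /integrableP[/measurable_EFinP mf fi]; apply/integrableP; split.
  by apply/measurable_EFinP; exact: (measurableT_comp mf (measurable_addr_borelV a)).
rewrite (ge0_integral_lebV_shift a (f := fun x => (`|(f x)%:E|)%E))//.
by apply: measurableT_comp => //; exact/measurable_EFinP.
Qed.

Lemma measurable_opp_borelV : measurable_fun setT ((fun x => - x) : borelV R n -> borelV R n).
Proof.
apply: measurable_rV => i; under eq_fun do rewrite mxE.
by apply: measurable_funN; exact: measurable_coord.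
Qed.

Lemma integral_lebV_opp (f : borelV R n -> \bar R) : measurable_fun setT f ->
  (\int[mu]_x f (- (x : 'rV[R]_n))%R = \int[mu]_x f x)%E.
Proof.
have H (k : borelV R n -> \bar R) : measurable_fun setT k -> (forall x, 0 <= k x)%E ->
    (\int[mu]_x k (- (x : 'rV[R]_n))%R = \int[mu]_x k x)%E.
  move=> mk k0; rewrite -!iintE//; first exact: iint_opp.
  exact: (measurableT_comp mk measurable_opp_borelV).
move=> mf; rewrite integralE [RHS]integralE; congr (_ - _)%E.
- rewrite -(H _ (measurable_funepos mf))//.
  by apply: eq_integral => x _; rewrite !funeposE.
- rewrite -(H _ (measurable_funeneg mf))//.
  by apply: eq_integral => x _; rewrite !funenegE.
Qed.

Lemma Rintegral_opp f : measurable_fun setT f ->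
  \int[mu]_x f (- (x : 'rV[R]_n)) = \int[mu]_x f x.
Proof.
move=> mf; rewrite /Rintegral (integral_lebV_opp (f := EFin \o f))//.
exact/measurable_EFinP.
Qed.

Lemma iint_sE f : mu.-integrable setT (EFin \o f) -> iint_s f = \int[mu]_x f x.
Proof.
move=> fi; have mf : measurable_fun setT f by apply/measurable_EFinP; exact: measurable_int fi.
rewrite /iint_s /Rintegral integralE fineB; last 2 first.
- exact: integrable_pos_fin_num.
- exact: integrable_neg_fin_num.
congr (fine _ - fine _).
- rewrite iintE; last 2 first.
  + by apply/measurable_EFinP; exact: measurable_maxr.
  + by move=> x; rewrite lee_fin le_max lexx orbT.
  by apply: eq_integral => x _; rewrite funeposE EFin_max.
- rewrite iintE; last 2 first.
  + by apply/measurable_EFinP; apply: measurable_maxr => //; exact: measurable_funN.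
  + by move=> x; rewrite lee_fin le_max lexx orbT.
  by apply: eq_integral => x _; rewrite funenegE EFin_max EFinN.
Qed.

End LebV.

(** * Euclidean norm and Cauchy-Schwarz *)

Section Enorm.
Variables (R : realType) (n : nat).
Implicit Types u v : 'rV[R]_n.

Lemma enorm_ge0 v : 0 <= enorm v. Proof. exact: sqrtr_ge0. Qed.
#[local] Hint Resolve enorm_ge0 : core.

Lemma enorm_sqr v : enorm v ^+ 2 = \sum_i v ord0 i ^+ 2.
Proof. by rewrite sqr_sqrtr// sumr_ge0// => i _; exact: sqr_ge0. Qed.

Lemma enormN v : enorm (- v) = enorm v.
Proof. by congr Num.sqrt; apply: eq_bigr => i _; rewrite mxE sqrrN. Qed.

Lemma enormB u v : enorm (u - v) = enorm (v - u).
Proof. by rewrite -enormN opprB. Qed.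

Lemma enormZ c v : enorm (c *: v) = `|c| * enorm v.
Proof.
rewrite /enorm -sqrtr_sqr -sqrtrM ?sqr_ge0// mulr_sumr.
by congr Num.sqrt; apply: eq_bigr => i _; rewrite mxE exprMn.
Qed.

Lemma coord_le_enorm v i : `|v ord0 i| <= enorm v.
Proof.
rewrite -sqrtr_sqr ler_sqrt ?sumr_ge0// => [|j _]; last exact: sqr_ge0.
by rewrite (bigD1 i)//= lerDl sumr_ge0// => j _; exact: sqr_ge0.
Qed.

Lemma enorm_le_coord v r : 0 <= r -> (forall i, `|v ord0 i| <= r) ->
  enorm v <= Num.sqrt n%:R * r.
Proof.
move=> r0 vr; rewrite -(ger0_norm r0) -sqrtr_sqr -sqrtrM// ler_sqrt; last first.
  by rewrite mulr_ge0// sqr_ge0.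
rewrite mulr_natl -[n in _ *+ n]card_ord -sumr_const; apply: ler_sum => i _.
by rewrite -[leLHS]real_normK ?num_real// lerXn2r// ?nnegrE.
Qed.

Definition dotV u v := \sum_i u ord0 i * v ord0 i.

Lemma dotV_le u v : `|dotV u v| <= enorm u * enorm v.
Proof.
wlog uv0 : u / 0 <= dotV u v.
  move=> H; case: (leP 0 (dotV u v)) => [|/ltW] uv0; first exact: H.
  rewrite -enormN -normrN (_ : - dotV u v = dotV (- u) v); last first.
    by rewrite /dotV -sumrN; apply: eq_bigr => i _; rewrite mxE mulNr.
  apply: H; rewrite (_ : dotV (- u) v = - dotV u v) ?oppr_ge0//.
  by rewrite /dotV -sumrN; apply: eq_bigr => i _; rewrite mxE mulNr.
rewrite ger0_norm//.
set a := enorm u; set b := enorm v.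
have a0 : 0 <= a := enorm_ge0 u. have b0 : 0 <= b := enorm_ge0 v.
(* Expanding the square gives a b (u.v) <= (a b)^2, to be divided by a b; if a b = 0, one of the
   vectors vanishes. *)
have : 0 <= \sum_i (b * u ord0 i - a * v ord0 i) ^+ 2.
  by apply: sumr_ge0 => i _; exact: sqr_ge0.
under eq_bigr do rewrite sqrrB !exprMn.
rewrite big_split sumrB/= -!mulr_sumr -!enorm_sqr -/a -/b.
rewrite (_ : \sum_i _ = a * b * dotV u v *+ 2); last first.
  rewrite /dotV mulr_sumr -sumrMnl; apply: eq_bigr => i _; ring.
move=> H.
have [ab0|] := ltP 0 (a * b).
  rewrite -(ler_pM2l ab0); nra.
move=> ab0; have {}ab0 : a * b = 0 by apply/eqP; rewrite eq_le ab0 mulr_ge0.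
rewrite ab0; move/eqP: ab0; rewrite mulf_eq0 => /orP[]/eqP ab0.
- rewrite /dotV big1// => i _; have := coord_le_enorm u i.
  by rewrite -/a ab0 normr_le0 => /eqP ->; rewrite mul0r.
- rewrite /dotV big1// => i _; have := coord_le_enorm v i.
  by rewrite -/b ab0 normr_le0 => /eqP ->; rewrite mulr0.
Qed.

Lemma enormD_sqr u v : enorm (u + v) ^+ 2 = enorm u ^+ 2 + dotV u v *+ 2 + enorm v ^+ 2.
Proof.
rewrite !enorm_sqr /dotV -sumrMnl -!big_split/=.
by apply: eq_bigr => i _; rewrite mxE sqrrD.
Qed.

Lemma enormB_sqr u v : enorm (u - v) ^+ 2 = enorm u ^+ 2 - dotV u v *+ 2 + enorm v ^+ 2.
Proof.
rewrite !enorm_sqr /dotV -sumrMnl -sumrB -!big_split/=.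
by apply: eq_bigr => i _; rewrite !mxE sqrrB.
Qed.

(** Giving up half of the quadratic exponent absorbs a change of centre; this is how a shifted
    Gaussian is dominated by a wider centred one. *)
Lemma enormD_sqr_ge u v : enorm u ^+ 2 / 2 - enorm v ^+ 2 <= enorm (u + v) ^+ 2.
Proof.
rewrite !enorm_sqr mulr_suml -sumrB; apply: ler_sum => i _; rewrite mxE.
set a := u _ _; set b := v _ _; have := sqr_ge0 (a / 2 + b); nra.
Qed.

Lemma measurable_enorm : measurable_fun setT (@enorm R n : borelV R n -> R).
Proof.
have ms : measurable_fun setT (Num.sqrt : R -> R).
  exact: continuous_measurable_fun (@sqrt_continuous R).
have mh : measurable_fun setT (fun v : borelV R n => \sum_i (v : 'rV[R]_n) ord0 i ^+ 2).
  by apply: measurable_sum => i; apply: measurable_funX; exact: measurable_coord.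
exact: (measurableT_comp ms mh).
Qed.

End Enorm.
#[global] Hint Extern 0 (is_true (0 <= enorm _)) => exact: enorm_ge0 : core.

(** * Gaussian kernels *)

Section Gauss.
Variables (R : realType) (n : nat).
Implicit Types x y z : 'rV[R]_n.
Notation mu := (lebV R n).

(** The heat kernel at time d/(4 pi): it has mass 1, and its exponential is the Gaussian factor in
    the formula for [bessel_kernel]. *)
Definition gaussV (d : R) y := d `^ (- (n%:R / 2)) * expR (- pi * enorm y ^+ 2 / d).

Lemma gaussV_ge0 d y : 0 <= gaussV d y.
Proof. by rewrite mulr_ge0 ?powR_ge0 ?expR_ge0. Qed.

Lemma gaussVN d y : gaussV d (- y) = gaussV d y.
Proof. by rewrite /gaussV enormN. Qed.

Lemma gaussVB d x y : gaussV d (x - y) = gaussV d (y - x).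
Proof. by rewrite -gaussVN opprB. Qed.

Lemma measurable_gaussV d : measurable_fun setT (gaussV d : borelV R n -> R).
Proof.
apply: measurable_funM => //; apply: measurableT_comp => //.
apply: measurable_funM => //; apply: measurable_funM => //.
by apply: measurable_funX; exact: measurable_enorm.
Qed.

Lemma integral_gauss1 (d : R) : 0 < d ->
  (\int[lebesgue_measure]_t (d `^ (- (1 / 2)) * expR (- pi * t ^+ 2 / d))%:E = 1)%E.
Proof.
move=> d0; have pi0 : 0 < pi :> R := pi_gt0 R.
(* The integrand is the centred normal density of variance d/(2 pi). *)
pose s := Num.sqrt (d / (pi *+ 2)).
have s2 : s ^+ 2 = d / (pi *+ 2).
  by rewrite sqr_sqrtr//; apply: divr_ge0; [exact: ltW|exact/mulrn_wge0/ltW].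
have s0 : s != 0.
  by rewrite gt_eqF// sqrtr_gt0 divr_gt0// mulrn_wgt0.
have E (r : R) : - pi * r ^+ 2 / d = - r ^+ 2 / (d / (pi *+ 2) *+ 2).
  have dn : d != 0 by rewrite gt_eqF.
  move: (pi : R) pi0 => p p0; have pn : p != 0 by rewrite gt_eqF.
  by rewrite -[p *+ 2]mulr_natr -[_ / _ *+ 2]mulr_natr; field; rewrite ?dn ?pn.
rewrite -(integral_normal_pdf 0 s); apply: eq_integral => t _.
rewrite normal_pdfE// /normal_peak /normal_fun s2 subr0; congr (_ * expR _)%:E.
  rewrite powRN div1r powR12_sqrt ?ltW//; congr (Num.sqrt _)^-1.
  by rewrite -mulrnAr divfK// mulrn_eq0/= gt_eqF.
exact: E.
Qed.

Lemma gaussV_prod d y : 0 < d ->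
  gaussV d y = \prod_i (d `^ (- (1 / 2)) * expR (- pi * y ord0 i ^+ 2 / d)).
Proof.
move=> d0; rewrite big_split/= prodr_const card_ord -expR_sum; congr (_ * expR _).
  rewrite -powR_mulrn ?powR_ge0// -powRrM; congr (_ `^ _); by field.
by rewrite -mulr_suml -mulr_sumr -enorm_sqr.
Qed.

Lemma ge0_integral_gaussV d : 0 < d -> (\int[mu]_y (gaussV d y)%:E = 1)%E.
Proof.
move=> d0; rewrite -iintE; last 2 first.
- by apply/measurable_EFinP; exact: measurable_gaussV.
- by move=> x; rewrite lee_fin gaussV_ge0.
under [X in iint X]eq_fun do rewrite gaussV_prod//.
rewrite (iint_prod _ (phi := fun t => d `^ (- (1 / 2)) * expR (- pi * t ^+ 2 / d))).
- by rewrite integral_gauss1//; elim: (n) => // k IH; rewrite expeS IH mul1e.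
- apply: measurable_funM => //; apply: measurableT_comp => //.
  by apply: measurable_funM => //; apply: measurable_funM => //; exact: measurable_funX.
- by move=> t; rewrite mulr_ge0 ?powR_ge0 ?expR_ge0.
Qed.

Lemma integrable_gaussV d x : 0 < d ->
  mu.-integrable setT (fun y => (gaussV d (x - (y : 'rV[R]_n)))%:E).
Proof.
move=> d0; apply: (@eq_integrable _ _ _ mu setT measurableT (fun y => (gaussV d ((y : 'rV[R]_n) - x))%:E)) => //.
  by move=> y _; rewrite gaussVB.
apply: (integrable_shift (- x)); apply: ge0_integrable.
- exact: measurable_gaussV.
- by move=> y; exact: gaussV_ge0.
- by rewrite ge0_integral_gaussV// ltry.
Qed.

Lemma Rintegral_gaussV d x : 0 < d -> \int[mu]_y gaussV d (x - (y : 'rV[R]_n)) = 1.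
Proof.
move=> d0; under eq_Rintegral do rewrite gaussVB.
rewrite (Rintegral_shift (- x) (measurable_gaussV d)).
by rewrite /Rintegral ge0_integral_gaussV.
Qed.

(** The square is completed in [y] by the parallelogram identity |x-y|^2 + |y-z|^2 = |x-z|^2/2 +
    2|(x+z)/2 - y|^2. The last factor has integral 1 in [y], so integrating gives the semigroup
    law. *)
Lemma gaussV_semigroup d x y z : 0 < d ->
  gaussV (d / 2) (x - y) * gaussV (d / 2) (y - z) =
  gaussV d (x - z) * gaussV (d / 4) (2^-1 *: (x + z) - y).
Proof.
move=> d0; rewrite /gaussV mulrACA -expRD [RHS]mulrACA -expRD; congr (_ * expR _).
  rewrite -!powRM ?divr_ge0// ?ltW//; congr (_ `^ _); by field.
rewrite -!mulrDl -!mulrDr.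
have -> : enorm (x - y) ^+ 2 + enorm (y - z) ^+ 2 =
   enorm (x - z) ^+ 2 / 2 + enorm (2^-1 *: (x + z) - y) ^+ 2 * 2.
  rewrite !enorm_sqr !mulr_suml -!big_split/=; apply: eq_bigr => i _.
  by rewrite !mxE; field.
by field; rewrite gt_eqF.
Qed.

Lemma gaussV_le d d' y : 0 < d -> d <= d' ->
  gaussV d y <= (d' / d) `^ (n%:R / 2) * gaussV d' y.
Proof.
move=> d0 dd'; have d'0 : 0 < d' by exact: lt_le_trans dd'.
rewrite /gaussV mulrA; apply: ler_pM; rewrite ?powR_ge0 ?expR_ge0//.
  rewrite powRM ?invr_ge0 ?(ltW d0) ?(ltW d'0)// mulrAC -powRD; last first.
    by rewrite (gt_eqF d'0) implybT.
  rewrite addrN powRr0 mul1r.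
  by rewrite -(powR_inv1 (ltW d0)) -powRrM mulN1r.
rewrite ler_expR !mulNr lerN2; apply: ler_wpM2l.
  by rewrite mulr_ge0 ?sqr_ge0// pi_ge0.
by rewrite lef_pV2.
Qed.

Lemma gaussV_shift_le d y z : 0 < d ->
  gaussV d (y + z) <= 2 `^ (n%:R / 2) * expR (pi * enorm z ^+ 2 / d) * gaussV (2 * d) y.
Proof.
move=> d0; rewrite /gaussV (powRM _ _ (ltW d0))// powRN [_ `^ (- (n%:R / 2))]powRN.
set c2 := 2 `^ _; set cd := d `^ _.
have c2n : c2 != 0 by rewrite gt_eqF// powR_gt0.
have cdn : 0 < cd by exact: powR_gt0.
rewrite (_ : c2 * _ * _ = cd^-1 * (expR (pi * enorm z ^+ 2 / d) * expR (- pi * enorm y ^+ 2 / (2 * d)))); last first.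
  by field; rewrite c2n gt_eqF.
rewrite -expRD ler_wpM2l ?invr_ge0 ?(ltW cdn)// ler_expR.
rewrite (_ : _ + _ = - (pi * ((enorm y ^+ 2 / 2 - enorm z ^+ 2) / d))); last first.
  by field; rewrite gt_eqF.
rewrite !mulNr lerN2 -mulrA ler_wpM2l ?pi_ge0// ler_wpM2r ?invr_ge0 ?(ltW d0)//.
exact: enormD_sqr_ge.
Qed.

Lemma expR_sub_le (p q : R) : `|expR (- p) - expR (- q)| <= `|p - q| * (expR (- p) + expR (- q)).
Proof.
wlog pq : p q / p <= q.
  move=> H; have [/H//|/ltW/H] := leP p q.
  by rewrite distrC [`|q - p|]distrC [expR (- q) + _]addrC.
have e : expR (- q) <= expR (- p) by rewrite ler_expR lerN2.
rewrite ger0_norm ?subr_ge0// ler0_norm ?subr_le0// opprB.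
apply: (@le_trans _ _ ((q - p) * expR (- p))); last first.
  by rewrite ler_wpM2l ?subr_ge0// lerDl expR_ge0.
rewrite (_ : - q = - p + - (q - p)); last by ring.
rewrite expRD -{1}[expR (- p)]mulr1 -mulrBr mulrC ler_wpM2r ?expR_ge0//.
have := expR_ge1Dx (- (q - p)); lra.
Qed.

Lemma mulr_expRN_le (c t : R) : 2 <= c -> t * expR (- (c / 4 * t ^+ 2)) <= 1.
Proof.
move=> c2; have := expR_ge1Dx (c / 4 * t ^+ 2); rewrite expRN => H.
have e0 := expR_gt0 (c / 4 * t ^+ 2).
rewrite ler_pdivrMr// mul1r; have := sqr_ge0 (t - 1); have := sqr_ge0 t; nra.
Qed.

(* [e^(-p) - e^(-q)] is at most [|p - q|] times the sum, and here [p - q] is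
   [4 pi y.z / d]: linear in [z], with the factor [y] absorbed by a wider Gaussian. *)
Lemma gaussV_diff_le (D : R) : exists2 C, 0 <= C & forall d y z, 0 < d -> enorm z <= D * Num.sqrt d ->
  `|gaussV d (y + z) - gaussV d (y - z)| <= C * (enorm z / Num.sqrt d) * gaussV (4 * d) y.
Proof.
have pi0 : 0 < pi :> R := pi_gt0 R.
pose K := expR (pi * D ^+ 2).
exists (4 * pi * (2 * (4 `^ (n%:R / 2)) * K)).
  by rewrite !mulr_ge0 ?powR_ge0 ?expR_ge0 ?(ltW pi0).
move=> d y z d0 zD; set s := Num.sqrt d.
have s0 : 0 < s by rewrite sqrtr_gt0.
have ds : d = s ^+ 2 by rewrite sqr_sqrtr ?ltW.
have D0 : 0 <= D by rewrite -(pmulr_lge0 _ s0) (le_trans _ zD).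
rewrite {1 2}/gaussV -mulrBr normrM ger0_norm ?powR_ge0//.
set p := pi * enorm (y + z) ^+ 2 / d; set q := pi * enorm (y - z) ^+ 2 / d.
rewrite !mulNr -/p -/q.
have pq : `|p - q| <= 4 * pi * (enorm y / s) * (enorm z / s).
  rewrite /p /q enormD_sqr enormB_sqr ds.
  rewrite (_ : _ - _ = 4 * pi / s ^+ 2 * dotV y z); last by field; rewrite gt_eqF.
  have c0 : 0 <= 4 * pi / s ^+ 2 by rewrite divr_ge0 ?sqr_ge0// mulr_ge0 ?(ltW pi0).
  rewrite normrM (ger0_norm c0).
  rewrite (_ : 4 * pi * _ * _ = 4 * pi / s ^+ 2 * (enorm y * enorm z)); last by field; rewrite gt_eqF.
  by rewrite ler_wpM2l ?dotV_le.
have ez w : enorm w = enorm z -> expR (- (pi * enorm (y + w) ^+ 2 / d)) <=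
    K * expR (- (pi * enorm y ^+ 2 / (2 * d))).
  move=> wz; rewrite -expRD ler_expR.
  have : enorm y ^+ 2 / 2 - (D * s) ^+ 2 <= enorm (y + w) ^+ 2.
    apply: le_trans (enormD_sqr_ge y w); rewrite lerD2l lerN2 wz.
    by apply: lerXn2r => //; rewrite nnegrE// mulr_ge0// ltW.
  rewrite exprMn -ds => H.
  rewrite (_ : _ - _ = - (pi * (enorm y ^+ 2 / 2 - D ^+ 2 * d) / d)); last first.
    by field; rewrite gt_eqF.
  by rewrite lerN2 ler_wpM2r ?invr_ge0 ?(ltW d0)// ler_wpM2l ?(ltW pi0).
have ep : expR (- p) <= K * expR (- (pi * enorm y ^+ 2 / (2 * d))) by exact: ez.
have eq : expR (- q) <= K * expR (- (pi * enorm y ^+ 2 / (2 * d))).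
  by apply: ez; rewrite enormN.
have ys : enorm y / s * expR (- (pi * enorm y ^+ 2 / (2 * d))) <=
          expR (- (pi * enorm y ^+ 2 / (4 * d))).
  rewrite (_ : - (pi * enorm y ^+ 2 / (2 * d)) = - (pi * enorm y ^+ 2 / (4 * d)) +
     - (pi * enorm y ^+ 2 / (4 * d))); last by field; rewrite gt_eqF.
  rewrite expRD mulrA ler_piMl ?expR_ge0//.
  rewrite (_ : pi * _ / _ = pi / 4 * (enorm y / s) ^+ 2); last first.
    by rewrite ds; field; rewrite gt_eqF.
  exact: mulr_expRN_le (pi_ge2 R).
rewrite {}/gaussV (powRM _ _ (ltW d0))// !powRN.
set c4 := 4 `^ _; set cd := d `^ _.
have c40 : 0 < c4 by rewrite powR_gt0.
have cd0 : 0 < cd by exact: powR_gt0.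
have K0 : 0 < K by exact: expR_gt0.
rewrite (_ : _ * (c4^-1 / cd * _) = cd^-1 * (4 * pi * (enorm z / s) * (2 * K * expR (- pi * enorm y ^+ 2 / (4 * d))))); last first.
  by field; rewrite !gt_eqF.
rewrite ler_wpM2l ?invr_ge0 ?(ltW cd0)//.
apply: (le_trans (expR_sub_le p q)).
apply: (@le_trans _ _ (4 * pi * (enorm y / s) * (enorm z / s) * (2 * K * expR (- (pi * enorm y ^+ 2 / (2 * d)))))).
  apply: ler_pM => //; lra.
rewrite (_ : 4 * pi * (enorm y / s) * (enorm z / s) * _ = 4 * pi * (enorm z / s) * (2 * K * (enorm y / s * expR (- (pi * enorm y ^+ 2 / (2 * d)))))); last by ring.
apply: ler_wpM2l.
  by apply: mulr_ge0; [exact: mulr_ge0 (ltW pi0)|exact: divr_ge0 (ltW s0)].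
apply: ler_wpM2l; first exact: mulr_ge0 (ltW K0).
by rewrite !mulNr.
Qed.

End Gauss.

(** * Integrals of tensor products *)

Section Tensor.
Context d1 d2 (T1 : measurableType d1) (T2 : measurableType d2) (R : realType).
Variable m1 : {sigma_finite_measure set T1 -> \bar R}.
Variable m2 : {sigma_finite_measure set T2 -> \bar R}.

Lemma measurable_tensor (a : T1 -> R) (b : T2 -> R) :
  measurable_fun setT a -> measurable_fun setT b ->
  measurable_fun setT (fun p : T1 * T2 => a p.1 * b p.2).
Proof.
move=> ma mb; apply: measurable_funM.
- exact: (measurableT_comp ma measurable_fst).
- exact: (measurableT_comp mb measurable_snd).
Qed.

Lemma ge0_integral_tensor (a : T1 -> R) (b : T2 -> R) :
  measurable_fun setT a -> measurable_fun setT b ->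
  (forall x, 0 <= a x) -> (forall x, 0 <= b x) ->
  (\int[m1 \x m2]_p (a p.1 * b p.2)%:E =
   \int[m1]_x (a x)%:E * \int[m2]_x (b x)%:E)%E.
Proof.
move=> ma mb a0 b0.
rewrite (fubini_tonelli1 (fun p => (a p.1 * b p.2)%:E)); last 2 first.
- by apply/measurable_EFinP; exact: measurable_tensor.
- by move=> p; rewrite lee_fin mulr_ge0.
rewrite -ge0_integralZr//; last 3 first.
- exact/measurable_EFinP.
- by move=> x _; rewrite lee_fin.
- by apply: integral_ge0 => x _; rewrite lee_fin.
apply: eq_integral => x _; rewrite /fubini_F/=.
under eq_integral do rewrite EFinM.
rewrite ge0_integralZl_EFin//; last exact/measurable_EFinP.
by move=> y _; rewrite lee_fin.
Qed.

End Tensor.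

(** * Volumes of balls, boxes and unit cubes *)

Section Volumes.
Variables (R : realType) (n : nat).
Notation mu := (lebV R n).
Notation V := (borelV R n).

Lemma measurable_subr_borelV (x : 'rV[R]_n) :
  measurable_fun setT ((fun y => x - y) : V -> V).
Proof.
apply: measurable_rV => i; under eq_fun do rewrite !mxE.
by apply: measurable_funB => //; exact: measurable_coord.
Qed.

Lemma measurable_eball (x : 'rV[R]_n) r : measurable (eball x r : set V).
Proof.
have -> : eball x r = [set y : V | (enorm ((y : 'rV[R]_n) - x) < r)%R] by [].
have m : measurable_fun setT (fun y : V => enorm ((y : 'rV[R]_n) - x)).
  exact: (measurableT_comp (@measurable_enorm R n) (measurable_addr_borelV (- x))).
rewrite -[X in measurable X]setTI.
rewrite (_ : [set y | _] = (fun y : V => enorm ((y : 'rV[R]_n) - x)) @^-1` `]-oo, r[%classic).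
  exact: m.
by apply/seteqP; split=> y/=; rewrite in_itv.
Qed.

Lemma measurable_ucube (k : 'rV[int]_n) : measurable (@ucube R n k : set V).
Proof.
have -> : @ucube R n k = \bigcap_(i in [set: 'I_n])
    ((fun y : V => (y : 'rV[R]_n) ord0 i) @^-1` `[(k ord0 i)%:~R, (k ord0 i)%:~R + 1[%classic).
  apply/seteqP; split=> y /=.
    by move=> yk i _; rewrite /= in_itv/=; exact: yk.
  by move=> yk i; have := yk i I; rewrite /= in_itv/=.
apply: fin_bigcap_measurable => // i _.
by rewrite -[X in measurable X]setTI; exact: (@measurable_coord R n i).
Qed.

Lemma lebV_iint (A : set V) : measurable A -> mu A = iint (fun y : V => (\1_A y)%:E).
Proof.
move=> mA; rewrite iintE; last 2 first.
- exact/measurable_EFinP/measurable_indic.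
- by move=> x; rewrite lee_fin indicE.
by rewrite integral_indic// setIT.
Qed.

Definition box (r : R) : set 'rV[R]_n := [set y | forall i, `|y ord0 i| < r].

Lemma indic_box r (y : 'rV[R]_n) : \1_(box r) y = \prod_i (\1_(`]- r, r[%classic : set R) (y ord0 i)) :> R.
Proof.
rewrite indicE; case: (boolP (y \in box r)) => [/set_mem yb|yb].
  rewrite big1// => i _; rewrite indicE mem_set//= in_itv/=.
  by have := yb i; rewrite ltr_norml.
have [i yi] : exists i, ~ `|y ord0 i| < r.
  by apply/existsNP => H; move: yb; rewrite mem_set.
apply/esym/eqP/prodf_eq0; exists i => //; rewrite indicE memNset//= in_itv/=.
by move: yi; rewrite ltr_norml.
Qed.

Lemma measurable_box r : measurable (box r : set V).
Proof.
apply/(@measurable_indicP _ _ R); rewrite (_ : \1_ _ = fun y : V => \prod_i (\1_(`]- r, r[%classic : set R) ((y : 'rV[R]_n) ord0 i))).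
  apply: measurable_prod => i _.
  have mi : measurable_fun setT (\1_(`]- r, r[%classic : set R) : R -> R) by exact: measurable_indic.
  exact: (measurableT_comp mi (@measurable_coord R n i)).
by apply/funext => y; rewrite indic_box.
Qed.

Lemma lebV_box r : 0 < r -> mu (box r) = ((2 * r) ^+ n)%:E.
Proof.
move=> r0; rewrite lebV_iint; last exact: measurable_box.
rewrite (_ : iint _ = iint (fun v : 'rV[R]_n => (\prod_i (\1_(`]- r, r[%classic : set R) (v ord0 i)))%:E)); last first.
  by congr iint; apply/funext => v; rewrite indic_box.
rewrite iint_prod//; last first.
have -> : (\int[lebesgue_measure]_x (\1_(`]- r, r[%classic : set R) x)%:E = (2 * r)%:E)%E.
  rewrite integral_indic// setIT.
  apply: (etrans (@lebesgue_measure_itv R `]- r, r[)).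
  by rewrite /= lte_fin ifT -?EFinD; [congr EFin; ring|lra].
by rewrite EFin_expe.
Qed.

Lemma lebV_shift (A : set V) (a : 'rV[R]_n) : measurable A ->
  mu ((fun y : V => ((y : 'rV[R]_n) + a : V)) @^-1` A) = mu A.
Proof.
move=> mA.
have mA' : measurable ((fun y : V => ((y : 'rV[R]_n) + a : V)) @^-1` A).
  by rewrite -[X in measurable X]setTI; exact: measurable_addr_borelV.
rewrite !lebV_iint// -(iint_shift (f := fun y => (\1_A y)%:E) a)//.
exact/measurable_EFinP/measurable_indic.
Qed.

Lemma eball_shift (x : 'rV[R]_n) r :
  eball x r = (fun y : V => ((y : 'rV[R]_n) + - x : V)) @^-1` (eball 0 r).
Proof. by apply/seteqP; split=> y; rewrite /eball/= subr0. Qed.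

Lemma lebV_eball_le (x : 'rV[R]_n) r : 0 < r -> (mu (eball x r) <= ((2 * r) ^+ n)%:E)%E.
Proof.
move=> r0; rewrite eball_shift lebV_shift; last exact: measurable_eball.
rewrite -lebV_box//; apply: le_measure; rewrite ?inE.
- exact: measurable_eball.
- exact: measurable_box.
- move=> y; rewrite /eball/= subr0 => yr i.
  by rewrite (le_lt_trans _ yr)// coord_le_enorm.
Qed.

Lemma lebV_eball_gt0 (x : 'rV[R]_n) r : 0 < r -> (0 < mu (eball x r))%E.
Proof.
move=> r0; rewrite eball_shift lebV_shift; last exact: measurable_eball.
(* The box of half-side r/c lies in the ball because |y| <= sqrt n * (r/c); the added 1 makes this
   strictly less than r and keeps [c] positive when n = 0. *)
set c : R := Num.sqrt n%:R + 1.
have c0 : 0 < c by rewrite ltr_wpDl ?sqrtr_ge0.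
have rc : 0 < r / c by rewrite divr_gt0.
apply: (@lt_le_trans _ _ (mu (box (r / c)))).
  by rewrite lebV_box// lte_fin exprn_gt0// mulr_gt0.
apply: le_measure; rewrite ?inE.
- exact: measurable_box.
- exact: measurable_eball.
- move=> y yr; rewrite /eball/= subr0.
  have yi i : `|y ord0 i| <= r / c by apply/ltW/yr.
  apply: (le_lt_trans (enorm_le_coord (ltW rc) yi)).
  by rewrite mulrA ltr_pdivrMr// mulrC ltr_pM2l// /c ltrDl.
Qed.

Lemma vol_eballE (x : 'rV[R]_n) r : vol (eball x r) = fine (mu (eball x r)).
Proof.
by rewrite /vol -lebV_iint//; exact: measurable_eball.
Qed.

Lemma lebV_eballE (x : 'rV[R]_n) r : 0 < r -> mu (eball x r) = (vol (eball x r))%:E.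
Proof.
move=> r0; rewrite vol_eballE fineK// ge0_fin_numE//.
by rewrite (le_lt_trans (lebV_eball_le x r0))// ltry.
Qed.

Lemma vol_eball_gt0 (x : 'rV[R]_n) r : 0 < r -> 0 < vol (eball x r).
Proof. by move=> r0; rewrite -lte_fin -lebV_eballE//; exact: lebV_eball_gt0. Qed.

Lemma vol_eball_le (x : 'rV[R]_n) r : 0 < r -> vol (eball x r) <= (2 * r) ^+ n.
Proof. by move=> r0; rewrite -lee_fin -lebV_eballE//; exact: lebV_eball_le. Qed.

Lemma lebV_ucube (k : 'rV[int]_n) : mu (@ucube R n k) = 1%E.
Proof.
have -> : @ucube R n k = (fun y : V => ((y : 'rV[R]_n) + - (map_mx intr k : 'rV[R]_n) : V)) @^-1`
    (@ucube R n 0).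
  apply/seteqP; split=> y /= yk i; have := yk i; rewrite !mxE; lra.
rewrite lebV_shift; last exact: measurable_ucube.
pose phi : R -> R := \1_(`[0, 1[%classic : set R).
have E (v : 'rV[R]_n) : \1_(@ucube R n 0) v = \prod_i phi (v ord0 i) :> R.
  rewrite indicE; case: (boolP (v \in _)) => [/set_mem yb|yb].
    rewrite big1// => i _; rewrite /phi indicE mem_set//= in_itv/=.
    by have := yb i; rewrite mxE add0r.
  have [i yi] : exists i, ~ (0 <= v ord0 i < 1).
    apply/existsNP => H; move: yb; rewrite mem_set// => i; rewrite mxE add0r; exact: H.
  apply/esym/eqP/prodf_eq0; exists i => //; rewrite /phi indicE memNset//= in_itv/=.
rewrite lebV_iint; last exact: measurable_ucube.
rewrite (_ : iint _ = iint (fun v : 'rV[R]_n => (\prod_i phi (v ord0 i))%:E)); last first.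
  by congr iint; apply/funext => v; rewrite E.
rewrite iint_prod//; last exact: measurable_indic.
have -> : (\int[lebesgue_measure]_x (phi x)%:E = 1%:E)%E.
  rewrite /phi integral_indic// setIT.
  apply: (etrans (@lebesgue_measure_itv R `[0, 1[)).
  by rewrite /= lte_fin ltr01 -EFinD subr0.
by rewrite -EFin_expe expr1n.
Qed.

Lemma ucube_floor (x : 'rV[R]_n) : @ucube R n (\row_i Num.floor (x ord0 i)) x.
Proof. by move=> i; rewrite mxE; have := floor_itv (x ord0 i); rewrite intrD. Qed.

Lemma ucube_enorm (k : 'rV[int]_n) x y : @ucube R n k x -> @ucube R n k y ->
  enorm (x - y) ^+ 2 <= n%:R.
Proof.
move=> xk yk; rewrite enorm_sqr -[n in leRHS]card_ord -sumr_const.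
apply: ler_sum => i _; rewrite !mxE; have := xk i; have := yk i => ? ?; nra.
Qed.

End Volumes.

(** * Oscillation bounds against Gaussian weights *)

Section Oscillation.
Variables (R : realType) (n : nat).
Notation mu := (lebV R n).
Notation V := (borelV R n).
Implicit Types (g : V -> R) (x : 'rV[R]_n).

(** The form in which bmo is used. Oscillation on a ball is a double integral, so no average occurs,
    and it is normalised by the squared volume of the circumscribed cube, a pure power of [r]. The
    last clause fixes the size at unit scale. *)
Definition tame (M : R) g := [/\ 0 <= M, measurable_fun setT g,
  forall x r, 0 < r ->
    (\int[mu \x mu]_p (\1_(eball x r) p.1 * \1_(eball x r) p.2 * `|g p.1 - g p.2|)%:E
     <= (M * (2 * r) ^+ (n + n))%:E)%E &
  forall k, (\int[mu]_y (\1_(@ucube R n k) y * `|g y|)%:E <= M%:E)%E].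

Lemma measurable_diff2 g : measurable_fun setT g ->
  measurable_fun setT (fun p : V * V => `|g p.1 - g p.2|).
Proof.
move=> mg; apply: measurableT_comp => //; apply: measurable_funB.
- exact: (measurableT_comp mg measurable_fst).
- exact: (measurableT_comp mg measurable_snd).
Qed.

Lemma measurable_indic_eball x r : measurable_fun setT (\1_(eball x r) : V -> R).
Proof. by apply: measurable_indic; exact: measurable_eball. Qed.

Lemma measurable_indic_ucube k : measurable_fun setT (\1_(@ucube R n k) : V -> R).
Proof. by apply: measurable_indic; exact: measurable_ucube. Qed.

Lemma indic_ge0 (T : Type) (A : set T) y : 0 <= \1_A y :> R.
Proof. by rewrite indicE. Qed.
#[local] Hint Extern 0 (is_true (0 <= \1__ _)) => exact: indic_ge0 : core.

Lemma tame_norm M g : tame M g -> tame M (fun y => `|g y|).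
Proof.
move=> [M0 mg og cg]; split => //; first exact: measurableT_comp.
- move=> x r r0; apply: le_trans (og x r r0).
  apply: ge0_le_integral => //.
  + apply/measurable_EFinP; apply: measurable_funM; first by apply: measurable_tensor; exact: measurable_indic_eball.
    by apply: (@measurable_diff2 (fun y => `|g y|)); exact: measurableT_comp.
  + apply/measurable_EFinP; apply: measurable_funM; first by apply: measurable_tensor; exact: measurable_indic_eball.
    exact: measurable_diff2.
  + by move=> p _; rewrite lee_fin ler_wpM2l ?mulr_ge0// ler_dist_dist.
- by move=> k; under eq_integral do rewrite normr_id.
Qed.

Lemma exprn_le_expR (N : nat) (t : R) : 0 <= t -> t ^+ N <= N.+1%:R ^+ N * expR t.
Proof.
move=> t0; have N0 : 0 < N.+1%:R :> R by [].
have tN : t <= N.+1%:R * expR (t / N.+1%:R).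
  have := expR_ge1Dx (t / N.+1%:R) => H.
  by rewrite mulrC -ler_pdivrMr//; apply: le_trans H; rewrite lerDr.
apply: (@le_trans _ _ ((N.+1%:R * expR (t / N.+1%:R)) ^+ N)).
  by rewrite lerXn2r ?nnegrE// mulr_ge0// expR_ge0.
rewrite exprMn ler_wpM2l ?exprn_ge0// -expRM_natl ler_expR.
rewrite mulrA ler_pdivrMr// mulrC ler_wpM2l// ler_nat//.
Qed.

(** Gaussian decay against the polynomial growth of the volumes of concentric balls. The dyadic
    right-hand side is the form that [epsilon_trick0] sums. *)
Lemma layer_sum_bound : exists2 C : R, 0 <= C & forall k : nat,
  expR (- (pi * k%:R ^+ 2)) * (2 * k.+1%:R) ^+ (n + n) <= C / (2 ^ k.+1)%:R.
Proof.
set N := (n + n)%N.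
exists (2 ^+ N * N.+1%:R ^+ N * expR 2); first by rewrite !mulr_ge0 ?exprn_ge0 ?expR_ge0.
move=> k; have e0 := expR_gt0 (pi * k%:R ^+ 2 : R).
have T0 : 0 < 2 ^+ k.+1 :> R by exact: exprn_gt0.
rewrite natrX expRN; set c := _ * expR 2.
suff H : (2 * k.+1%:R) ^+ N * 2 ^+ k.+1 <= expR (pi * k%:R ^+ 2) * c.
  by rewrite ler_pdivlMr// -mulrA ler_pdivrMl.
rewrite exprMn /c.
have h1 := exprn_le_expR N (ler0n R k.+1).
have h2 : 2 ^+ k.+1 <= expR k.+1%:R :> R.
  rewrite -[k.+1%:R]mulr1 expRM_natl lerXn2r ?nnegrE ?expR_ge0//.
  by have := expR_ge1Dx (1 : R); lra.
(* Here 2(k+1) <= pi k^2 + 2, since pi >= 2 and k <= k^2 for integers. *)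
have h3 : expR k.+1%:R * expR k.+1%:R <= expR (pi * k%:R ^+ 2) * expR 2 :> R.
  rewrite -!expRD ler_expR.
  have kk : k%:R <= k%:R ^+ 2 :> R by rewrite -natrX ler_nat; case: (k) => // j; rewrite expnS leq_pmulr.
  have := pi_ge2 R; rewrite -natr1; nra.
apply: (@le_trans _ _ (2 ^+ N * (N.+1%:R ^+ N * expR k.+1%:R) * expR k.+1%:R)).
  by rewrite -[leLHS]mulrA -[leRHS]mulrA ler_wpM2l ?exprn_ge0// ler_pM ?exprn_ge0.
rewrite (_ : 2 ^+ N * _ * _ = 2 ^+ N * N.+1%:R ^+ N * (expR k.+1%:R * expR k.+1%:R)); last by ring.
rewrite [leRHS]mulrCA.
by rewrite ler_wpM2l// mulr_ge0 ?exprn_ge0.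
Qed.

(* With [k] the integer part of the larger of the two scaled distances. *)
Lemma gaussV_tensor_layer d x (y z : 'rV[R]_n) : 0 < d -> exists k : nat,
  gaussV d (x - y) * gaussV d (x - z) <=
  expR (- (pi * k%:R ^+ 2)) * d^-1 ^+ n *
  (\1_(eball x (k.+1%:R * Num.sqrt d)) y * \1_(eball x (k.+1%:R * Num.sqrt d)) z).
Proof.
move=> d0; set s := Num.sqrt d; have s0 : 0 < s by rewrite sqrtr_gt0.
have ds : d = s ^+ 2 by rewrite sqr_sqrtr ?ltW.
set a := enorm (x - y) / s; set b := enorm (x - z) / s.
have a0 : 0 <= a by rewrite divr_ge0 ?(ltW s0).
have b0 : 0 <= b by rewrite divr_ge0 ?(ltW s0).
exists (Num.truncn (Num.max a b)).
have m0 : 0 <= Num.max a b by rewrite le_max a0.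
have /andP[km mk] := truncn_itv m0.
set k := Num.truncn _ in km mk *.
have yb : eball x (k.+1%:R * s) y.
  rewrite /eball/= enormB -ltr_pdivrMr//; apply: le_lt_trans mk.
  by rewrite le_max lexx.
have zb : eball x (k.+1%:R * s) z.
  rewrite /eball/= enormB -ltr_pdivrMr//; apply: le_lt_trans mk.
  by rewrite le_max lexx orbT.
rewrite !indicE !mem_set// !mulr1 /gaussV mulrACA -powRD; last first.
  by rewrite (gt_eqF d0) implybT.
rewrite (_ : - (n%:R / 2) + _ = - n%:R); last by field.
rewrite powR_invn ?(ltW d0)// exprVn mulrC ler_wpM2r ?invr_ge0 ?exprn_ge0 ?(ltW d0)//.
rewrite -expRD ler_expR.
have -> : - pi * enorm (x - y) ^+ 2 / d + - pi * enorm (x - z) ^+ 2 / d = - (pi * (a ^+ 2 + b ^+ 2)).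
  by rewrite /a /b ds; field; rewrite gt_eqF.
rewrite lerN2 ler_wpM2l ?pi_ge0//.
apply: (@le_trans _ _ (Num.max a b ^+ 2)); first by rewrite lerXn2r ?nnegrE.
by case: (leP a b) => _; rewrite ?lerDr ?lerDl sqr_ge0.
Qed.

(** The product of the two weights is dominated by a sum over concentric balls of radius (k+1) sqrt
    d, and on each of them [tame] controls the oscillation. The factor d^(-n) cancels against the
    volumes, so the bound is uniform in [d]. *)
Lemma gauss_osc : exists2 C : R, 0 <= C & forall M g x d, tame M g -> 0 < d ->
  (\int[mu \x mu]_p (gaussV d (x - (p.1 : 'rV[R]_n)) * gaussV d (x - (p.2 : 'rV[R]_n)) *
     `|g p.1 - g p.2|)%:E <= (C * M)%:E)%E.
Proof.
have [C C0 HC] := layer_sum_bound; exists C => // M g x d [M0 mg og _] d0.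
have mG : measurable_fun setT (fun y : V => gaussV d (x - (y : 'rV[R]_n))).
  exact: (measurableT_comp (@measurable_gaussV R n d) (measurable_subr_borelV x)).
set s := Num.sqrt d; have s0 : 0 < s by rewrite sqrtr_gt0.
have ds : d = s ^+ 2 by rewrite sqr_sqrtr ?ltW.
pose c (k : nat) : R := expR (- (pi * k%:R ^+ 2)) * d^-1 ^+ n.
have c0 k : 0 <= c k by rewrite mulr_ge0 ?expR_ge0// exprn_ge0// invr_ge0 ltW.
pose B k := eball x (k.+1%:R * s).
pose h k (p : V * V) := \1_(B k) p.1 * \1_(B k) p.2 * `|g p.1 - g p.2|.
have mh k : measurable_fun setT (h k).
  apply: measurable_funM; first by apply: measurable_tensor; exact: measurable_indic_eball.
  exact: measurable_diff2.
have h0 k p : 0 <= h k p by rewrite !mulr_ge0.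
have mch k : measurable_fun setT (fun p => (c k * h k p)%:E).
  by apply/measurable_EFinP; apply: measurable_funM.
apply: (@le_trans _ _ (\int[mu \x mu]_p (\sum_(0 <= k <oo) (c k * h k p)%:E))%E).
  apply: ge0_le_integral => //.
  - by move=> p _; rewrite lee_fin; apply: mulr_ge0 => //; apply: mulr_ge0; exact: gaussV_ge0.
  - apply/measurable_EFinP; apply: measurable_funM; first exact: (measurable_tensor mG mG).
    exact: measurable_diff2.
  - by apply: ge0_emeasurable_sum => [k p _ _|k _]; [rewrite lee_fin mulr_ge0|exact: mch].
  - move=> p _; have [k Hk] := gaussV_tensor_layer x p.1 p.2 d0.
    apply: le_trans (nneseries_lim_ge k.+1 _); last by move=> *; rewrite lee_fin mulr_ge0.
    rewrite big_nat_recr//=; apply: (@le_trans _ _ (c k * h k p)%:E).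
      by rewrite lee_fin /h [leRHS]mulrA; apply: ler_wpM2r.
    by rewrite leeDr// sume_ge0// => *; rewrite lee_fin mulr_ge0.
rewrite integral_nneseries//; last by move=> *; rewrite lee_fin mulr_ge0.
apply: (@le_trans _ _ (\sum_(0 <= k <oo) (M * C / (2 ^ k.+1)%:R)%:E)%E); last first.
  by rewrite mulrC; apply: epsilon_trick0; rewrite mulr_ge0.
apply: lee_nneseries => [k _ _|k _].
  by apply: integral_ge0 => p _; rewrite lee_fin mulr_ge0.
under eq_integral do rewrite EFinM.
rewrite ge0_integralZl_EFin//; last by exact/measurable_EFinP.
apply: (@le_trans _ _ ((c k)%:E * (M * (2 * (k.+1%:R * s)) ^+ (n + n))%:E)%E).
  by rewrite lee_wpmul2l ?lee_fin//; apply: og; rewrite mulr_gt0.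
rewrite -EFinM lee_fin mulrCA -mulrA ler_wpM2l//.
apply: le_trans (HC k); rewrite /c ds le_eqVlt; apply/orP; left; apply/eqP.
rewrite !exprMn !exprD; set e := expR _.
have sn0 : s ^+ n != 0 by rewrite expf_neq0// gt_eqF.
- by rewrite exprVn -exprM mulnC exprM exprS expr1; field.
- by move=> p _; rewrite lee_fin.
Qed.

End Oscillation.

(** * Gaussian averages of tame functions *)

Section GaussAverage.
Variables (R : realType) (n : nat).
Notation mu := (lebV R n).
Notation V := (borelV R n).
Implicit Types (g A B : V -> R) (x z h : 'rV[R]_n).

Lemma measurable_gaussVx d x : measurable_fun setT (fun y : V => gaussV d (x - (y : 'rV[R]_n))).
Proof. exact: (measurableT_comp (@measurable_gaussV R n d) (measurable_subr_borelV x)). Qed.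

Lemma ge0_integral_gaussVx d x : 0 < d -> (\int[mu]_y (gaussV d (x - (y : 'rV[R]_n)))%:E = 1)%E.
Proof.
by move=> d0; rewrite integrable_EFinK ?Rintegral_gaussV//; exact: integrable_gaussV.
Qed.

(** Reciprocal of the Gaussian at distance sqrt n, the diameter of a unit cube. *)
Definition cubec (d : R) := d `^ (n%:R / 2) * expR (pi * n%:R / d).

Lemma cubec_ge0 d : 0 <= cubec d.
Proof. by rewrite mulr_ge0 ?powR_ge0 ?expR_ge0. Qed.

Lemma indic_ucube_le d k x z : 0 < d -> @ucube R n k x ->
  \1_(@ucube R n k) z <= cubec d * gaussV d (x - z).
Proof.
move=> d0 xk; rewrite indicE; case: (boolP (z \in _)) => [/set_mem zk|_]; last first.
  by rewrite mulr_ge0 ?cubec_ge0 ?gaussV_ge0.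
rewrite /cubec /gaussV mulrACA -powRD; last by rewrite (gt_eqF d0) implybT.
rewrite addrN powRr0 mul1r -expRD; apply: le_trans (expR_ge1Dx _); rewrite lerDl.
rewrite (_ : _ + _ = pi * (n%:R - enorm (x - z) ^+ 2) / d); last by ring.
by rewrite divr_ge0 ?(ltW d0)// mulr_ge0 ?pi_ge0// subr_ge0; exact: ucube_enorm xk zk.
Qed.

(** From |g(y)| <= |g(y) - g(z)| + |g(z)| with [z] averaged over the unit cube containing [x]: the
    first term is an oscillation once the indicator of the cube is bounded by a Gaussian, the second
    is controlled by the size on cubes. *)
Lemma tame_gauss_le : exists2 C : R, 0 <= C & forall M g x d, tame M g -> 0 < d ->
  (\int[mu]_y (gaussV d (x - (y : 'rV[R]_n)) * `|g y|)%:E <= ((1 + C * cubec d) * M)%:E)%E.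
Proof.
have [C C0 HC] := @gauss_osc R n; exists C => // M g x d tg d0.
have [M0 mg og cg] := tg.
pose k := \row_i Num.floor (x ord0 i); pose Q : set V := @ucube R n k.
have xQ : Q x := ucube_floor x.
have mQ : measurable Q by exact: measurable_ucube.
have m1Q : measurable_fun setT (\1_Q : V -> R) by exact: measurable_indic.
pose P (y : V) := gaussV d (x - (y : 'rV[R]_n)).
have P0 y : 0 <= P y by exact: gaussV_ge0.
have mP : measurable_fun setT P by exact: measurable_gaussVx.
have mng : measurable_fun setT (fun y => `|g y|) by exact: measurableT_comp.
have mPg : measurable_fun setT (fun y => P y * `|g y|) by exact: measurable_funM.
have m1g : measurable_fun setT (fun y => \1_Q y * `|g y|) by exact: measurable_funM.
(* The indicator of a unit cube has integral 1, so it introduces the second variable for free. *)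
have -> : (\int[mu]_y (P y * `|g y|)%:E =
           \int[mu \x mu]_p (P p.1 * `|g p.1| * \1_Q p.2)%:E)%E.
  rewrite (ge0_integral_tensor _ _ (a := fun y => P y * `|g y|) (b := \1_Q))//.
  - have -> : (\int[mu]_y (\1_Q y)%:E = 1)%E by rewrite integral_indic// setIT; exact: lebV_ucube.
    by rewrite mule1.
  - by move=> y; rewrite mulr_ge0.
have mPP : measurable_fun setT (fun p : V * V => P p.1 * P p.2 * `|g p.1 - g p.2|).
  by apply: measurable_funM; [exact: (measurable_tensor mP mP)|exact: measurable_diff2].
have PP0 p : 0 <= P p.1 * P p.2 * `|g p.1 - g p.2| by rewrite mulr_ge0// mulr_ge0.
have mPQ : measurable_fun setT (fun p : V * V => P p.1 * (\1_Q p.2 * `|g p.2|)).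
  exact: (measurable_tensor mP m1g).
have PQ0 (p : V * V) : 0 <= P p.1 * (\1_Q p.2 * `|g p.2|) by rewrite mulr_ge0// mulr_ge0// indicE.
apply: (@le_trans _ _ (\int[mu \x mu]_p ((cubec d)%:E * (P p.1 * P p.2 * `|g p.1 - g p.2|)%:E +
    (P p.1 * (\1_Q p.2 * `|g p.2|))%:E))%E).
  apply: ge0_le_integral => //.
  - by move=> p _; rewrite lee_fin mulr_ge0// ?indicE// mulr_ge0.
  - by apply/measurable_EFinP; exact: (measurable_tensor mPg m1Q).
  - apply: emeasurable_funD; last exact/measurable_EFinP.
    by apply: measurable_funeM; exact/measurable_EFinP.
  - move=> p _; rewrite -EFinM -EFinD lee_fin.
    have i0 : 0 <= \1_Q p.2 :> R by rewrite indicE.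
    apply: (@le_trans _ _ (P p.1 * (\1_Q p.2 * `|g p.1 - g p.2|) + P p.1 * (\1_Q p.2 * `|g p.2|))).
      rewrite -mulrDr -mulrDr -mulrA ler_wpM2l// mulrC ler_wpM2l//.
      by rewrite -[X in `|X|](subrK (g p.2)) ler_normD.
    rewrite lerD2r [leRHS](_ : _ = P p.1 * (cubec d * P p.2 * `|g p.1 - g p.2|)); last by ring.
    by rewrite ler_wpM2l// ler_wpM2r//; exact: indic_ucube_le.
rewrite ge0_integralD//; last 4 first.
- by move=> p _; apply: mule_ge0; rewrite lee_fin; [exact: cubec_ge0|exact: PP0].
- by apply: measurable_funeM; exact/measurable_EFinP.
- by move=> p _; rewrite lee_fin; exact: PQ0.
- exact/measurable_EFinP.
rewrite ge0_integralZl_EFin ?cubec_ge0//; last exact/measurable_EFinP.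
rewrite (ge0_integral_tensor _ _ (a := P) (b := fun y => \1_Q y * `|g y|))//.
rewrite ge0_integral_gaussVx// mul1e mulrDl mul1r [(M + _)%R]addrC EFinD leeD//.
  rewrite (_ : C * cubec d * M = cubec d * (C * M)); last by ring.
  rewrite [leRHS]EFinM; apply: lee_wpmul2l; last exact: HC.
  by rewrite lee_fin cubec_ge0.
  exact: cg.
by move=> p _; rewrite lee_fin; exact: PP0.
Qed.

Definition gint g := measurable_fun setT g /\ forall d x, 0 < d ->
  mu.-integrable setT (fun y => (gaussV d (x - (y : 'rV[R]_n)) * g y)%:E).

Lemma tame_gint M g : tame M g -> gint g.
Proof.
move=> tg; have [M0 mg _ _] := tg; split=> // d x d0.
have [C C0 HC] := tame_gauss_le.
apply: (integrable_dom (g := fun y : V => gaussV d (x - (y : 'rV[R]_n)) * `|g y|)).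
- by apply: measurable_funM => //; exact: measurable_gaussVx.
- by move=> y; rewrite normrM ger0_norm ?gaussV_ge0.
- apply: ge0_integrable.
  + by apply: measurable_funM; [exact: measurable_gaussVx|exact: measurableT_comp].
  + by move=> y; rewrite mulr_ge0 ?gaussV_ge0.
  + by rewrite (le_lt_trans (HC _ _ _ _ tg d0))// ltry.
Qed.

Lemma gint_dom_integrable g A d x a : gint g -> measurable_fun setT A -> 0 < d ->
  (forall y, `|A y| <= a * gaussV d (x - y)) -> mu.-integrable setT (EFin \o (fun y => A y * g y)).
Proof.
move=> [mg ig] mA d0 Ale.
apply: (integrable_dom (g := fun y : V => a * (gaussV d (x - (y : 'rV[R]_n)) * `|g y|))).
- exact: measurable_funM.
- by move=> y; rewrite normrM mulrA ler_wpM2r.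
- apply: integrable_RZl; apply: eq_integrableR (integrable_Rnorm (ig d x d0)).
  by move=> y; rewrite normrM ger0_norm ?gaussV_ge0.
Qed.

Lemma dom_integrable A d x a : measurable_fun setT A -> 0 < d ->
  (forall y, `|A y| <= a * gaussV d (x - y)) -> mu.-integrable setT (EFin \o A).
Proof.
move=> mA d0 Ale.
apply: (integrable_dom (g := fun y : V => a * gaussV d (x - (y : 'rV[R]_n)))) => //.
by apply: integrable_RZl; exact: integrable_gaussV.
Qed.

(** As [B] has integral 1, the difference is the double integral of A(y) B(z) (g(y) - g(z)). Changes
    of scale, changes of centre and differences of Gaussian means are all instances, the last one
    with the integral of [A] equal to 0. *)
Lemma osc_pair : exists2 C : R, 0 <= C & forall M g x d A B a b, tame M g -> 0 < d ->
  measurable_fun setT A -> measurable_fun setT B -> 0 <= a -> 0 <= b ->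
  (forall y, `|A y| <= a * gaussV d (x - y)) ->
  (forall y, `|B y| <= b * gaussV d (x - y)) -> \int[mu]_y B y = 1 ->
  `|\int[mu]_y (A y * g y) - (\int[mu]_y A y) * \int[mu]_y (B y * g y)| <= a * b * (C * M).
Proof.
have [C C0 HC] := @gauss_osc R n; exists C => // M g x d A B a b tg d0 mA mB a0 b0 Aa Bb B1.
have [M0 mg og cg] := tg; have gg := tame_gint tg.
have iA := dom_integrable mA d0 Aa; have iB := dom_integrable mB d0 Bb.
have iAg := gint_dom_integrable gg mA d0 Aa; have iBg := gint_dom_integrable gg mB d0 Bb.
pose P (y : V) := gaussV d (x - (y : 'rV[R]_n)).
have mP : measurable_fun setT P by exact: measurable_gaussVx.
have P0 y : 0 <= P y by exact: gaussV_ge0.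
pose F (p : V * V) := A p.1 * B p.2 * (g p.1 - g p.2).
pose G (p : V * V) := P p.1 * P p.2 * `|g p.1 - g p.2|.
have mG : measurable_fun setT G.
  by apply: measurable_funM; [exact: (measurable_tensor mP mP)|exact: measurable_diff2].
have G0 p : 0 <= G p by rewrite mulr_ge0// mulr_ge0.
have mF : measurable_fun setT F.
  apply: measurable_funM; first exact: measurable_tensor.
  apply: measurable_funB; [exact: (measurableT_comp mg measurable_fst)|exact: (measurableT_comp mg measurable_snd)].
have FG p : `|F p| <= a * b * G p.
  rewrite [leRHS](_ : _ = (a * P p.1) * (b * P p.2) * `|g p.1 - g p.2|); last by rewrite /G; ring.
  by rewrite !normrM ler_wpM2r// ler_pM.
have iG : (mu \x mu)%E.-integrable setT (EFin \o G).
  by apply: ge0_integrable => //; rewrite (le_lt_trans (HC _ _ _ _ tg d0))// ltry.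
have iF : (mu \x mu)%E.-integrable setT (EFin \o F).
  by apply: (integrable_dom (g := fun p => a * b * G p)) => //; exact: integrable_RZl.
have <- : \int[(mu \x mu)%E]_p F p = \int[mu]_y (A y * g y) - (\int[mu]_y A y) * \int[mu]_y (B y * g y).
  set K := \int[mu]_y (B y * g y).
  transitivity (\int[mu]_y (A y * g y - A y * K)).
    rewrite /Rintegral -integral12_prod_meas1//; congr fine; apply: eq_integral => y _; rewrite /fubini_F/=.
    have -> : (fun z => (F (y, z))%:E) = EFin \o (fun z => A y * g y * B z - A y * (B z * g z)).
      by apply/funext => z /=; rewrite /F/=; congr EFin; ring.
    rewrite integrable_EFinK; last first.
      by apply: integrable_RB; exact: integrable_RZl.
    rewrite RintegralB//; last 2 first.
    - exact: integrable_RZl.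
    - exact: integrable_RZl.
    by rewrite !RintegralZl// B1 mulr1.
  rewrite RintegralB//; last first.
    exact: integrable_RZr.
  by rewrite RintegralZr.
apply: (le_trans (Rintegral_le_norm iF _ FG)); first exact: integrable_RZl.
rewrite RintegralZl// ler_wpM2l ?mulr_ge0// -lee_fin -integrable_EFinK//.
exact: HC.
Qed.

End GaussAverage.

(** * Gaussian convolutions: scale, centre, first differences *)

Section GaussConv.
Variables (R : realType) (n : nat).
Notation mu := (lebV R n).
Notation V := (borelV R n).
Implicit Types (g : V -> R) (x z h : 'rV[R]_n).

Definition gconv g (d : R) x : R := \int[mu]_y (gaussV d (x - (y : 'rV[R]_n)) * g y).

Lemma gconv_scale4 : exists2 C : R, 0 <= C & forall M g x d d', tame M g -> 0 < d ->
  d <= d' -> d' <= 4 * d -> `|gconv g d x - gconv g d' x| <= C * M.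
Proof.
have [C C0 HC] := @osc_pair R n; exists (4 `^ (n%:R / 2) * C); first by rewrite mulr_ge0 ?powR_ge0.
move=> M g x d d' tg d0 dd' d'4; have d'0 : 0 < d' by exact: lt_le_trans dd'.
have := HC M g x d' (fun y => gaussV d (x - (y : 'rV[R]_n)))
  (fun y => gaussV d' (x - (y : 'rV[R]_n))) (4 `^ (n%:R / 2)) 1 tg d'0
  (measurable_gaussVx d x) (measurable_gaussVx d' x) (powR_ge0 _ _) ler01.
rewrite !Rintegral_gaussV// mul1r mulr1 -mulrA; apply => // y.
  rewrite ger0_norm ?gaussV_ge0//; apply: (le_trans (gaussV_le _ d0 dd')).
  rewrite ler_wpM2r ?gaussV_ge0// ge0_ler_powR ?nnegrE ?divr_ge0 ?(ltW d0) ?(ltW d'0)//.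
  by rewrite ler_pdivrMr.
by rewrite mul1r ger0_norm ?gaussV_ge0.
Qed.

Lemma gconv_scale_log : exists2 C : R, 0 <= C & forall M g x d d' k, tame M g -> 0 < d ->
  d <= d' -> d' <= 4 ^+ k * d -> `|gconv g d x - gconv g d' x| <= k%:R * (C * M).
Proof.
have [C C0 HC] := gconv_scale4; exists C => // M g x d d' k tg d0.
have [M0 _ _ _] := tg.
elim: k d d0 => [|k IH] d d0 dd' d'k.
  rewrite expr0 mul1r in d'k; have -> : d' = d by apply/eqP; rewrite eq_le dd' d'k.
  by rewrite subrr normr0 mul0r.
have [d'4|/ltW d'4] := leP d' (4 * d).
  apply: (le_trans (HC _ _ _ _ _ tg d0 dd' d'4)).
  by rewrite ler_peMl ?mulr_ge0// ler1n.
have d40 : 0 < 4 * d by rewrite mulr_gt0.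
have kE : k.+1%:R * (C * M) = C * M + k%:R * (C * M) by rewrite -nat1r mulrDl mul1r.
rewrite -(subrKA (gconv g (4 * d) x)) kE.
apply: (le_trans (ler_normD _ _)); apply: lerD.
  by apply: HC => //; rewrite ler_peMl ?(ltW d0)// ler1n.
by apply: IH => //; rewrite mulrA -exprSr.
Qed.

(** Telescoping over factors of 4 gives logarithmic growth in d'/d, as usual for averages of bmo
    functions. It is weakened to a power with any positive exponent so that it can enter power
    integrals over the scale. *)
Lemma gconv_scale (e : R) : 0 < e -> exists2 C : R, 0 <= C & forall M g x d d', tame M g -> 0 < d ->
  d <= d' -> `|gconv g d x - gconv g d' x| <= C * M * (d' / d) `^ e.
Proof.
move=> e0; have [C C0 HC] := gconv_scale_log.
exists ((e^-1 + 1) * C); first by rewrite mulr_ge0// addr_ge0// invr_ge0 ltW.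
move=> M g x d d' tg d0 dd'; have [M0 _ _ _] := tg.
have r1 : 1 <= d' / d by rewrite ler_pdivlMr// mul1r.
have r0 : 0 < d' / d by exact: lt_le_trans r1.
have l0 : 0 <= ln (d' / d) by exact: ln_ge0.
pose k := (Num.truncn (ln (d' / d))).+1.
have /andP[k1 k2] := truncn_itv l0.
apply: (le_trans (HC M g x d d' k tg d0 dd' _)).
  rewrite -ler_pdivrMr// -[leLHS](lnK r0)%R.
  apply: (@le_trans _ _ (expR k%:R)); first by rewrite ler_expR ltW.
  rewrite -[k%:R]mulr1 expRM_natl lerXn2r ?nnegrE ?expR_ge0//.
  (* This is [expR 1 <= 4], obtained from [expR (- 2^-1) >= 2^-1]. *)
  have := expR_ge1Dx (- 2^-1 : R); have := expR_gt0 (- 2^-1 : R).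
  have : expR (- 2^-1) * expR (- 2^-1) * expR 1 = 1 :> R.
    by rewrite -!expRD (_ : _ + _ + _ = 0) ?expR0//; field.
  move=> E a0 a1; have a2 : 4^-1 <= expR (- 2^-1) * expR (- 2^-1) :> R.
    by apply: (@le_trans _ _ (2^-1 * 2^-1)); [lra|apply: ler_pM => //; lra].
  by have := ler_wpM2r (expR_ge0 (1 : R)) a2; rewrite E; lra.
rewrite (_ : _ * C * M * _ = (e^-1 + 1) * (d' / d) `^ e * (C * M)); last by ring.
rewrite ler_wpM2r ?mulr_ge0//.
have pe : 1 + e * ln (d' / d) <= (d' / d) `^ e.
  by rewrite /powR (gt_eqF r0); exact: expR_ge1Dx.
have p1 : 1 <= (d' / d) `^ e by apply: le_trans pe; rewrite lerDl mulr_ge0// ltW.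
rewrite mulrDl mul1r -natr1; apply: lerD => //.
rewrite ler_pdivlMl//; have := ler_wpM2l (ltW e0) k1; lra.
Qed.

Lemma gconv_shift (D : R) : exists2 C : R, 0 <= C & forall M g x z d, tame M g -> 0 < d ->
  enorm z <= D * Num.sqrt d -> `|gconv g d (x + z) - gconv g d x| <= C * M.
Proof.
have [C C0 HC] := @osc_pair R n.
pose K := 2 `^ (n%:R / 2) * expR (pi * D ^+ 2) : R.
have K0 : 0 <= K by rewrite mulr_ge0 ?powR_ge0 ?expR_ge0.
exists (K * (2 `^ (n%:R / 2)) * C); first by rewrite !mulr_ge0 ?powR_ge0.
move=> M g x z d tg d0 zD; have d20 : 0 < 2 * d by rewrite mulr_gt0.
have := HC M g x (2 * d) (fun y => gaussV d (x + z - (y : 'rV[R]_n)))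
  (fun y => gaussV d (x - (y : 'rV[R]_n))) K (2 `^ (n%:R / 2)) tg d20
  (measurable_gaussVx d (x + z)) (measurable_gaussVx d x) K0 (powR_ge0 _ _).
rewrite !Rintegral_gaussV// mul1r => H; rewrite -[leRHS]mulrA; apply: H => // y; rewrite ger0_norm ?gaussV_ge0//.
  rewrite addrAC; apply: (le_trans (gaussV_shift_le _ _ d0)).
  rewrite ler_wpM2r ?gaussV_ge0// ler_wpM2l ?powR_ge0// ler_expR -mulrA ler_wpM2l ?pi_ge0//.
  rewrite ler_pdivrMr// -[d in leRHS](sqr_sqrtr (ltW d0)) -exprMn lerXn2r ?nnegrE//.
  exact: le_trans zD.
apply: (le_trans (gaussV_le _ d0 (_ : d <= 2 * d))); first by rewrite ler_peMl ?(ltW d0)// ler1n.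
by rewrite mulfK ?gt_eqF.
Qed.

(** The difference of the two kernels has integral 0, so [osc_pair] sees only the oscillation of
    [g]; the gain |h|/sqrt d comes from [gaussV_diff_le], applied with D/2 because each kernel moves
    by h/2. *)
Lemma gconv_diff1 (D : R) : exists2 C : R, 0 <= C & forall M g x h d, tame M g -> 0 < d ->
  enorm h <= D * Num.sqrt d -> `|Delta h (gconv g d) x| <= C * M * (enorm h / Num.sqrt d).
Proof.
have [C C0 HC] := @osc_pair R n; have [K K0 HK] := @gaussV_diff_le R n (D / 2).
exists (K / 2 * C); first by rewrite mulr_ge0// divr_ge0.
move=> M g x h d tg d0 hD; have d40 : 0 < 4 * d by rewrite mulr_gt0.
have gg := tame_gint tg.
have s0 : 0 < Num.sqrt d by rewrite sqrtr_gt0.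
pose A (y : V) := gaussV d (x + 2^-1 *: h - (y : 'rV[R]_n)) - gaussV d (x - 2^-1 *: h - (y : 'rV[R]_n)).
have mA : measurable_fun setT A by apply: measurable_funB; exact: measurable_gaussVx.
have A0 : \int[mu]_y A y = 0.
  by rewrite RintegralB//; [rewrite !Rintegral_gaussV// subrr|exact: integrable_gaussV|exact: integrable_gaussV].
have a0 : 0 <= K * (enorm (2^-1 *: h) / Num.sqrt d) by rewrite mulr_ge0// divr_ge0.
have := HC M g x (4 * d) A
  (fun y => gaussV (4 * d) (x - (y : 'rV[R]_n))) (K * (enorm (2^-1 *: h) / Num.sqrt d)) 1 tg d40
  mA (measurable_gaussVx (4 * d) x) a0 ler01.
rewrite Rintegral_gaussV// A0 mul0r subr0 mulr1 => H.
have -> : Delta h (gconv g d) x = \int[mu]_y (A y * g y).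
  rewrite /Delta /gconv -RintegralB//; [|exact: (gg.2)|exact: gg.2].
  by apply: eq_Rintegral => y _; rewrite /A mulrBl.
apply: (le_trans (H _ _ _)) => //.
- move=> y; rewrite /A addrAC [x - 2^-1 *: h - y]addrAC; apply: HK => //.
  by rewrite enormZ ger0_norm ?invr_ge0// mulrAC mulrC ler_wpM2r ?invr_ge0.
- by move=> y; rewrite mul1r ger0_norm ?gaussV_ge0.
- rewrite enormZ ger0_norm ?invr_ge0// le_eqVlt; apply/orP; left; apply/eqP; ring.
Qed.

(** One smoothing is split into two, so that differences can be shared between them in [gconv_diff];
    it also yields the sign of the Gaussian multiplier in [phi_ge0]. *)
Lemma gint_semigroup g d x : gint g -> 0 < d -> gconv g d x = gconv (gconv g (d / 2)) (d / 2) x.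
Proof.
move=> gg d0; have [mg ig] := gg.
have d20 : 0 < d / 2 by rewrite divr_gt0. have d40 : 0 < d / 4 by rewrite divr_gt0.
pose f (p : V * V) : R := gaussV (d / 2) (x - (p.2 : 'rV[R]_n)) *
  gaussV (d / 2) ((p.2 : 'rV[R]_n) - (p.1 : 'rV[R]_n)) * g p.1.
have fE z (y : V) : f (z, y) = gaussV d (x - z) * g z * gaussV (d / 4) (2^-1 *: (x + z) - (y : 'rV[R]_n)).
  by rewrite /f /= gaussV_semigroup//; ring.
have mf : measurable_fun setT f.
  apply: measurable_funM; last exact: (measurableT_comp mg measurable_fst).
  apply: measurable_funM; first exact: (measurableT_comp (measurable_gaussVx _ x) measurable_snd).
  apply: (measurableT_comp (@measurable_gaussV R n (d / 2))); apply: measurable_rV => i.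
  under eq_fun do rewrite !mxE.
  apply: measurable_funB; [exact: (measurableT_comp (measurable_coord i) measurable_snd)|].
  exact: (measurableT_comp (measurable_coord i) measurable_fst).
have fi : (\int[mu]_z \int[mu]_y `|f (z, y)|%:E < +oo)%E.
  under eq_integral => z _.
    under eq_integral => y _ do rewrite fE normrM [X in _ * X]ger0_norm ?gaussV_ge0// EFinM.
    rewrite ge0_integralZl_EFin ?ge0_integral_gaussVx ?mule1//; last 2 first.
    - by move=> y _; rewrite lee_fin gaussV_ge0.
    - by apply/measurable_EFinP; exact: measurable_gaussVx.
    over.
  by have /integrableP[_] := ig d x d0.
have := Rfubini mf fi.
rewrite /gconv => H; apply: etrans; last first.
  apply: etrans; first exact: H.
  apply: eq_Rintegral => y _; rewrite -(RintegralZl _ measurableT (ig (d / 2) y d20)).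
  by apply: eq_Rintegral => z _; rewrite /f/= mulrA.
apply: eq_Rintegral => z _; under eq_Rintegral do rewrite fE.
by rewrite RintegralZl ?Rintegral_gaussV ?mulr1//; exact: integrable_gaussV.
Qed.

Lemma gint_shift g z : gint g -> gint (fun y => g ((y : 'rV[R]_n) + z)).
Proof.
move=> [mg ig]; split; first exact: (measurableT_comp mg (measurable_addr_borelV z)).
move=> d x d0; have := integrable_shift z (ig d (x + z) d0).
by apply: eq_integrable => // y _ /=; rewrite opprD addrACA subrr addr0.
Qed.

Lemma gconv_shiftE g z d x : measurable_fun setT g ->
  gconv (fun y => g ((y : 'rV[R]_n) + z)) d x = gconv g d (x + z).
Proof.
move=> mg; rewrite /gconv.
rewrite -[RHS](Rintegral_shift z); last by apply: measurable_funM => //; exact: measurable_gaussVx.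
by apply: eq_Rintegral => y _; rewrite opprD addrACA subrr addr0.
Qed.

Lemma gint_Delta g h : gint g -> gint (Delta h g).
Proof.
move=> gg; have [m1 i1] := gint_shift (2^-1 *: h) gg; have [m2 i2] := gint_shift (- (2^-1 *: h)) gg.
split; first exact: measurable_funB.
move=> d x d0; apply: eq_integrableR (integrable_RB (i1 d x d0) (i2 d x d0)).
by move=> y; rewrite -mulrBr.
Qed.

Lemma gconv_Delta g h d : gint g -> 0 < d -> gconv (Delta h g) d = Delta h (gconv g d).
Proof.
move=> gg d0; have [m1 i1] := gint_shift (2^-1 *: h) gg; have [m2 i2] := gint_shift (- (2^-1 *: h)) gg.
apply/funext => x; rewrite {2}/Delta -!gconv_shiftE; [|exact: gg.1|exact: gg.1].
rewrite /gconv -RintegralB//; [|exact: i1|exact: i2].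
by apply: eq_Rintegral => y _; rewrite -mulrBr.
Qed.

Lemma gint_iter_Delta g h m : gint g -> gint (iter m (Delta h) g).
Proof. by move=> gg; elim: m => // m IH; exact: gint_Delta. Qed.

Lemma gconv_iter_Delta g h d m : gint g -> 0 < d ->
  gconv (iter m (Delta h) g) d = iter m (Delta h) (gconv g d).
Proof.
move=> gg d0; elim: m => //= m IH; rewrite gconv_Delta ?IH//.
exact: gint_iter_Delta.
Qed.

End GaussConv.

(** * Higher differences of Gaussian means *)

Section Regularity.
Variables (R : realType) (n : nat).
Notation mu := (lebV R n).
Notation V := (borelV R n).
Implicit Types (g : V -> R) (x z h : 'rV[R]_n).

Lemma enorm_gt0_neq0 h : h != 0 -> 0 < enorm h.
Proof.
move=> h0; rewrite lt_neqAle enorm_ge0 andbT eq_sym; apply: contra h0 => /eqP e0.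
apply/eqP/rowP => i; rewrite mxE; apply/eqP; rewrite -normr_le0.
by rewrite (le_trans (coord_le_enorm h i))// e0.
Qed.

(** Differences are centred, so f(x) - f(y) is a first difference at the midpoint with step x -
    y. *)
Lemma holder_continuous (f : 'rV[R]_n -> R) (C a : R) : 0 <= C -> 0 < a ->
  (forall x h, 0 < enorm h <= 1 -> `|Delta h f x| <= C * enorm h `^ a) -> continuous f.
Proof.
move=> C0 a0 Hf x B /nbhs_ballP[e /= e0 eB].
have C1 : 0 < C + 1 by rewrite ltr_wpDl.
pose t := Num.min 1 ((e / (C + 1)) `^ a^-1).
have t0 : 0 < t by rewrite lt_min ltr01 powR_gt0// divr_gt0.
have t1 : t <= 1 by rewrite ge_min lexx.
have ta : t `^ a <= e / (C + 1).
  set q := e / (C + 1); have q0 : 0 < q by rewrite divr_gt0.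
  rewrite -[leRHS](powRr1 (ltW q0)) -[in leRHS](mulVf (lt0r_neq0 a0)) powRrM.
  rewrite ge0_ler_powR ?nnegrE ?(ltW a0) ?(ltW t0) ?powR_ge0//.
  by rewrite ge_min lexx orbT.
(* Neighbourhoods are sup-norm balls; dividing the radius by [c] brings the Euclidean length of x -
   y below [t]. *)
pose c := Num.sqrt n%:R + 1 : R.
have c0 : 0 < c by rewrite ltr_wpDl ?sqrtr_ge0.
have tc : 0 < t / c by rewrite divr_gt0.
apply/nbhs_ballP; exists (t / c) => //= y [_ xy]; apply: eB; rewrite /ball/=.
have [->|xny] := eqVneq x y; first by rewrite subrr normr0.
pose h := x - y.
have hn : h != 0 by rewrite subr_eq0.
have ht : enorm h <= t.
  apply: (@le_trans _ _ (Num.sqrt n%:R * (t / c))).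
    apply: enorm_le_coord; first exact: ltW.
    by move=> i; rewrite !mxE; exact: ltW (xy ord0 i).
  by rewrite mulrCA ler_piMr ?(ltW t0)// ler_pdivrMr// mul1r /c lerDl.
have -> : f x - f y = Delta h f (2^-1 *: (x + y)).
  by rewrite /Delta /h; congr (f _ - f _); apply/rowP => i; rewrite !mxE; field.
apply: (le_lt_trans (Hf _ _ _)); first by rewrite enorm_gt0_neq0//= (le_trans ht).
apply: (@le_lt_trans _ _ (C * (e / (C + 1)))).
  rewrite ler_wpM2l// (le_trans _ ta)// ge0_ler_powR ?nnegrE ?(ltW a0) ?(ltW t0)//.
by rewrite mulrCA gtr_pMr// ltr_pdivrMr// mul1r ltrDl.
Qed.

Lemma integral_indic_eball x r : 0 < r ->
  (\int[mu]_y (\1_(eball x r) y)%:E = (vol (eball x r))%:E)%E.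
Proof.
by move=> r0; rewrite integral_indic ?setIT//; [exact: lebV_eballE|exact: measurable_eball].
Qed.

Lemma integral_indic_ucube k : (\int[mu]_y (\1_(@ucube R n k) y)%:E = 1)%E.
Proof.
by rewrite integral_indic ?setIT//; [exact: lebV_ucube|exact: measurable_ucube].
Qed.

Lemma bounded_tame g (K : R) : measurable_fun setT g -> 0 <= K -> (forall y, `|g y| <= K) ->
  tame (2 * K) g.
Proof.
move=> mg K0 gK; have K20 : 0 <= 2 * K by rewrite mulr_ge0.
split => // [x r r0|k].
- have mB := @measurable_indic_eball R n x r.
  apply: (@le_trans _ _ (\int[mu \x mu]_p ((2 * K)%:E * (\1_(eball x r) p.1 * \1_(eball x r) p.2)%:E))%E).
    apply: ge0_le_integral => //.
    + apply/measurable_EFinP; apply: measurable_funM; last exact: measurable_diff2.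
      exact: (measurable_tensor mB mB).
    + by apply: measurable_funeM; apply/measurable_EFinP; exact: (measurable_tensor mB mB).
    + move=> p _; rewrite -EFinM lee_fin mulrC ler_wpM2r ?mulr_ge0 ?indicE//.
      by rewrite (le_trans (ler_normB _ _))// mulr_natl mulr2n lerD.
  rewrite ge0_integralZl_EFin//; last by apply/measurable_EFinP; exact: (measurable_tensor mB mB).
  rewrite (ge0_integral_tensor _ _ mB mB); [|by move=> y; rewrite indicE|by move=> y; rewrite indicE].
  rewrite integral_indic_eball// -!EFinM lee_fin ler_wpM2l// exprD.
  by rewrite ler_pM ?(ltW (vol_eball_gt0 _ _))// vol_eball_le.
- have mQ := @measurable_indic_ucube R n k.
  apply: (@le_trans _ _ (\int[mu]_y (K%:E * (\1_(@ucube R n k) y)%:E))%E).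
    apply: ge0_le_integral => //.
    + by apply/measurable_EFinP; apply: measurable_funM => //; exact: measurableT_comp.
    + by apply: measurable_funeM; exact/measurable_EFinP.
    + by move=> p _; rewrite -EFinM lee_fin mulrC ler_wpM2r ?indicE.
  rewrite ge0_integralZl_EFin//; last exact/measurable_EFinP.
  by rewrite integral_indic_ucube mule1 lee_fin; lra.
Qed.

Lemma gconv_continuous M g d : tame M g -> 0 < d -> continuous (gconv g d).
Proof.
move=> tg d0; have [M0 _ _ _] := tg.
have s0 : 0 < Num.sqrt d by rewrite sqrtr_gt0.
have [C C0 HC] := @gconv_diff1 R n (Num.sqrt d)^-1.
apply: (@holder_continuous _ (C * M / Num.sqrt d) 1) => //.
  by rewrite divr_ge0 ?mulr_ge0.
move=> x h /andP[h0 h1]; rewrite powRr1// mulrAC -mulrA; apply: HC => //.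
by rewrite mulVf ?gt_eqF.
Qed.

Lemma measurable_gconv M g d : tame M g -> 0 < d ->
  measurable_fun setT (gconv g d : V -> R).
Proof. by move=> tg d0; apply: continuous_borelV_measurable; exact: gconv_continuous tg d0. Qed.

Lemma measurable_iter_Delta g h m : measurable_fun setT g ->
  measurable_fun setT (iter m (Delta h) g : V -> R).
Proof.
move=> mg; elim: m => //= m IH; apply: measurable_funB.
- exact: (measurableT_comp IH (measurable_addr_borelV (2^-1 *: h))).
- exact: (measurableT_comp IH (measurable_addr_borelV (- (2^-1 *: h)))).
Qed.

(** Smoothing at scale d is smoothing twice at scale d/2. The first m+1 differences fall on the
    inner smoothing, which makes that function bounded and therefore tame with a small constant; the
    last difference falls on the outer one. *)
Lemma gconv_diff (m : nat) (D : R) : exists2 C : R, 0 <= C & forall M g x h d, tame M g -> 0 < d ->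
  enorm h <= D * Num.sqrt d ->
  `|iter m.+1 (Delta h) (gconv g d) x| <= C * M * (enorm h / Num.sqrt d) ^+ m.+1.
Proof.
elim: m D => [|m IH] D.
  have [C C0 HC] := @gconv_diff1 R n D; by exists C.
(* In terms of d/2 the admissible range |h| <= D sqrt d reads |h| <= sqrt 2 * D * sqrt (d/2). *)
have [C C0 HC] := IH (Num.sqrt 2 * D); have [C1 C10 HC1] := @gconv_diff1 R n (Num.sqrt 2 * D).
pose q : R := Num.sqrt 2.
exists (C1 * 2 * C * q ^+ m.+2); first by rewrite mulr_ge0 ?exprn_ge0 ?sqrtr_ge0// !mulr_ge0.
move=> M g x h d tg d0 hd; have [M0 mg _ _] := tg.
have d20 : 0 < d / 2 by rewrite divr_gt0.
have s0 : 0 < Num.sqrt d by rewrite sqrtr_gt0.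
have q0 : 0 < q by rewrite sqrtr_gt0.
have s2 : Num.sqrt d = q * Num.sqrt (d / 2).
  by rewrite -sqrtrM//; congr Num.sqrt; field.
have hd2 : enorm h <= q * D * Num.sqrt (d / 2) by rewrite mulrAC -s2 mulrC.
have gg := tame_gint tg.
pose v := iter m.+1 (Delta h) (gconv g (d / 2)).
have vE : v = gconv (iter m.+1 (Delta h) g) (d / 2) by rewrite gconv_iter_Delta.
pose K := C * M * (enorm h / Num.sqrt (d / 2)) ^+ m.+1.
have K0 : 0 <= K by rewrite !mulr_ge0// exprn_ge0// divr_ge0// sqrtr_ge0.
have tv : tame (2 * K) (v : V -> R).
  apply: bounded_tame => // [|y]; last exact: HC.
  by apply: measurable_iter_Delta; exact: measurable_gconv tg d20.
rewrite iterS; have -> : iter m.+1 (Delta h) (gconv g d) = gconv v (d / 2).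
  rewrite -gconv_iter_Delta//; apply/funext => y.
  by rewrite gint_semigroup ?vE//; exact: gint_iter_Delta.
apply: (le_trans (HC1 _ _ _ _ _ tv d20 hd2)).
rewrite /K (_ : enorm h / Num.sqrt (d / 2) = q * (enorm h / Num.sqrt d)); last first.
  by rewrite s2 invfM; field; rewrite !gt_eqF// sqrtr_gt0.
set t := enorm h / Num.sqrt d.
rewrite exprMn [q ^+ m.+2]exprS [t ^+ m.+2]exprS le_eqVlt; apply/orP; left; apply/eqP; ring.
Qed.

(** At d = 1 the bound comes from the size on unit cubes, and [gconv_scale] carries it to all
    scales; the two powers serve d >= 1 and d <= 1. *)
Lemma gconv_abs_bound (e : R) : 0 < e -> exists2 C : R, 0 <= C & forall M g x d, tame M g -> 0 < d ->
  gconv (fun y => `|g y|) d x <= C * M * (d `^ e + d `^ (- e)).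
Proof.
move=> e0; have [C C0 HC] := @gconv_scale R n e e0; have [K K0 HK] := @tame_gauss_le R n.
exists (C + (1 + K * cubec n 1)); first by rewrite !addr_ge0// mulr_ge0// cubec_ge0.
move=> M g x d tg d0; have [M0 mg _ _] := tg; have ta := tame_norm tg.
set g' := fun y => _ in ta *; set k := 1 + K * _.
have k0 : 0 <= k by rewrite addr_ge0// mulr_ge0// cubec_ge0.
have b1 : gconv g' 1 x <= k * M.
  rewrite -lee_fin /gconv -integrable_EFinK; last exact: (tame_gint ta).2.
  exact: HK.
have p0 := powR_ge0 d e; have p1 := powR_ge0 d (- e).
have [d1|/ltW d1] := leP d 1.
  have := HC M g' x d 1 ta d0 d1; rewrite div1r -powR_inv1 ?(ltW d0)// -powRrM mulN1r.
  rewrite ler_norml => /andP[_ H].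
  have q1 : 1 <= d `^ (- e).
    by rewrite -(powRr0 d); apply: ger_powR; [rewrite d0|rewrite oppr_le0 ltW].
  have h1 : k * M <= k * M * d `^ (- e) by rewrite ler_peMr// mulr_ge0.
  have h2 : 0 <= (C + k) * M * d `^ e by rewrite !mulr_ge0// addr_ge0.
  by rewrite mulrDr; move: H b1 h1 h2; clear; lra.
have := HC M g' x 1 d ta ltr01 d1; rewrite divr1 ler_norml => /andP[H _].
have q1 : 1 <= d `^ e by rewrite -(powRr0 d); apply: ler_powR => //; exact: ltW.
have h1 : k * M <= k * M * d `^ e by rewrite ler_peMr// mulr_ge0.
have h2 : 0 <= (C + k) * M * d `^ (- e) by rewrite !mulr_ge0// addr_ge0.
by rewrite mulrDr; move: H b1 h1 h2; clear; lra.
Qed.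

End Regularity.

(** * Power integrals over the scale parameter *)

Section PowerIntegrals.
Variable R : realType.
Notation leb := (@lebesgue_measure R).

Lemma measurable_powRl (p : R) : measurable_fun setT (fun x : R => x `^ p).
Proof. exact: measurable_powR. Qed.

Lemma integral_powR_cc (p u v : R) : p != 0 -> 0 < u -> u < v ->
  (\int[leb]_(x in `[u, v]) (x `^ (p - 1))%:E = ((v `^ p - u `^ p) / p)%:E)%E.
Proof.
move=> p0 u0 uv.
have cpow q (x : R) : 0 < x -> {for x, continuous (fun y : R => y `^ q)}.
  move=> x0; apply/differentiable_continuous/derivable1_diffP.
  by apply: derivable_powR; rewrite in_itv/= x0.
rewrite (@continuous_FTC2 _ _ (fun x => p^-1 * x `^ p)) ?mulrBl//.
- by rewrite -EFinB; congr EFin; ring.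
- apply: continuous_in_subspaceT => x; rewrite inE/= in_itv/= => /andP[ux _].
  by apply: cpow; exact: lt_le_trans ux.
- split.
  + move=> x; rewrite in_itv/= => /andP[ux _]; apply: derivableM => //.
    by apply: derivable_powR; rewrite in_itv/= (lt_trans u0 ux).
  + apply: cvgM; first exact: cvg_cst.
    by apply: cvg_at_right_filter; exact: cpow.
  + apply: cvgM; first exact: cvg_cst.
    by apply: cvg_at_left_filter; apply: cpow; exact: lt_trans uv.
- move=> x; rewrite in_itv/= => /andP[ux _]; have x0 := lt_trans u0 ux.
  rewrite derive1E deriveZ; last by apply: derivable_powR; rewrite in_itv/= x0.
  rewrite -derive1E powR_derive1 ?in_itv/= ?x0// [_ *: _]mulrA mulVf// mul1r.
  by [].
Qed.

Lemma ge0_integral_bigcup_le d (T : measurableType d) (mu : {measure set T -> \bar R})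
    (F : (set T)^nat) (f : T -> \bar R) B :
  nondecreasing_seq F -> (forall i, measurable (F i)) -> measurable_fun setT f ->
  (forall x, 0 <= f x)%E -> (forall i, \int[mu]_(x in F i) f x <= B)%E ->
  (\int[mu]_(x in \bigcup_i F i) f x <= B)%E.
Proof.
move=> ndF mF mf f0 FB.
have cF : (\int[mu]_(x in F i) f x)%E @[i --> \oo] --> (\int[mu]_(x in \bigcup_i F i) f x)%E.
  by apply: ge0_nondecreasing_set_cvg_integral => // i; exact: measurable_funTS.
rewrite -(cvg_lim _ cF)//; apply: lime_le; first by apply/cvg_ex; eexists; exact: cF.
exact: nearW.
Qed.

Lemma integral_powR_0 (a H : R) : 0 < a -> 0 < H ->
  (\int[leb]_(x in `]0%R, H]) (x `^ (a - 1))%:E <= (H `^ a / a)%:E)%E.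
Proof.
move=> a0 H0.
(* The index [k.+2] keeps the left end strictly below [H] already for k = 0, as [integral_powR_cc]
   requires. *)
have -> : `]0, H]%classic = \bigcup_k `[H / k.+2%:R, H]%classic.
  apply/seteqP; split=> [x|x [k _]] /=; rewrite !in_itv/= => /andP[xl xH].
    have Hx0 : 0 <= H / x by rewrite divr_ge0 ?(ltW H0) ?(ltW xl).
    exists (Num.truncn (H / x)) => //=; rewrite in_itv/= xH andbT.
    rewrite ler_pdivrMr// mulrC -ler_pdivrMr//.
    have /andP[_ /ltW h] := truncn_itv Hx0.
    by rewrite (le_trans h)// ler_nat.
  by rewrite xH andbT (lt_le_trans _ xl)// divr_gt0.
apply: ge0_integral_bigcup_le => //.
- apply/nondecreasing_seqP => k; apply/subsetPset => x /=; rewrite !in_itv/= => /andP[xl ->].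
  by rewrite andbT (le_trans _ xl)// ler_wpM2l ?(ltW H0)// lef_pV2 ?posrE// ler_nat.
- by apply/measurable_EFinP; exact: measurable_powRl.
- by move=> x; rewrite lee_fin powR_ge0.
- move=> k; rewrite integral_powR_cc ?gt_eqF//.
  + by rewrite lee_fin ler_wpM2r ?invr_ge0 ?(ltW a0)// gerBl powR_ge0.
  + by rewrite divr_gt0.
  + by rewrite ltr_pdivrMr// ltr_pMr// ltr1n.
Qed.

Lemma integral_powR_y (b H : R) : 0 < b -> 0 < H ->
  (\int[leb]_(x in `[H, +oo[) (x `^ (- b - 1))%:E <= (H `^ (- b) / b)%:E)%E.
Proof.
move=> b0 H0.
have -> : `[H, +oo[%classic = \bigcup_k `[H, H + k.+1%:R]%classic.
  apply/seteqP; split=> [x|x [k _]] /=; rewrite !in_itv/= ?andbT; last by case/andP.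
  move=> Hx.
  have Hx0 : 0 <= x - H by rewrite subr_ge0.
  exists (Num.truncn (x - H)) => //=; rewrite in_itv/= Hx/=.
  by have /andP[_ /ltW h] := truncn_itv Hx0; rewrite addrC -lerBlDr.
apply: ge0_integral_bigcup_le => //.
- apply/nondecreasing_seqP => k; apply/subsetPset => x /=; rewrite !in_itv/= => /andP[-> xl] /=.
  by rewrite (le_trans xl)// lerD2l ler_nat.
- by apply/measurable_EFinP; exact: measurable_powRl.
- by move=> x; rewrite lee_fin powR_ge0.
- move=> k; rewrite integral_powR_cc ?oppr_eq0 ?gt_eqF//; last by rewrite ltrDl.
  rewrite lee_fin invrN mulrN -mulNr opprB ler_wpM2r ?invr_ge0 ?(ltW b0)//.
  by rewrite gerBl powR_ge0.
Qed.

(** Profile in [d] of the differences of a Gaussian mean, with H = |h|^2: a slow blow-up of exponent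
    [e] below the scale of the step, a decay of exponent [b] above it. *)
Definition psi (H e b d : R) := if d <= H then (H / d) `^ e else (H / d) `^ b.

Lemma psi_ge0 H e b d : 0 <= psi H e b d.
Proof. by rewrite /psi; case: ifP => _; exact: powR_ge0. Qed.

(* Positivity of [d] is built into the weights because [powR] is junk below 0. *)
Definition pospow (p d : R) : R := if 0 < d then d `^ p else 0.

Lemma pospow_ge0 p d : 0 <= pospow p d.
Proof. by rewrite /pospow; case: ifP => // _; exact: powR_ge0. Qed.

Lemma measurable_pospow p : measurable_fun setT (pospow p).
Proof.
by apply: measurable_fun_ifT => //; exact: measurable_fun_ltr.
Qed.

Lemma pospow_psi (H e b a d : R) : 0 < H ->
  pospow (a - 1) d * psi H e b d =
  H `^ e * (d `^ (a - e - 1) * \1_(`]0, H]%classic : set R) d) +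
  H `^ b * (d `^ (- (b - a) - 1) * \1_(`]H, +oo[%classic : set R) d).
Proof.
move=> H0; rewrite /pospow /psi !indicE !mem_setE !in_itv/= andbT.
case: ltP => [d0|dn0]; last first.
  by rewrite /= (ltNge H d) (le_trans dn0 (ltW H0))/= !mulr0 mul0r addr0.
have E q : d `^ (a - 1) * (H / d) `^ q = H `^ q * d `^ (a - q - 1).
  rewrite powRM ?invr_ge0 ?(ltW H0) ?(ltW d0)// -(powR_inv1 (ltW d0)) -powRrM mulrCA -powRD.
    by congr (_ * _ `^ _); ring.
  by rewrite (gt_eqF d0) implybT.
rewrite /= ltNge; case: (leP d H) => dH /=; rewrite E ?mulr1 ?mulr0 ?addr0 ?add0r//.
by congr (_ * _ `^ _); ring.
Qed.

Lemma measurable_pospow_psi (H e b a : R) : 0 < H ->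
  measurable_fun setT (fun d => pospow (a - 1) d * psi H e b d).
Proof.
move=> H0; rewrite (funext (fun d => pospow_psi e b a d H0)).
apply: measurable_funD; apply: measurable_funM => //; apply: measurable_funM;
  by [exact: measurable_powRl|exact: measurable_indic].
Qed.

(** The condition e < a gives convergence at 0 and a < b at infinity; the power H^a is forced by
    scaling. *)
Lemma integral_pospow_psi (e b a : R) : e < a -> a < b -> exists2 C, 0 <= C & forall H, 0 < H ->
  (\int[leb]_d (pospow (a - 1) d * psi H e b d)%:E <= (C * H `^ a)%:E)%E.
Proof.
move=> ea ab; have ae0 : 0 < a - e by rewrite subr_gt0. have ba0 : 0 < b - a by rewrite subr_gt0.
exists ((a - e)^-1 + (b - a)^-1); first by rewrite addr_ge0// invr_ge0 ltW.
move=> H H0; under eq_integral do rewrite pospow_psi// EFinD [X in (X + _)%E]EFinM [X in (_ + X)%E]EFinM.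
have m1 q (A : set R) : measurable A ->
    measurable_fun setT (fun d : R => (d `^ q * \1_A d)%:E).
  move=> mA; apply/measurable_EFinP; apply: measurable_funM; first exact: measurable_powRl.
  exact: measurable_indic.
have p0 q (A : set R) (d : R) : (0 <= (d `^ q * \1_A d)%:E)%E by rewrite lee_fin mulr_ge0 ?powR_ge0// indicE.
rewrite ge0_integralD//; last 4 first.
- by move=> d _; apply: mule_ge0; [rewrite lee_fin powR_ge0|exact: p0].
- by apply: measurable_funeM; exact: m1.
- by move=> d _; apply: mule_ge0; [rewrite lee_fin powR_ge0|exact: p0].
- by apply: measurable_funeM; exact: m1.
rewrite !ge0_integralZl_EFin ?powR_ge0//; do ?exact: m1.
have S q (A : set R) : measurable A -> (\int[leb]_d (d `^ q * \1_A d)%:E = \int[leb]_(d in A) (d `^ q)%:E)%E.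
  move=> mA; rewrite [RHS]integral_mkcond; apply: eq_integral => d _.
  by rewrite patchE indicE; case: ifP => _; rewrite ?mulr1 ?mulr0.
rewrite !S// mulrDl EFinD; apply: leeD.
- apply: (@le_trans _ _ ((H `^ e)%:E * (H `^ (a - e) / (a - e))%:E)%E).
    by rewrite lee_wpmul2l ?lee_fin ?powR_ge0//; exact: integral_powR_0.
  rewrite -EFinM lee_fin mulrA -powRD; last by rewrite (gt_eqF H0) implybT.
  by rewrite subrKC mulrC.
- apply: (@le_trans _ _ ((H `^ b)%:E * (H `^ (- (b - a)) / (b - a))%:E)%E).
    rewrite lee_wpmul2l ?lee_fin ?powR_ge0//.
    apply: le_trans (integral_powR_y ba0 H0).
    rewrite integral_itv_obnd_cbnd//; apply/measurable_EFinP.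
    by apply: measurable_funTS; exact: measurable_powRl.
  rewrite -EFinM lee_fin mulrA -powRD; last by rewrite (gt_eqF H0) implybT.
  by rewrite opprB subrKC mulrC.
Qed.

Lemma expRN_pow_le (p : R) : 0 <= p -> exists2 C, 0 <= C & forall d : R, 0 < d ->
  expR (- d / (4 * pi)) * d `^ p <= C.
Proof.
move=> p0; pose N := (Num.truncn p).+1.
have pi0 := pi_gt0 R; have fp0 : 0 < 4 * pi :> R by rewrite mulr_gt0.
exists (1 + (4 * pi) ^+ N * N.+1%:R ^+ N).
  by rewrite addr_ge0// mulr_ge0 ?exprn_ge0// ltW.
move=> d d0; rewrite mulNr expRN mulrC ler_pdivrMr ?expR_gt0//.
have e1 : 1 <= expR (d / (4 * pi)).
  by apply: le_trans (expR_ge1Dx _); rewrite lerDl divr_ge0 ?(ltW d0) ?(ltW fp0).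
have [d1|/ltW d1] := leP d 1.
  apply: (@le_trans _ _ 1).
    by rewrite -(powRr0 d); apply: ger_powR => //; rewrite d0.
  rewrite mulrDl mul1r (le_trans e1)// lerDl mulr_ge0 ?expR_ge0// mulr_ge0 ?exprn_ge0//.
  exact: ltW.
apply: (@le_trans _ _ (d ^+ N)).
  rewrite -powR_mulrn ?(ltW d0)//; apply: ler_powR => //.
  by have /andP[_ /ltW] := truncn_itv p0.
have := @exprn_le_expR R N (d / (4 * pi)); rewrite divr_ge0 ?(ltW d0) ?(ltW fp0)// => /(_ isT).
rewrite exprMn exprVn mulrC ler_pdivrMl ?exprn_gt0// mulrA => /le_trans; apply.
by rewrite ler_wpM2r ?expR_ge0// lerDr.
Qed.

(** The weight left in the integral for the Bessel kernel once d^(-n/2) and the Gaussian exponential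
    are collected in [gaussV]. *)
Definition wt (s d : R) := expR (- d / (4 * pi)) * pospow (s / 2 - 1) d.

Lemma wt_ge0 s d : 0 <= wt s d.
Proof. by rewrite mulr_ge0 ?expR_ge0 ?pospow_ge0. Qed.

Lemma wt_eq0 s d : d <= 0 -> wt s d = 0.
Proof. by move=> d0; rewrite /wt /pospow ltNge d0/= mulr0. Qed.

Lemma measurable_wt s : measurable_fun setT (wt s).
Proof.
apply: measurable_funM; last exact: measurable_pospow.
apply: measurableT_comp => //; apply: measurable_funM => //.
Qed.

(** The exponential absorbs the surplus power d^((s-s')/2). Replacing the order by a smaller one
    gives access to Hölder exponents below 1, hence to continuity. *)
Lemma wt_le (s s' : R) : s' <= s -> exists2 C, 0 <= C & forall d, wt s d <= C * pospow (s' / 2 - 1) d.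
Proof.
move=> ss'; have p0 : 0 <= (s - s') / 2 by rewrite divr_ge0// subr_ge0.
have [C C0 HC] := expRN_pow_le p0; exists C => // d.
rewrite /wt /pospow; case: ltP => d0; last by rewrite !mulr0.
rewrite (_ : s / 2 - 1 = (s - s') / 2 + (s' / 2 - 1)); last by field.
rewrite powRD; last by rewrite (gt_eqF d0) implybT.
by rewrite mulrA ler_wpM2r ?powR_ge0//; exact: HC.
Qed.

Lemma wt_pow_integrable (s e : R) : 0 < s -> 0 <= e -> e < s / 2 ->
  leb.-integrable setT (fun d => (wt s d * (d `^ e + d `^ (- e)))%:E).
Proof.
(* Any exponent above s/2 gives convergence at infinity. *)
move=> s0 e0 es; pose b := s / 2 + 1.
have b0 : 0 <= b by rewrite addr_ge0// divr_ge0// ltW.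
have sb : s / 2 < b by rewrite ltrDl.
have [C C0 HC] := integral_pospow_psi es sb.
have [K K0 HK] := @expRN_pow_le (e + b) (addr_ge0 e0 b0).
have mwt := measurable_wt s.
have E (d : R) : `|wt s d * (d `^ e + d `^ (- e))| <=
    (2 + 2 * K) * (pospow (s / 2 - 1) d * psi 1 e b d).
  have [d0|d0] := leP d 0.
      by rewrite wt_eq0// mul0r normr0 mulr_ge0 ?mulr_ge0 ?pospow_ge0 ?psi_ge0// addr_ge0// mulr_ge0.
    rewrite ger0_norm; last by apply: mulr_ge0; [exact: wt_ge0|rewrite addr_ge0 ?powR_ge0].
    rewrite (_ : wt s d * _ = pospow (s / 2 - 1) d * (expR (- d / (4 * pi)) * (d `^ e + d `^ (- e)))); last by rewrite /wt; ring.
    rewrite [leRHS]mulrCA; apply: ler_wpM2l; first exact: pospow_ge0.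
    have ed0 := expR_ge0 (- d / (4 * pi)).
    have ed1 : expR (- d / (4 * pi)) <= 1.
      by rewrite -expR0 ler_expR mulNr oppr_le0 divr_ge0 ?(ltW d0)// mulr_ge0// pi_ge0.
    rewrite /psi div1r -(powR_inv1 (ltW d0)) -!powRrM !mulN1r.
    have pe := powR_ge0 d e; have pne := powR_ge0 d (- e).
    case: (leP d 1) => d1.
      have h : d `^ e <= d `^ (- e) by apply: ger_powR; [rewrite d0|lra].
      apply: (@le_trans _ _ (2 * d `^ (- e))).
        by apply: (@le_trans _ _ (1 * (d `^ e + d `^ (- e)))); [rewrite ler_wpM2r// addr_ge0|lra].
      by rewrite ler_wpM2r// lerDl mulr_ge0.
    have h : d `^ (- e) <= d `^ e by apply: ler_powR; [exact: ltW|lra].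
    have := HK d d0; rewrite powRD; last by rewrite (gt_eqF d0) implybT.
    have pb : 0 < d `^ b by exact: powR_gt0.
    rewrite [d `^ (- b)]powRN mulrA -ler_pdivlMr// => H.
    apply: (@le_trans _ _ (2 * (K / d `^ b))).
      apply: (@le_trans _ _ (2 * (expR (- d / (4 * pi)) * d `^ e))); last by rewrite ler_wpM2l.
      by rewrite mulrCA ler_wpM2l//; lra.
    by rewrite mulrA ler_wpM2r ?invr_ge0 ?(ltW pb)// lerDr.
apply: (integrable_dom (g := fun d : measurableTypeR R => (2 + 2 * K) * (pospow (s / 2 - 1) d * psi 1 e b d))).
- by apply: measurable_funM => //; apply: measurable_funD; exact: measurable_powRl.
- exact: E.
- apply: integrable_RZl; apply: ge0_integrable.
  + exact: measurable_pospow_psi.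
  + by move=> d; rewrite mulr_ge0 ?pospow_ge0 ?psi_ge0.
  + by rewrite (le_lt_trans (HC 1 ltr01))// ltry.
Qed.

End PowerIntegrals.

(** * The Bessel potential as a superposition of Gaussian means *)

Section BesselRep.
Variables (R : realType) (n : nat).
Notation mu := (lebV R n).
Notation V := (borelV R n).
Notation leb := (@lebesgue_measure R).
Implicit Types (g : V -> R) (x h : 'rV[R]_n).

Lemma measurable_gauss_wt (s : R) x : measurable_fun setT
  (fun p : V * measurableTypeR R => gaussV p.2 (x - (p.1 : 'rV[R]_n)) * wt s p.2).
Proof.
have -> : (fun p : V * measurableTypeR R => gaussV p.2 (x - (p.1 : 'rV[R]_n)) * wt s p.2) =
    fun p => (p.2 `^ (- (n%:R / 2)) * expR (- pi * enorm (x - (p.1 : 'rV[R]_n)) ^+ 2 * p.2 `^ (- 1))) * wt s p.2.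
  apply/funext => p; have [d0|d0] := leP (p.2 : R) 0; first by rewrite wt_eq0// !mulr0.
  by rewrite /gaussV powR_inv1// ltW.
have m2 : measurable_fun setT (snd : V * measurableTypeR R -> R) by exact: measurable_snd.
have mp q : measurable_fun setT (fun p : V * measurableTypeR R => (p.2 : R) `^ q).
  exact: (measurableT_comp (measurable_powRl q) m2).
apply: measurable_funM; last exact: (measurableT_comp (measurable_wt s) m2).
apply: measurable_funM => //; apply: measurableT_comp => //; apply: measurable_funM => //.
apply: measurable_funM => //; apply: measurable_funX.
have me := measurableT_comp (@measurable_enorm R n) (measurable_subr_borelV x).
exact: (measurableT_comp me measurable_fst).
Qed.

Lemma measurable_gauss_wt1 (s : R) x : measurable_fun setT (fun d : measurableTypeR R => gaussV d x * wt s d).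
Proof.
have := measurableT_comp (@measurable_gauss_wt s x) (measurable_pair1 (0 : V)).
by rewrite /comp/= subr0.
Qed.

Definition bessel_cst (s : R) : R := ((4 * pi) `^ (s / 2) * Gamma (s / 2))^-1.

Lemma bessel_kernelE (s : R) x :
  bessel_kernel s x = bessel_cst s * \int[leb]_d (gaussV d x * wt s d).
Proof.
rewrite /bessel_kernel; congr (_ * fine _).
rewrite [LHS]integral_mkcond; apply: eq_integral => d _; rewrite patchE.
case: ifPn => [|]; rewrite ?notin_setE ?in_setE /=; last first.
  by move=> /negP; rewrite -leNgt => d0; rewrite wt_eq0// mulr0.
move=> d0; rewrite /wt /pospow d0 /gaussV; congr EFin.
set E1 := expR (- pi * _ / _); set E2 := expR (- d / _).
rewrite (_ : (s - n%:R) / 2 = - (n%:R / 2) + (s / 2 - 1) + 1); last by field.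
rewrite !powRD; do ?by rewrite (gt_eqF d0) implybT.
by rewrite powRr1 ?(ltW d0)//; field; rewrite gt_eqF.
Qed.

(** After Tonelli the inner integral is the weight times a Gaussian mean of |g|, of size d^e +
    d^(-e). This is integrable against [wt s] for e < s/2, and e = s/4 is one such choice. *)
Lemma gauss_wt_fubini (s M : R) g x : 0 < s -> tame M g ->
  (\int[mu]_y \int[leb]_d `|gaussV d (x - (y : 'rV[R]_n)) * wt s d * g y|%:E < +oo)%E.
Proof.
move=> s0 tg; have [M0 mg _ _] := tg; have ta := tame_norm tg; have [_ ga] := tame_gint ta.
pose e := s / 4; have e0 : 0 < e by rewrite divr_gt0.
have es : e < s / 2 by rewrite /e; lra.
have [C C0 HC] := @gconv_abs_bound R n e e0.
pose F (p : V * measurableTypeR R) : R := gaussV p.2 (x - (p.1 : 'rV[R]_n)) * wt s p.2 * g p.1.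
have mF : measurable_fun setT F.
  apply: measurable_funM; first exact: measurable_gauss_wt.
  exact: (measurableT_comp mg measurable_fst).
have mnF : measurable_fun setT (fun p => `|F p|%:E).
  by apply/measurable_EFinP; exact: measurableT_comp.
rewrite [ltLHS](fubini_tonelli (m1 := mu) (m2 := leb) (fun p => `|F p|%:E) mnF); last first.
  by move=> p; rewrite lee_fin.
have := wt_pow_integrable s0 (ltW e0) es => /(@integrable_RZl _ _ _ leb (C * M)).
move=> /integrableP[mI]; apply: le_lt_trans.
apply: ge0_le_integral => //.
- by move=> d _; apply: integral_ge0 => y _; rewrite lee_fin.
- exact: (measurable_fun_fubini_tonelli_G (fun p => `|F p|%:E)).
- exact: measurableT_comp.
move=> d _; rewrite /fubini_G/=.
apply: (@le_trans _ _ (C * M * (wt s d * (d `^ e + d `^ (- e))))%:E); last by rewrite lee_fin ler_norm.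
have [d0|d0] := leP (d : R) 0.
  by rewrite /F/= wt_eq0//; under eq_integral do rewrite mulr0 mul0r normr0; rewrite integral0 mul0r mulr0.
rewrite /F/= (eq_integral (fun y : V => ((wt s d)%:E * (gaussV d (x - (y : 'rV[R]_n)) * `|g y|)%:E)%E)); last first.
  move=> y _; rewrite [`|_ * g y|]normrM ger0_norm -?EFinM; last first.
    by apply: mulr_ge0; [exact: gaussV_ge0|exact: wt_ge0].
  by congr EFin; ring.
rewrite ge0_integralZl_EFin ?wt_ge0//; last 2 first.
- by move=> y _; rewrite lee_fin; apply: mulr_ge0 => //; exact: gaussV_ge0.
- by apply/measurable_EFinP; apply: measurable_funM; [exact: measurable_gaussVx|exact: measurableT_comp].
rewrite integrable_EFinK; last exact: ga.
rewrite -EFinM lee_fin mulrCA; apply: ler_wpM2l; first exact: wt_ge0.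
exact: HC.
Qed.

Lemma bessel_rep (s M : R) g x : 0 < s -> tame M g ->
  leb.-integrable setT (EFin \o (fun d => wt s d * gconv g d x)) /\
  bessel_potential s g x = bessel_cst s * \int[leb]_d (wt s d * gconv g d x).
Proof.
move=> s0 tg; have [M0 mg _ _] := tg; have [_ gg] := tame_gint tg.
pose F (p : V * measurableTypeR R) : R := gaussV p.2 (x - (p.1 : 'rV[R]_n)) * wt s p.2 * g p.1.
have mF : measurable_fun setT F.
  apply: measurable_funM; first exact: measurable_gauss_wt.
  exact: (measurableT_comp mg measurable_fst).
have fi := gauss_wt_fubini x s0 tg.
have FG (d : R) : \int[mu]_y F (y, d) = wt s d * gconv g d x.
  have [d0|d0] := leP d 0.
    rewrite wt_eq0// mul0r; under eq_Rintegral do rewrite /F/= wt_eq0// mulr0 mul0r.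
    by rewrite /Rintegral integral0.
  rewrite /gconv -RintegralZl//; last exact: gg.
  by apply: eq_Rintegral => y _; rewrite /F/=; ring.
(* At y = x the integral over [d] may be infinite; both sides are then 0, which is why
   [ge0_RintegralZr] is used. *)
have FE (y : V) : bessel_kernel s (x - (y : 'rV[R]_n)) * g y = bessel_cst s * \int[leb]_d F (y, d).
  rewrite bessel_kernelE -mulrA -ge0_RintegralZr//; first exact: measurable_gauss_wt1.
  by move=> d; apply: mulr_ge0; [exact: gaussV_ge0|exact: wt_ge0].
have I1 := integrable_Rfubini (m1 := mu) (m2 := leb) mF fi.
split.
  apply: eq_integrableR (integrable_Rfubini_swap (m1 := mu) (m2 := leb) mF fi).
  by move=> d; exact: FG.
have E : (fun y => bessel_kernel s (x - y) * g y) = (fun y : V => bessel_cst s * \int[leb]_d F (y, d)).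
  by apply/funext => y; exact: FE.
rewrite /bessel_potential E iint_sE; last exact: integrable_RZl.
rewrite RintegralZl//; congr (_ * _).
rewrite (Rfubini (m1 := mu) (m2 := leb) mF fi).
by apply: eq_Rintegral => d _; exact: FG.
Qed.

End BesselRep.

(** * Difference bounds for Bessel potentials *)

Section BesselRegularity.
Variables (R : realType) (n : nat).
Notation mu := (lebV R n).
Notation V := (borelV R n).
Notation leb := (@lebesgue_measure R).
Implicit Types (g : V -> R) (x h : 'rV[R]_n).

Lemma iter_DeltaZ k h (c : R) (f : 'rV[R]_n -> R) :
  iter k (Delta h) (fun x => c * f x) = (fun x => c * iter k (Delta h) f x).
Proof. by elim: k => // k IH; apply/funext => x; rewrite !iterS IH /Delta -mulrBr. Qed.

Lemma iter_Delta0 k h : iter k (Delta h) (fun=> 0) = (fun=> 0 : R).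
Proof. by elim: k => // k IH; rewrite iterS IH; apply/funext => x; rewrite /Delta subrr. Qed.

(** A difference of order at least one kills the constant [c], and all evaluation points lie within
    (m+1)|h| of [x]. *)
Lemma iter_Delta_le (f : 'rV[R]_n -> R) h x (c K : R) m :
  (forall t : R, `|t| <= m.+1%:R -> `|f (x + t *: h) - c| <= K) ->
  `|iter m.+1 (Delta h) f x| <= 2 ^+ m.+1 * K.
Proof.
elim: m x => [|m IH] x fK.
  rewrite /= /Delta expr1 -scaleNr.
  have h1 := fK 2^-1; have h2 := fK (- 2^-1).
  have n2 : `|2^-1| <= 1%:R :> R by rewrite ger0_norm ?invr_ge0//; lra.
  rewrite normrN in h2; have {}h1 := h1 n2; have {}h2 := h2 n2.
  rewrite -(subrKA c) (le_trans (ler_normD _ _))// [`|c - _|]distrC; lra.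
have mE : m.+2%:R = m.+1%:R + 1 :> R by rewrite -natr1.
have KE : 2 ^+ m.+2 * K = 2 ^+ m.+1 * K + 2 ^+ m.+1 * K by rewrite [2 ^+ m.+2]exprS; ring.
rewrite iterS {1}/Delta KE.
rewrite (le_trans (ler_normB _ _))//; apply: lerD; apply: IH => t tm.
- rewrite -addrA -scalerDl; apply: fK.
  rewrite (le_trans (ler_normD _ _))// ger0_norm ?invr_ge0// mE; lra.
- rewrite -addrA -scaleNr -scalerDl; apply: fK.
  rewrite (le_trans (ler_normD _ _))// normrN ger0_norm ?invr_ge0// mE; lra.
Qed.

(** For d <= |h|^2 all values are compared with the one mean at [x] of scale |h|^2, which costs a
    small power of |h|^2/d. For larger d each order of difference gains |h|/sqrt d, in total
    (|h|^2/d)^((m+1)/2). *)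
Lemma gconv_diff_psi (m : nat) (e : R) : 0 < e -> exists2 C : R, 0 <= C & forall M g x h d, tame M g -> 0 < d ->
  0 < enorm h -> `|iter m.+1 (Delta h) (gconv g d) x| <= C * M * psi (enorm h ^+ 2) e (m.+1%:R / 2) d.
Proof.
move=> e0; have [C1 C10 H1] := @gconv_scale R n e e0.
have [C2 C20 H2] := @gconv_shift R n m.+1%:R.
have [C3 C30 H3] := @gconv_diff R n m 1.
exists (2 ^+ m.+1 * (C1 + C2) + C3); first by rewrite addr_ge0// mulr_ge0 ?exprn_ge0// addr_ge0.
move=> M g x h d tg d0 h0; have [M0 _ _ _] := tg; set H := enorm h ^+ 2.
have H0 : 0 < H by exact: exprn_gt0.
have sH : Num.sqrt H = enorm h by rewrite sqrtr_sqr ger0_norm.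
rewrite /psi; case: (leP d H) => dH.
  apply: (@le_trans _ _ (2 ^+ m.+1 * ((C1 + C2) * M * (H / d) `^ e))).
    apply: (@iter_Delta_le _ _ _ (gconv g H x)) => t tm.
    rewrite -(subrKA (gconv g H (x + t *: h))) (le_trans (ler_normD _ _))//.
    have q1 : 1 <= (H / d) `^ e.
      by rewrite -(powRr0 (H / d)); apply: ler_powR; [rewrite ler_pdivlMr// mul1r|exact: ltW].
    have h1 := H1 M g (x + t *: h) d H tg d0 dH.
    have h2 : `|gconv g H (x + t *: h) - gconv g H x| <= C2 * M.
      by apply: H2 => //; rewrite sH enormZ ler_wpM2r.
    have h3 : C2 * M <= C2 * M * (H / d) `^ e by rewrite ler_peMr// mulr_ge0.
    rewrite (_ : (C1 + C2) * M * _ = C1 * M * (H / d) `^ e + C2 * M * (H / d) `^ e); last by ring.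
    by apply: lerD => //; exact: le_trans h3.
  rewrite (_ : 2 ^+ m.+1 * _ = 2 ^+ m.+1 * (C1 + C2) * M * (H / d) `^ e); last by ring.
  rewrite ler_wpM2r ?powR_ge0// ler_wpM2r//.
  by rewrite lerDl.
have s0 : 0 < Num.sqrt d by rewrite sqrtr_gt0.
have hd : enorm h <= 1 * Num.sqrt d by rewrite mul1r -sH ler_sqrt ltW.
apply: (le_trans (H3 M g x h d tg d0 hd)).
have -> : (H / d) `^ (m.+1%:R / 2) = (enorm h / Num.sqrt d) ^+ m.+1.
  rewrite -[d in LHS](sqr_sqrtr (ltW d0)) -expr_div_n; set t := enorm h / _.
  have t0 : 0 <= t by rewrite divr_ge0 ?(ltW s0).
  by rewrite -(powR_mulrn 2 t0) -powRrM -(powR_mulrn m.+1 t0); congr (_ `^ _); field.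
rewrite ler_wpM2r ?exprn_ge0 ?divr_ge0 ?(ltW s0)// ler_wpM2r// lerDr mulr_ge0 ?exprn_ge0// addr_ge0//.
Qed.

Lemma iter_Delta_bessel (s M : R) g h m x : 0 < s -> tame M g ->
  leb.-integrable setT (EFin \o (fun d => wt s d * iter m (Delta h) (gconv g d) x)) /\
  iter m (Delta h) (bessel_potential s g) x =
    bessel_cst s * \int[leb]_d (wt s d * iter m (Delta h) (gconv g d) x).
Proof.
move=> s0 tg; elim: m x => [|m IH] x; first exact: bessel_rep s0 tg.
have [i1 e1] := IH (x + 2^-1 *: h); have [i2 e2] := IH (x - 2^-1 *: h).
have E d : wt s d * iter m.+1 (Delta h) (gconv g d) x =
    wt s d * iter m (Delta h) (gconv g d) (x + 2^-1 *: h) -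
    wt s d * iter m (Delta h) (gconv g d) (x - 2^-1 *: h).
  by rewrite iterS {1}/Delta mulrBr.
split; first by apply: eq_integrableR (integrable_RB i1 i2) => d; rewrite E.
rewrite iterS {1}/Delta e1 e2 -mulrBr -RintegralB//; congr (_ * _).
by apply: eq_Rintegral => d _; rewrite E.
Qed.

(** The exponent s' = s gives the seminorm of [Lambda]; the freedom to take s' < 1 with m = 0 gives
    continuity. The condition s' < m+1 is what makes the scale integral converge at infinity. *)
Lemma bessel_diff_bound (s s' : R) (m : nat) : 0 < s' -> s' <= s -> s' < m.+1%:R ->
  exists2 C : R, 0 <= C & forall M g x h, tame M g -> 0 < enorm h ->
  `|iter m.+1 (Delta h) (bessel_potential s g) x| <= C * M * enorm h `^ s'.
Proof.
move=> s'0 ss' sm; have s0 : 0 < s by exact: lt_le_trans ss'.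
pose e := s' / 4; have e0 : 0 < e by rewrite divr_gt0.
have es : e < s' / 2 by rewrite /e; lra.
have sb : s' / 2 < m.+1%:R / 2 by rewrite ltr_pM2r.
have [C C0 HC] := @gconv_diff_psi m e e0.
have [K K0 HK] := @wt_le R s s' ss'.
have [L L0 HL] := integral_pospow_psi es sb.
pose B : R := `|bessel_cst s|; have B0 : 0 <= B by exact: normr_ge0.
exists (B * (K * C * L)); first by rewrite !mulr_ge0.
move=> M g x h tg h0; have [M0 _ _ _] := tg.
have [iD ->] := iter_Delta_bessel h m.+1 x s0 tg.
rewrite normrM -/B -!mulrA ler_wpM2l//.
pose H := enorm h ^+ 2; have H0 : 0 < H by exact: exprn_gt0.
pose G (d : measurableTypeR R) : R := K * C * M * (pospow (s' / 2 - 1) d * psi H e (m.+1%:R / 2) d).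
have G0 d : 0 <= pospow (s' / 2 - 1) d * psi H e (m.+1%:R / 2) d by rewrite mulr_ge0 ?pospow_ge0 ?psi_ge0.
have iG0 : leb.-integrable setT (EFin \o (fun d => pospow (s' / 2 - 1) d * psi H e (m.+1%:R / 2) d)).
  by apply: ge0_integrable => //; [exact: measurable_pospow_psi|rewrite (le_lt_trans (HL H H0))// ltry].
have iG : leb.-integrable setT (EFin \o G) by exact: integrable_RZl.
apply: (le_trans (Rintegral_le_norm iD iG _)).
  move=> d; have [d0|d0] := leP (d : R) 0.
    rewrite wt_eq0// mul0r normr0 /G mulr_ge0// mulr_ge0// mulr_ge0//.
  rewrite normrM (ger0_norm (wt_ge0 _ _)).
  apply: (@le_trans _ _ (K * pospow (s' / 2 - 1) d * (C * M * psi H e (m.+1%:R / 2) d))).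
    by apply: ler_pM => //; [exact: wt_ge0|exact: HC].
  by rewrite /G le_eqVlt; apply/orP; left; apply/eqP; ring.
rewrite RintegralZl// -!mulrA ler_wpM2l// ler_wpM2l// mulrCA ler_wpM2l//.
rewrite -lee_fin -integrable_EFinK//; apply: (le_trans (HL H H0)).
rewrite lee_fin ler_wpM2l// /H -powR_mulrn// -powRrM.
by rewrite (_ : 2%:R * (s' / 2) = s')//; field.
Qed.

Lemma bessel_bounded (s : R) : 0 < s -> exists2 C : R, 0 <= C & forall M g x, tame M g ->
  `|bessel_potential s g x| <= C * M.
Proof.
move=> s0; pose e := s / 4; have e0 : 0 < e by rewrite divr_gt0.
have es : e < s / 2 by rewrite /e; lra.
have [C C0 HC] := @gconv_abs_bound R n e e0.
have iw := wt_pow_integrable s0 (ltW e0) es.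
pose L := \int[leb]_d (wt s d * (d `^ e + d `^ (- e))).
have w0 (d : R) : 0 <= wt s d * (d `^ e + d `^ (- e)).
  by rewrite mulr_ge0 ?wt_ge0// addr_ge0 ?powR_ge0.
have L0 : 0 <= L by apply: Rintegral_ge0 => d _.
exists (`|bessel_cst s| * (C * L)); first by rewrite !mulr_ge0.
move=> M g x tg; have [M0 mg _ _] := tg; have [iD ->] := bessel_rep x s0 tg.
have [_ gg] := tame_gint tg; have [_ ga] := tame_gint (tame_norm tg).
rewrite normrM -!mulrA ler_wpM2l//.
apply: (le_trans (Rintegral_le_norm iD (integrable_RZl (C * M) iw) _)).
  move=> d; have [d0|d0] := leP (d : R) 0; first by rewrite wt_eq0// !mul0r normr0 mulr0.
  rewrite normrM (ger0_norm (wt_ge0 _ _)) mulrCA; apply: ler_wpM2l; first exact: wt_ge0.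
  apply: le_trans (HC M g x d tg d0).
  apply: Rintegral_le_norm; [exact: gg|exact: ga|].
  by move=> y; rewrite normrM ger0_norm ?gaussV_ge0.
by rewrite RintegralZl// -/L le_eqVlt; apply/orP; left; apply/eqP; ring.
Qed.

Lemma bessel_continuous (s M : R) g : 0 < s -> tame M g -> continuous (bessel_potential s g).
Proof.
move=> s0 tg; have [M0 _ _ _] := tg; pose s' := Num.min s 2^-1.
have s'0 : 0 < s' by rewrite lt_min s0/=; lra.
have s's : s' <= s by rewrite ge_min lexx.
have s'1 : s' < 1%:R by rewrite (@le_lt_trans _ _ 2^-1)//; [rewrite ge_min lexx orbT|lra].
have [C C0 HC] := bessel_diff_bound s'0 s's s'1.
apply: (@holder_continuous _ _ _ (C * M) s') => //; first by rewrite mulr_ge0.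
by move=> x h /andP[h0 _]; exact: HC.
Qed.

Lemma lambda_norm_le (s A B : R) (f : 'rV[R]_n -> R) :
  (forall x, `|f x| <= A) ->
  (forall x h, 0 < enorm h <= 1 -> `|iter (Num.truncn s).+1 (Delta h) f x| <= B * enorm h `^ s) ->
  (lambda_norm s f <= (A + B)%:E)%E.
Proof.
move=> fA fB; rewrite /lambda_norm EFinD; apply: leeD.
  by apply: ge_ereal_sup => _ [x _ <-]; rewrite lee_fin.
apply: ge_ereal_sup => _ [x [h [y [/andP[y0 y1] [hy ->]]]]]; rewrite lee_fin.
by rewrite ler_pdivrMr ?powR_gt0// -hy fB// hy y0.
Qed.

Lemma bessel_Lambda (s M : R) g : 0 < s -> tame M g -> Lambda n s (bessel_potential s g).
Proof.
move=> s0 tg; split; first exact: bessel_continuous tg.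
have [C C0 HC] := bessel_bounded s0.
have sm : s < (Num.truncn s).+1%:R by have /andP[] := truncn_itv (ltW s0).
have [K K0 HK] := bessel_diff_bound s0 (lexx s) sm.
apply: (@le_lt_trans _ _ (C * M + K * M)%:E); last exact: ltry.
by apply: lambda_norm_le => [x|x h /andP[h0 _]]; [exact: HC|exact: HK].
Qed.

End BesselRegularity.

(** * From the bmo norm to oscillation bounds *)

Section Bmo.
Variables (R : realType) (n : nat).
Notation mu := (lebV R n).
Notation V := (borelV R n).
Notation leb := (@lebesgue_measure R).
Implicit Types (g : V -> R) (x h : 'rV[R]_n).

(** The nonnegative members exclude the value -oo for either supremum, so a finite sum forces both
    to be finite. *)
Lemma ereal_sup_add_fin (X Y : set (\bar R)) a b : X a -> Y b -> (0 <= a)%E -> (0 <= b)%E ->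
  (ereal_sup X + ereal_sup Y < +oo)%E -> exists A B : R,
  [/\ ereal_sup X = A%:E, ereal_sup Y = B%:E, 0 <= A & 0 <= B].
Proof.
move=> Xa Yb a0 b0.
have : (0 <= ereal_sup X)%E by apply: le_trans a0 _; exact: ereal_sup_ubound.
have : (0 <= ereal_sup Y)%E by apply: le_trans b0 _; exact: ereal_sup_ubound.
case: (ereal_sup Y) => [B||]//; case: (ereal_sup X) => [A||]// B0 A0 _.
by exists A, B.
Qed.

(** The double integral is reduced to deviations from the average by the triangle inequality, hence
    the factor 2 in front of [A]. The L^2 bound on cubes is returned separately from [tame], because
    Bessel's inequality needs the squares. *)
Lemma bmo_tame g : bmo g -> exists2 M, tame M g &
  forall k, (\int[mu]_y (\1_(@ucube R n k) y * g y ^+ 2)%:E <= M%:E)%E.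
Proof.
move=> [[/borel_funP mg _] ng].
have mB (x : 'rV[R]_n) r (c : R) : measurable_fun setT (fun y : V => (\1_(eball x r) y * `|g y - c|)%:E).
  apply/measurable_EFinP; apply: measurable_funM; first exact: measurable_indic_eball.
  by apply: measurableT_comp => //; exact: measurable_funB.
have mQ k : measurable_fun setT (fun y : V => (\1_(@ucube R n k) y * g y ^+ 2)%:E).
  apply/measurable_EFinP; apply: measurable_funM; first exact: measurable_indic_ucube.
  exact: measurable_funX.
have [] := @ereal_sup_add_fin _ _ _ _ (ex_intro _ 0 (ex_intro _ 1 (conj ltr01 erefl))) (ex_intro _ 0 erefl) _ _ ng.
- rewrite iintE//.
  apply: mule_ge0; first by rewrite lee_fin invr_ge0 ltW// vol_eball_gt0.
  by apply: integral_ge0 => y _; rewrite lee_fin mulr_ge0.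
- by case: (iint _) => [r||]//=; rewrite lee_fin sqrtr_ge0.
move=> A [B [SA SB A0 B0]].
have HA (x : 'rV[R]_n) (r : R) : 0 < r -> exists c : R,
    (\int[mu]_y (\1_(eball x r) y * `|g y - c|)%:E <= (A * vol (eball x r))%:E)%E.
  move=> r0; exists (avg (eball x r) g).
  have : (((vol (eball x r))^-1)%:E * iint (fun y => (\1_(eball x r) y * `|g y - avg (eball x r) g|)%:E) <= A%:E)%E.
    by rewrite -SA; apply: ereal_sup_ubound; exists x, r.
  rewrite iintE//.
  by rewrite lee_pdivrMl ?vol_eball_gt0// -EFinM mulrC.
have HB k : (\int[mu]_y (\1_(@ucube R n k) y * g y ^+ 2)%:E <= (B ^+ 2)%:E)%E.
  have : (esqrt (iint (fun y => (\1_(ucube k) y * `|g y| ^+ 2)%:E)) <= B%:E)%E.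
    by rewrite -SB; apply: ereal_sup_ubound; exists k.
  rewrite (_ : (fun y => _) = (fun y : V => (\1_(ucube k) y * g y ^+ 2)%:E)); last first.
    by apply/funext => y; rewrite real_normK// num_real.
  have z0 (y : V) : (0 <= (\1_(@ucube R n k) y * g y ^+ 2)%:E)%E by rewrite lee_fin mulr_ge0 ?sqr_ge0.
  rewrite (iintE (mQ k) z0).
  have : (0 <= \int[mu]_y (\1_(@ucube R n k) y * g y ^+ 2)%:E)%E by exact: integral_ge0.
  case: (\int[mu]_y _)%E => [r||]//; rewrite !lee_fin => r0 rB.
  by rewrite -(sqr_sqrtr r0) ler_sqr ?nnegrE ?sqrtr_ge0.
pose M := 2 * A + (1 + B ^+ 2); have B20 := sqr_ge0 B.
exists M; last by move=> k; rewrite (le_trans (HB k))// lee_fin /M; lra.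
split => //; first by rewrite /M; lra.
- move=> x r r0; have [c Hc] := HA x r r0; set b := \1_(eball x r) : V -> R.
  have mb : measurable_fun setT b by exact: measurable_indic_eball.
  have b0 (y : V) : 0 <= b y by exact: indic_ge0.
  pose a (y : V) : R := b y * `|g y - c|.
  have ma : measurable_fun setT a by apply/measurable_EFinP; exact: mB.
  have a0 (y : V) : 0 <= a y by exact: mulr_ge0.
  have mab := measurable_tensor ma mb; have mba := measurable_tensor mb ma.
  apply: (@le_trans _ _ (\int[mu \x mu]_p ((a p.1 * b p.2)%:E + (b p.1 * a p.2)%:E))%E).
    apply: ge0_le_integral => //.
    + by move=> p _; rewrite lee_fin; apply: mulr_ge0 => //; exact: mulr_ge0.
    + apply/measurable_EFinP; apply: measurable_funM; last exact: measurable_diff2.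
      exact: measurable_tensor.
    + by apply: emeasurable_funD; exact/measurable_EFinP.
    + move=> p _; rewrite -EFinD lee_fin /a.
      rewrite [leRHS](_ : _ = b p.1 * b p.2 * (`|g p.1 - c| + `|g p.2 - c|)); last by ring.
      apply: ler_wpM2l; first exact: mulr_ge0.
      rewrite [`|g p.2 - c|]distrC; apply: le_trans (ler_normD _ _).
      by rewrite le_eqVlt; apply/orP; left; apply/eqP; congr `|_|; ring.
  rewrite ge0_integralD//; first last.
  + exact/measurable_EFinP.
  + by move=> p _; rewrite lee_fin; exact: mulr_ge0.
  + exact/measurable_EFinP.
  + by move=> p _; rewrite lee_fin; exact: mulr_ge0.
  rewrite !ge0_integral_tensor// integral_indic_eball//.
  have v0 := vol_eball_gt0 x r0.
  apply: (@le_trans _ _ ((A * vol (eball x r))%:E * (vol (eball x r))%:E + (vol (eball x r))%:E * (A * vol (eball x r))%:E)%E).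
    by apply: leeD; [apply: lee_wpmul2r|apply: lee_wpmul2l] => //; rewrite lee_fin ltW.
  rewrite -!EFinM -EFinD lee_fin exprD.
  have v1 := vol_eball_le x r0; set v := vol _ in v0 v1 *; set w := (2 * r) ^+ n in v1 *.
  have : v * v <= w * w by rewrite ler_pM// ltW.
  move=> vw; apply: (@le_trans _ _ ((2 * A) * (v * v))); first by rewrite le_eqVlt; apply/orP; left; apply/eqP; ring.
  apply: ler_pM => //; [exact: mulr_ge0|by rewrite mulr_ge0// ltW|by rewrite /M; lra].
- move=> k; have mI := @measurable_indic_ucube R n k.
  apply: (@le_trans _ _ (\int[mu]_y ((\1_(@ucube R n k) y)%:E + (\1_(@ucube R n k) y * g y ^+ 2)%:E))%E).
    apply: ge0_le_integral => //.
    + by apply/measurable_EFinP; apply: measurable_funM => //; exact: measurableT_comp.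
    + by apply: emeasurable_funD; [exact/measurable_EFinP|exact: mQ].
    + move=> y _; rewrite -EFinD lee_fin -[X in X + _]mulr1 -mulrDr ler_wpM2l//.
      (* The elementary bound t <= 1 + t^2. *)
      rewrite -[g y ^+ 2]real_normK ?num_real//; set t := `|_|.
      by have := sqr_ge0 (t - 2^-1); rewrite sqrrB; lra.
  rewrite ge0_integralD//; [|exact/measurable_EFinP|by move=> y _; rewrite lee_fin mulr_ge0 ?sqr_ge0].
  rewrite integral_indic_ucube (le_trans (leeD2l _ (HB k)))// -EFinD lee_fin /M; lra.
Qed.

Lemma bounded_bmo g (K : R) : measurable_fun setT g -> (forall y, `|g y| <= K) -> bmo g.
Proof.
move=> mg gK; have K0 : 0 <= K := le_trans (normr_ge0 _) (gK 0).
have mB (x : 'rV[R]_n) r (c : R) : measurable_fun setT (fun y : V => \1_(eball x r) y * `|g y - c|).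
  apply: measurable_funM; first exact: measurable_indic_eball.
  by apply: measurableT_comp => //; exact: measurable_funB.
have Bi (x : 'rV[R]_n) r (L : R) : 0 < r -> 0 <= L ->
    (\int[mu]_y (L * \1_(eball x r) y)%:E = (L * vol (eball x r))%:E)%E.
  move=> r0 L0; under eq_integral do rewrite EFinM.
  rewrite ge0_integralZl_EFin//; last by apply/measurable_EFinP; exact: measurable_indic_eball.
  by rewrite integral_indic_eball.
have HB (x : 'rV[R]_n) r (c L : R) : 0 < r -> (forall y, `|g y - c| <= L) ->
    (\int[mu]_y (\1_(eball x r) y * `|g y - c|)%:E <= (L * vol (eball x r))%:E)%E.
  move=> r0 gL; have L0 : 0 <= L := le_trans (normr_ge0 _) (gL 0).
  rewrite -Bi//; apply: ge0_le_integral => //.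
  - exact/measurable_EFinP.
  - by apply/measurable_EFinP; apply: measurable_funM => //; exact: measurable_indic_eball.
  - by move=> y _; rewrite lee_fin mulrC ler_wpM2r.
split.
  split; first exact/borel_funP.
  move=> x r r0; rewrite iintE; last 2 first.
  - by have := mB x r 0 => /measurable_EFinP; under eq_fun do rewrite subr0.
  - by move=> y; rewrite lee_fin mulr_ge0.
  have := HB x r 0 K r0; under eq_integral do rewrite subr0.
  move=> H; rewrite (le_lt_trans (H _)) ?ltry// => y; rewrite subr0//.
apply: (@le_lt_trans _ _ ((2 * K)%:E + K%:E)%E); last by rewrite -EFinD ltry.
apply: leeD; apply: ge_ereal_sup.
- move=> _ [x [r [r0 ->]]]; have v0 := vol_eball_gt0 x r0.
  rewrite iintE; last 2 first.
  + by apply/measurable_EFinP; exact: mB.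
  + by move=> y; rewrite lee_fin mulr_ge0.
  rewrite lee_pdivrMl// -EFinM mulrC; apply: HB => // y.
  rewrite (le_trans (ler_normB _ _))// (_ : 2 * K = K + K); last by ring.
  apply: lerD => //.
  have iK : mu.-integrable setT (EFin \o (fun y : V => K * \1_(eball x r) y)).
    apply: ge0_integrable; first by apply: measurable_funM => //; exact: measurable_indic_eball.
      by move=> z; rewrite mulr_ge0.
    by rewrite Bi// ltry.
  have bd (z : V) : `|\1_(eball x r) z * g z| <= K * \1_(eball x r) z.
    by rewrite normrM ger0_norm// mulrC ler_wpM2r.
  have iG : mu.-integrable setT (EFin \o (fun y : V => \1_(eball x r) y * g y)).
    apply: integrable_dom iK => //; apply: measurable_funM => //; exact: measurable_indic_eball.
  rewrite /avg iint_sE// normrM [`|_^-1|]ger0_norm ?invr_ge0 ?(ltW v0)// ler_pdivrMr//.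
  apply: (le_trans (Rintegral_le_norm iG iK bd)).
  by rewrite /Rintegral/= Bi.
- move=> _ [k ->]; have mQ := @measurable_indic_ucube R n k.
  have mq : measurable_fun setT (fun y : V => \1_(@ucube R n k) y * `|g y| ^+ 2).
    by apply: measurable_funM => //; apply: measurable_funX; exact: measurableT_comp.
  rewrite iintE; last 2 first.
  + exact/measurable_EFinP.
  + by move=> y; rewrite lee_fin mulr_ge0 ?sqr_ge0.
  have : (\int[mu]_y (\1_(@ucube R n k) y * `|g y| ^+ 2)%:E <= (K ^+ 2)%:E)%E.
    apply: (@le_trans _ _ (\int[mu]_y ((K ^+ 2)%:E * (\1_(@ucube R n k) y)%:E))%E).
      apply: ge0_le_integral => //.
      + exact/measurable_EFinP.
      + by apply: measurable_funeM; exact/measurable_EFinP.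
      + by move=> y _; rewrite -EFinM lee_fin mulrC ler_wpM2r// ler_sqr// nnegrE.
    rewrite ge0_integralZl_EFin ?sqr_ge0//; last exact/measurable_EFinP.
    by rewrite integral_indic_ucube mule1.
  case: (\int[mu]_y _)%E => [r||]//=; rewrite ?lee_fin// => rK.
  by rewrite -(ger0_norm K0) -sqrtr_sqr ler_wsqrtr.
Qed.

End Bmo.

(** * Positivity of the Bessel constant *)

Section Gamma.
Variable R : realType.
Notation leb := (@lebesgue_measure R).

Lemma Rintegral_gt0 (f : R -> R) (a b k : R) : leb.-integrable setT (EFin \o f) ->
  (forall t, 0 <= f t) -> a < b -> 0 < k -> (forall t, a <= t <= b -> k <= f t) ->
  0 < \int[leb]_t f t.
Proof.
move=> fi f0 ab k0 fk.
rewrite -lte_fin -integrable_EFinK//.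
apply: (@lt_le_trans _ _ (\int[leb]_(t in `[a, b]) k%:E)%E).
  by rewrite integral_cst//= lebesgue_measure_itv/= lte_fin ab -EFinD -EFinM lte_fin mulr_gt0// subr_gt0.
have mf := integrableR_measurable fi.
apply: (@le_trans _ _ (\int[leb]_(t in `[a, b]) (f t)%:E)%E).
  apply: ge0_le_integral => //=.
  - by move=> t _; rewrite lee_fin ltW.
  - by apply/measurable_EFinP; exact: measurable_funTS.
apply: ge0_subset_integral => //=; first exact/measurable_EFinP.
by move=> t _; rewrite lee_fin.
Qed.

Lemma powR_ge_norm (p d a : R) : 0 < a -> a <= d -> d <= 1 -> a `^ `|p| <= d `^ p.
Proof.
move=> a0 ad d1; have d0 : 0 < d by exact: lt_le_trans ad.
apply: (@le_trans _ _ (d `^ `|p|)); first by apply: ge0_ler_powR; rewrite ?nnegrE// ltW.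
by apply: ger_powR; [rewrite d0|exact: ler_norm].
Qed.

Lemma wt_integrable (s : R) : 0 < s -> leb.-integrable setT (EFin \o wt s).
Proof.
move=> s0; have s20 : 0 < s / 2 by rewrite divr_gt0.
have := integrable_RZl 2^-1 (wt_pow_integrable s0 (lexx 0) s20).
by apply: eq_integrableR => d; rewrite oppr0 !powRr0; field.
Qed.

(** Finiteness matters as much as positivity, since [fine] would send an infinite integral to 0. The
    integrand is dominated by [wt (2 * a)], whose exponential decays more slowly. *)
Lemma Gamma_gt0 (a : R) : 0 < a -> 0 < Gamma a.
Proof.
move=> a0; pose f (t : R) : R := pospow (a - 1) t * expR (- t).
have f0 (t : R) : 0 <= f t by rewrite mulr_ge0 ?pospow_ge0 ?expR_ge0.
have mf : measurable_fun setT f.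
  apply: measurable_funM; first exact: measurable_pospow.
  by apply: measurableT_comp => //; exact: oppr_measurable.
have -> : Gamma a = \int[leb]_t f t.
  rewrite /Gamma /Rintegral [in LHS]integral_mkcond; congr fine; apply: eq_integral => t _.
  rewrite patchE /f /pospow; case: ifPn; rewrite ?notin_setE ?in_setE/= => t0.
    by rewrite t0.
  by rewrite ifF ?mul0r//; apply/negbTE/negP.
have fi : leb.-integrable setT (EFin \o f).
  have a20 : 0 < 2 * a by rewrite mulr_gt0.
  apply: integrable_dom (wt_integrable a20) => // t.
  have [t0|t0] := leP t 0; first by rewrite wt_eq0// /f /pospow ltNge t0/= mul0r normr0.
  rewrite ger0_norm// /f /wt mulrC (_ : 2 * a / 2 = a); last by field.
  apply: ler_wpM2r; first exact: pospow_ge0.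
  rewrite ler_expR mulNr lerN2 ler_pdivrMr ?mulr_gt0 ?pi_gt0//.
  by rewrite ler_peMr// ?(ltW t0)//; have := pi_ge2 R; lra.
apply: (@Rintegral_gt0 f 2^-1 1 (2^-1 `^ `|a - 1| * expR (- 1)) fi f0); first by lra.
  by rewrite mulr_gt0 ?expR_gt0// powR_gt0.
move=> t /andP[t1 t2]; have t0 : 0 < t by apply: lt_le_trans t1.
rewrite /f /pospow t0; apply: ler_pM; rewrite ?powR_ge0 ?expR_ge0//.
  exact: powR_ge_norm.
by rewrite ler_expR lerN2.
Qed.

Lemma bessel_cst_gt0 (s : R) : 0 < s -> 0 < bessel_cst s.
Proof.
move=> s0; rewrite /bessel_cst invr_gt0 mulr_gt0//.
  by rewrite powR_gt0// mulr_gt0// pi_gt0.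
by rewrite Gamma_gt0// divr_gt0.
Qed.

Lemma normr_sin_le (t : R) : `|sin t| <= `|t|.
Proof.
wlog t0 : t / 0 <= t.
  move=> H; have [|/ltW t0] := leP 0 t; first exact: H.
  by rewrite -normrN -sinN -(normrN t); apply: H; rewrite oppr_ge0.
have [|c _] := @MVT_segment R sin cos 0 t t0 (fun x _ => is_derive_sin x).
  by apply: continuous_subspaceT; exact: continuous_sin.
by rewrite sin0 !subr0 => ->; rewrite normrM ler_piMl// cos_max.
Qed.

Lemma cos_sub1_le (t : R) : `|1 - cos t| <= `|t|.
Proof.
have -> : 1 - cos t = 2 * sin (t / 2) ^+ 2.
  have E : t = (t / 2) *+ 2 by rewrite mulr2n; field.
  by rewrite {1}E cos_mulr2n cos2sin2 !mulr2n; ring.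
rewrite ger0_norm; last by rewrite mulr_ge0// sqr_ge0.
rewrite -real_normK ?num_real//.
have h1 := sin_max (t / 2); have h2 := normr_sin_le (t / 2).
rewrite expr2 mulrCA.
have : `|t / 2| = `|t| / 2 by rewrite normrM [`|2^-1|]ger0_norm// invr_ge0.
set u := `|sin _| in h1 h2 *; have u0 : 0 <= u by exact: normr_ge0.
move=> tE; rewrite tE in h2; apply: (@le_trans _ _ (1 * (2 * u))); last by lra.
by apply: ler_wpM2r => //; rewrite mulr_ge0.
Qed.

End Gamma.

(** * Polynomial weights against Gaussians *)

Section GaussMoments.
Variables (R : realType) (n : nat).

(** Half of the exponent is split off to absorb powers of |y|/sqrt d; the other half is a Gaussian
    of doubled parameter. *)
Lemma gaussV_doubling (d : R) (y : 'rV[R]_n) : 0 < d ->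
  gaussV d y = 2 `^ (n%:R / 2) * expR (- (pi / 2 * (enorm y / Num.sqrt d) ^+ 2)) * gaussV (2 * d) y.
Proof.
move=> d0; rewrite /gaussV (powRM _ _ (ltW d0))// powRN [_ `^ (- (n%:R / 2))]powRN.
have c2n : 2 `^ (n%:R / 2) != 0 :> R by rewrite gt_eqF// powR_gt0.
set c2 := 2 `^ _ in c2n *; set cd := _^-1.
rewrite (_ : c2 * _ * _ = cd * (expR (- (pi / 2 * (enorm y / Num.sqrt d) ^+ 2)) * expR (- pi * enorm y ^+ 2 / (2 * d)))); last by field.
rewrite -expRD expr_div_n (sqr_sqrtr (ltW d0)); congr (_ * _); congr expR.
by field; rewrite gt_eqF.
Qed.

Lemma enorm_gaussV_le (d : R) (y : 'rV[R]_n) : 0 < d ->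
  enorm y * gaussV d y <= 2 `^ (n%:R / 2) * Num.sqrt d * gaussV (2 * d) y.
Proof.
move=> d0; rewrite gaussV_doubling//; have s0 : 0 < Num.sqrt d by rewrite sqrtr_gt0.
set t := enorm y / _; have yE : enorm y = t * Num.sqrt d by rewrite /t mulfVK ?gt_eqF.
rewrite [leLHS](_ : _ = 2 `^ (n%:R / 2) * Num.sqrt d * (t * expR (- (pi / 2 * t ^+ 2))) * gaussV (2 * d) y); last by rewrite yE; ring.
apply: ler_wpM2r; first exact: gaussV_ge0.
rewrite -[leRHS]mulr1; apply: ler_wpM2l; first by rewrite mulr_ge0 ?powR_ge0 ?(ltW s0).
have := @mulr_expRN_le R (2 * pi) t; rewrite (_ : 2 * pi / 4 = pi / 2); last by field.
by apply; have := pi_ge2 R; lra.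
Qed.

Lemma enorm_sqr_gaussV_le (d : R) (y : 'rV[R]_n) : 0 < d ->
  enorm y ^+ 2 * gaussV d y <= 2 `^ (n%:R / 2) * d * gaussV (2 * d) y.
Proof.
move=> d0; rewrite gaussV_doubling//; have s0 : 0 < Num.sqrt d by rewrite sqrtr_gt0.
set t := enorm y / _; have yE : enorm y = t * Num.sqrt d by rewrite /t mulfVK ?gt_eqF.
have t0 : 0 <= t by rewrite divr_ge0 ?enorm_ge0 ?(ltW s0).
rewrite [leLHS](_ : _ = 2 `^ (n%:R / 2) * d * (t ^+ 2 * expR (- (pi / 2 * t ^+ 2))) * gaussV (2 * d) y); last first.
  by rewrite yE exprMn (sqr_sqrtr (ltW d0)); ring.
apply: ler_wpM2r; first exact: gaussV_ge0.
rewrite -[leRHS]mulr1; apply: ler_wpM2l; first by rewrite mulr_ge0 ?powR_ge0 ?(ltW d0).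
rewrite (_ : - (pi / 2 * t ^+ 2) = - (pi / 4 * t ^+ 2) + - (pi / 4 * t ^+ 2)); last by field.
rewrite expRD (_ : _ * _ = (t * expR (- (pi / 4 * t ^+ 2))) ^+ 2); last by ring.
apply: exprn_ile1; first by apply: mulr_ge0 => //; exact: expR_ge0.
by apply: mulr_expRN_le; exact: pi_ge2.
Qed.

End GaussMoments.

(** * Cosine waves and their multipliers *)

Section CosineWaves.
Variables (R : realType) (n : nat).
Notation mu := (lebV R n.+1).
Notation V := (borelV R n.+1).
Notation leb := (@lebesgue_measure R).
Implicit Types (x h : 'rV[R]_n.+1) (w th : R).

(** The phase makes the family stable under differences, each of which adds [pi / 2] to it. *)
Definition cw w th x : R := cos (w * x ord0 ord0 + th).

Lemma cw_le1 w th x : `|cw w th x| <= 1.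
Proof. exact: cos_max. Qed.

Lemma continuous_cw w th : continuous (cw w th).
Proof.
move=> x; apply: (@continuous_comp _ _ _ (fun x : 'rV[R]_n.+1 => w * x ord0 ord0 + th) cos); last exact: continuous_cos.
apply: continuousD; last exact: cst_continuous.
by apply: continuousM; [exact: cst_continuous|exact: coord_continuous].
Qed.

Lemma measurable_cw w th : measurable_fun setT (cw w th : V -> R).
Proof. by apply: continuous_borelV_measurable; exact: continuous_cw. Qed.

Lemma cw_tame w th : tame (2 * 1) (cw w th : V -> R).
Proof. by apply: bounded_tame => //; [exact: measurable_cw|exact: cw_le1]. Qed.

Lemma cw_gint w th : gint (cw w th : V -> R).
Proof. exact: tame_gint (cw_tame w th). Qed.

Lemma cw_add w th x a : cw w th (x + a) = cos (w * x ord0 ord0 + th + w * a ord0 ord0).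
Proof. by rewrite /cw mxE mulrDr addrAC. Qed.

Lemma Delta_cw w th h x :
  Delta h (cw w th) x = 2 * sin (w * h ord0 ord0 / 2) * cw w (th + pi / 2) x.
Proof.
rewrite /Delta !cw_add !mxE [X in _ = _ * X]/cw addrA cosDpihalf.
have -> : w * - (2^-1 * h ord0 ord0) = - (w * h ord0 ord0 / 2) by ring.
have -> : w * (2^-1 * h ord0 ord0) = w * h ord0 ord0 / 2 by ring.
by rewrite cosB cosD; ring.
Qed.

Lemma iter_Delta_cw w th h m x : iter m (Delta h) (cw w th) x =
  (2 * sin (w * h ord0 ord0 / 2)) ^+ m * cw w (th + m%:R * (pi / 2)) x.
Proof.
elim: m x => [|m IH] x; first by rewrite /= expr0 mul1r mul0r addr0.
rewrite iterS {1}/Delta !IH -mulrBr -[X in _ * X]/(Delta h (cw w (th + m%:R * (pi / 2))) x).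
rewrite Delta_cw (_ : th + m.+1%:R * (pi / 2) = th + m%:R * (pi / 2) + pi / 2); last first.
  by rewrite -[m.+1%:R]natr1 mulrDl mul1r addrA.
by rewrite [in RHS]exprSr -[RHS]mulrA.
Qed.

(** The Gaussian multiplier, in closed form exp(-w^2 d/(4 pi)). The formula is replaced by three
    properties: nonnegativity, closeness to 1 for small d, decay for large d. *)
Definition phi w (d : R) := gconv (cw w 0) d 0.

(** By the addition formula the shifted wave is a cosine part and a sine part; the sine part is odd
    and drops out against the even Gaussian. *)
Lemma gconv_cw w th d x : 0 < d -> gconv (cw w th) d x = phi w d * cw w th x.
Proof.
move=> d0; pose P (y : V) : R := gaussV d (0 - (y : 'rV[R]_n.+1)).
have mP : measurable_fun setT P by exact: measurable_gaussVx.
have Pi : mu.-integrable setT (EFin \o P) by exact: integrable_gaussV.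
have P0 y : 0 <= P y by exact: gaussV_ge0.
have ms th' : measurable_fun setT (fun y : V => P y * cw w th' y).
  by apply: measurable_funM => //; exact: measurable_cw.
have iS th' : mu.-integrable setT (EFin \o (fun y : V => P y * cw w th' y)).
  apply: integrable_dom Pi => // y; rewrite normrM ger0_norm//.
  by rewrite -[leRHS]mulr1 ler_wpM2l// cw_le1.
have odd : \int[mu]_y (P y * cw w (pi / 2) y) = 0.
  have : \int[mu]_y (P y * cw w (pi / 2) y) = - \int[mu]_y (P y * cw w (pi / 2) y).
    rewrite -[LHS](Rintegral_opp (ms _)) -mulN1r -RintegralZl//.
    apply: eq_Rintegral => y _; rewrite /P !sub0r opprK gaussVN /cw !mxE !cosDpihalf.
    by rewrite (_ : w * - _ = - (w * (y : 'rV[R]_n.+1) ord0 ord0)) ?sinN; ring.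
  by move=> /eqP; rewrite -addr_eq0 -mulr2n mulrn_eq0/= => /eqP.
pose f (y : V) : R := gaussV d (x - (y : 'rV[R]_n.+1)) * cw w th y.
have mf : measurable_fun setT f.
  by apply: measurable_funM; [exact: measurable_gaussVx|exact: measurable_cw].
rewrite /gconv -(Rintegral_shift x mf).
have E (y : V) : f ((y : 'rV[R]_n.+1) + x) = cw w th x * (P y * cw w 0 y) - sin (w * x ord0 ord0 + th) * - (P y * cw w (pi / 2) y).
  rewrite /f /P opprD addrCA subrr addr0 sub0r.
  rewrite addrC cw_add /cw !addr0 cosDpihalf addrC cosD; ring.
under eq_Rintegral do rewrite E.
rewrite RintegralB//; last 2 first.
- exact: integrable_RZl.
- apply: integrable_RZl; apply: eq_integrableR (integrable_RZl (-1) (iS (pi / 2))) => y; ring.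
rewrite RintegralZl// RintegralZl//; last first.
  by apply: eq_integrableR (integrable_RZl (-1) (iS (pi / 2))) => y; ring.
rewrite [X in _ - _ * X](_ : _ = 0); last first.
  under eq_Rintegral do rewrite -mulN1r.
  by rewrite RintegralZl// odd mulr0.
by rewrite mulr0 subr0 mulrC.
Qed.

(** By the semigroup law the multiplier at d is the square of the multiplier at d/2. *)
Lemma phi_ge0 w d : 0 < d -> 0 <= phi w d.
Proof.
move=> d0; have d20 : 0 < d / 2 by rewrite divr_gt0.
rewrite /phi (gint_semigroup _ (cw_gint w 0) d0).
have -> : gconv (cw w 0) (d / 2) = (fun x => phi w (d / 2) * cw w 0 x).
  by apply/funext => x; rewrite gconv_cw.
rewrite {1}/gconv (_ : Rintegral _ _ _ = phi w (d / 2) * gconv (cw w 0) (d / 2) 0).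
  by rewrite -/(phi w (d / 2)) -expr2 sqr_ge0.
rewrite /gconv -RintegralZl//; last exact: (cw_gint w 0).2.
by apply: eq_Rintegral => y _; ring.
Qed.

Lemma phi_near1 w d : 0 < d ->
  `|1 - phi w d| <= `|w| * (2 `^ (n.+1%:R / 2) * Num.sqrt d).
Proof.
move=> d0; have d20 : 0 < 2 * d by rewrite mulr_gt0.
have i1 := @integrable_gaussV R n.+1 d 0 d0; have i2 := @integrable_gaussV R n.+1 (2 * d) 0 d20.
have ic := (cw_gint w 0).2 d 0 d0.
rewrite -{1}(@Rintegral_gaussV R n.+1 d 0 d0) /phi /gconv -RintegralB//.
rewrite [leRHS](_ : _ = \int[mu]_y (`|w| * (2 `^ (n.+1%:R / 2) * Num.sqrt d) * gaussV (2 * d) (0 - (y : 'rV[R]_n.+1)))); last first.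
  by rewrite RintegralZl// Rintegral_gaussV// mulr1.
apply: Rintegral_le_norm; [exact: integrable_RB|exact: integrable_RZl|].
move=> y; set G := gaussV d _; have G0 : 0 <= G by exact: gaussV_ge0.
rewrite -{1}[G]mulr1 -mulrBr normrM ger0_norm//.
have h := enorm_gaussV_le (0 - (y : 'rV[R]_n.+1)) d0; rewrite -/G in h.
apply: (@le_trans _ _ (`|w| * (enorm (0 - (y : 'rV[R]_n.+1)) * G))); last first.
  by rewrite -mulrA ler_wpM2l// mulrA.
rewrite [leRHS]mulrA [leRHS]mulrC; apply: ler_wpM2l => //.
have yn : `|(y : 'rV[R]_n.+1) ord0 ord0| <= enorm (0 - (y : 'rV[R]_n.+1)) by rewrite sub0r enormN coord_le_enorm.
apply: (@le_trans _ _ (`|w * (y : 'rV[R]_n.+1) ord0 ord0|)).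
  by rewrite /cw addr0; exact: cos_sub1_le.
by rewrite normrM; apply: ler_wpM2l.
Qed.

(** A wave is half of a difference of its quarter-turn shift, with step pi/w equal to half a period;
    the difference bound then supplies the factor 1/sqrt d. *)
Lemma phi_decay w : 0 < w -> exists2 C : R, 0 <= C & forall d, 1 <= d -> `|phi w d| <= C / Num.sqrt d.
Proof.
move=> w0; pose h : 'rV[R]_n.+1 := \row_i (if i == ord0 then pi / w else 0).
have h0 : h ord0 ord0 = pi / w by rewrite mxE eqxx.
have [C C0 HC] := @gconv_diff1 R n.+1 (enorm h).
exists (C * (2 * 1) * enorm h); first by rewrite !mulr_ge0 ?enorm_ge0.
move=> d d1; have d0 : 0 < d by apply: lt_le_trans d1.
have hd : enorm h <= enorm h * Num.sqrt d.
  by rewrite ler_peMr ?enorm_ge0// -[leLHS]sqrtr1 ler_wsqrtr.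
have := HC _ _ 0 _ _ (cw_tame w (- (pi / 2))) d0 hd.
rewrite -gconv_Delta//; last exact: cw_gint.
have -> : Delta h (cw w (- (pi / 2))) = (fun x => 2 * cw w 0 x).
  apply/funext => x; rewrite Delta_cw h0 (addNr (pi / 2)).
  by rewrite (_ : w * (pi / w) / 2 = pi / 2) ?sin_pihalf ?mulr1//; field; rewrite gt_eqF.
rewrite {1}/gconv (_ : Rintegral _ _ _ = 2 * phi w d); last first.
  rewrite /phi /gconv -RintegralZl//; last exact: (cw_gint w 0).2.
  by apply: eq_Rintegral => y _; ring.
rewrite normrM ger0_norm// -!mulrA => H.
by apply: le_trans H; rewrite ler_peMl//; lra.
Qed.

(** The Bessel multiplier, in closed form (1 + w^2)^(-s/2). *)
Definition besselc (s w : R) := bessel_cst s * \int[leb]_d (wt s d * phi w d).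

Lemma bessel_cw s w th x : 0 < s ->
  bessel_potential s (cw w th) x = besselc s w * cw w th x.
Proof.
move=> s0; have [i1 ->] := bessel_rep x s0 (cw_tame w th).
have [i2 _] := bessel_rep 0 s0 (cw_tame w 0).
rewrite /besselc -mulrA; congr (_ * _); rewrite -RintegralZr//.
apply: eq_Rintegral => d _; have [d0|d0] := leP (d : R) 0; first by rewrite wt_eq0// !mul0r.
by rewrite gconv_cw// mulrA.
Qed.

Lemma besselc_gt0 s w : 0 < s -> 0 < besselc s w.
Proof.
move=> s0; rewrite /besselc mulr_gt0 ?bessel_cst_gt0//.
have [i2 _] := bessel_rep (0 : 'rV[R]_n.+1) s0 (cw_tame w 0).
(* Chosen so that by [phi_near1] the multiplier is at least 1/2 for d <= dl = B^(-2); the integral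
   over [dl/2, dl] is then bounded below. *)
pose B : R := 2 * `|w| * 2 `^ (n.+1%:R / 2) + 1.
have B1 : 1 <= B by rewrite /B lerDr mulr_ge0 ?powR_ge0// mulr_ge0.
have B0 : 0 < B by apply: lt_le_trans B1.
pose dl : R := (B^-1) ^+ 2.
have dl0 : 0 < dl by rewrite exprn_gt0// invr_gt0.
have dl1 : dl <= 1 by apply: exprn_ile1; [rewrite invr_ge0 ltW|rewrite invf_le1].
pose k : R := expR (- 1 / (4 * pi)) * (dl / 2) `^ `|s / 2 - 1| * 2^-1.
apply: (@Rintegral_gt0 R _ (dl / 2) dl k i2).
- move=> d; have [d0|d0] := leP (d : R) 0; first by rewrite wt_eq0// mul0r.
  by apply: mulr_ge0; [exact: wt_ge0|exact: phi_ge0].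
- by rewrite ltr_pdivrMr// ltr_pMr// ltr1n.
- by rewrite /k mulr_gt0 ?invr_gt0// mulr_gt0 ?expR_gt0// powR_gt0// divr_gt0.
move=> d /andP[d1 d2]; have dl20 : 0 < dl / 2 by rewrite divr_gt0.
have d0 : 0 < d by apply: lt_le_trans d1.
have pd0 := pi_gt0 R.
rewrite /k; apply: ler_pM.
- by rewrite mulr_ge0 ?expR_ge0 ?powR_ge0.
- by rewrite invr_ge0.
- rewrite /wt /pospow d0; apply: ler_pM; rewrite ?expR_ge0 ?powR_ge0//.
    rewrite ler_expR !mulNr lerN2 ler_wpM2r ?invr_ge0 ?mulr_ge0 ?(ltW pd0)//.
    exact: le_trans dl1.
  by apply: powR_ge_norm => //; exact: le_trans dl1.
have h := phi_near1 w d0.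
have sd : Num.sqrt d <= B^-1.
  by rewrite -[leRHS](ger0_norm (ltW _)) ?invr_gt0// -sqrtr_sqr ler_wsqrtr.
have : `|w| * (2 `^ (n.+1%:R / 2) * Num.sqrt d) <= 2^-1.
  apply: (@le_trans _ _ ((`|w| * 2 `^ (n.+1%:R / 2)) / B)).
    by rewrite mulrA ler_wpM2l// mulr_ge0 ?powR_ge0.
  rewrite ler_pdivrMr// /B; set a := `|w| * _; rewrite (_ : 2 * `|w| * _ = 2 * a); last by rewrite /a mulrA.
  by lra.
move=> h2; have := le_trans h h2; rewrite ler_norml -/(phi w d) => /andP[_]; lra.
Qed.

Definition freq (j : nat) : R := pi * 2 ^+ j.

Lemma freq_gt0 j : 0 < freq j.
Proof. by rewrite mulr_gt0 ?pi_gt0// exprn_gt0. Qed.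

Lemma freq_inj : injective freq.
Proof.
move=> i j /(mulfI (lt0r_neq0 (pi_gt0 R))) /eqP.
by rewrite -!natrX eqr_nat eqn_exp2l// => /eqP.
Qed.

(* Half a period of the wave of frequency [freq j]. *)
Definition step (j : nat) : 'rV[R]_n.+1 := \row_i (if i == ord0 then 2^-1 ^+ j else 0).

Lemma step0 j : step j ord0 ord0 = 2^-1 ^+ j.
Proof. by rewrite mxE eqxx. Qed.

Lemma enorm_step j : enorm (step j) = 2^-1 ^+ j.
Proof.
rewrite /enorm (bigD1 ord0)//= big1 ?addr0; last first.
  by move=> i /negbTE i0; rewrite mxE i0 expr0n.
by rewrite step0 sqrtr_sqr ger0_norm// exprn_ge0// invr_ge0.
Qed.

(** The initial phase cancels the accumulated quarter turns, and the half-period step turns every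
    factor [2 * sin] into 2. *)
Lemma iter_Delta_step_cw j k x :
  iter k (Delta (step j)) (cw (freq j) (- (k%:R * (pi / 2)))) x = 2 ^+ k * cw (freq j) 0 x.
Proof.
rewrite iter_Delta_cw step0 addNr /freq (_ : pi * _ * _ / 2 = pi / 2).
  by rewrite sin_pihalf mulr1.
by rewrite -[pi * _ * _]mulrA -exprMn divff// expr1n mulr1.
Qed.

(** The eigenvalue is not evaluated: at the origin, a half-period difference of order m+1 of the
    potential of a wave equals 2^(m+1) times the eigenvalue, and [bessel_diff_bound] applies to the
    wave because waves are uniformly tame. *)
Lemma besselc_le s : 0 < s -> exists2 C : R, 0 <= C & forall j : nat,
  besselc s (freq j) <= C * (2^-1 ^+ j) `^ s.
Proof.
move=> s0; have sm : s < (Num.truncn s).+1%:R by have /andP[] := truncn_itv (ltW s0).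
set m := (Num.truncn s) in sm.
have [K K0 HK] := @bessel_diff_bound R n.+1 s s m s0 (lexx s) sm.
exists (K * (2 * 1)); first by rewrite !mulr_ge0.
move=> j; have t0 : 0 < 2^-1 ^+ j :> R by rewrite exprn_gt0// invr_gt0.
have := HK _ _ 0 (step j) (cw_tame (freq j) (- (m.+1%:R * (pi / 2)))).
rewrite enorm_step => /(_ t0).
have -> : bessel_potential s (cw (freq j) (- (m.+1%:R * (pi / 2)))) =
   (fun x => besselc s (freq j) * cw (freq j) (- (m.+1%:R * (pi / 2))) x).
  by apply/funext => x; rewrite bessel_cw.
rewrite iter_DeltaZ iter_Delta_step_cw [cw _ _ 0]/cw mxE mulr0 addr0 cos0 mulr1.
rewrite normrM (gtr0_norm (besselc_gt0 _ s0)) ger0_norm ?exprn_ge0//.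
apply: le_trans; rewrite ler_peMr ?(ltW (besselc_gt0 _ s0))//.
by rewrite exprn_ege1// ler1n.
Qed.

End CosineWaves.

(** * Moments of the Bessel kernel *)

Section KernelMoments.
Variables (R : realType) (n : nat).
Notation mu := (lebV R n).
Notation V := (borelV R n).
Notation leb := (@lebesgue_measure R).
Implicit Types (g : V -> R) (x z h : 'rV[R]_n).

Lemma gaussV_slope_le (d : R) x z : 1 <= d ->
  pi / d * (enorm z * (2 * enorm x + enorm z)) * gaussV d x <=
  2 * pi * 2 `^ (n%:R / 2) / Num.sqrt d * (enorm z + enorm z ^+ 2) * gaussV (2 * d) x.
Proof.
move=> d1; have d0 : 0 < d by exact: lt_le_trans d1.
have h1 := enorm_gaussV_le x d0.
have h2 : gaussV d x <= 2 `^ (n%:R / 2) * gaussV (2 * d) x.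
  have := @gaussV_le R n d (2 * d) x d0; rewrite (_ : 2 * d / d = 2); last by field; rewrite gt_eqF.
  by apply; lra.
have G0 := gaussV_ge0 (2 * d) x; have z0 := enorm_ge0 z; have p0 := pi_gt0 R.
have c0 : 0 <= 2 `^ (n%:R / 2) :> R by exact: powR_ge0.
set r := Num.sqrt d in h1 *.
have dE : d = r ^+ 2 by rewrite /r (sqr_sqrtr (ltW d0)).
have r1 : 1 <= r by rewrite /r -[leLHS]sqrtr1 ler_wsqrtr.
have r0 : 0 < r by apply: lt_le_trans r1.
move: G0 h1 h2 c0; set G2 := gaussV _ x; set G := gaussV d x; set c := 2 `^ _; set a := enorm z in z0 *.
move=> G0 h1 h2 c0.
apply: (@le_trans _ _ (pi / d * a * (2 * (c * r * G2) + a * (c * G2)))).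
  rewrite (_ : pi / d * _ * _ = pi / d * a * (2 * (enorm x * G) + a * G)); last by ring.
  apply: ler_wpM2l; first by apply: mulr_ge0 => //; apply: divr_ge0; exact: ltW.
  by apply: lerD; apply: ler_wpM2l.
rewrite dE (_ : _ / r ^+ 2 * _ * _ = pi * c * G2 / r * (2 * a + a ^+ 2 * r^-1)); last by field; rewrite gt_eqF.
rewrite [leRHS](_ : _ = pi * c * G2 / r * (2 * a + 2 * a ^+ 2)); last by ring.
apply: ler_wpM2l; first by apply: divr_ge0; [apply: mulr_ge0 => //; apply: mulr_ge0 => //; exact: ltW|exact: ltW].
rewrite lerD2l mulrC; apply: ler_wpM2r; first exact: sqr_ge0.
by apply: (@le_trans _ _ 1); [rewrite invf_le1|lra].
Qed.

(** Quantifies the slow variation of a wide Gaussian weight: 1/sqrt d per unit length, with a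
    quadratic term for long displacements. This is the price of moving a convolution across the
    weight. *)
Lemma gaussV_lip : exists2 C : R, 0 <= C & forall (d : R) x y, 1 <= d ->
  `|gaussV d x - gaussV d y| <=
  C / Num.sqrt d * (enorm (x - y) + enorm (x - y) ^+ 2) * (gaussV (2 * d) x + gaussV (2 * d) y).
Proof.
exists (2 * pi * 2 `^ (n%:R / 2)); first by rewrite mulr_ge0 ?powR_ge0// mulr_ge0// pi_ge0.
move=> d x y d1; have d0 : 0 < d by exact: lt_le_trans d1.
have p0 := pi_gt0 R; set z := x - y.
have cd0 : 0 <= d `^ (- (n%:R / 2)) by exact: powR_ge0.
pose p := pi * enorm x ^+ 2 / d; pose q := pi * enorm y ^+ 2 / d.
have gE (u : 'rV[R]_n) : gaussV d u = d `^ (- (n%:R / 2)) * expR (- (pi * enorm u ^+ 2 / d)).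
  by rewrite /gaussV !mulNr.
have : `|gaussV d x - gaussV d y| <= `|p - q| * gaussV d x + `|p - q| * gaussV d y.
  rewrite !gE -mulrBr normrM (ger0_norm cd0) -mulrDr -mulrDr.
  rewrite [leRHS]mulrCA; apply: ler_wpM2l => //.
  exact: expR_sub_le.
move=> /le_trans; apply; rewrite mulrDr.
have pd0 : 0 <= pi / d by apply: divr_ge0; exact: ltW.
have pqE : p - q = pi / d * (enorm x ^+ 2 - enorm y ^+ 2) by rewrite /p /q; ring.
have dzx := dotV_le x z; have dzy := dotV_le y z.
have xE : y = x - z by rewrite /z subKr.
have yE : x = y + z by rewrite /z addrC subrK.
have h1 : `|p - q| <= pi / d * (enorm z * (2 * enorm x + enorm z)).
  rewrite pqE normrM (ger0_norm pd0) ler_wpM2l// xE enormB_sqr.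
  rewrite (_ : _ - _ = dotV x z *+ 2 - enorm z ^+ 2); last by ring.
  rewrite (le_trans (ler_normB _ _))// normrMn (ger0_norm (sqr_ge0 _)) mulr2n; nra.
have h2 : `|p - q| <= pi / d * (enorm z * (2 * enorm y + enorm z)).
  rewrite pqE normrM (ger0_norm pd0) ler_wpM2l// yE enormD_sqr.
  rewrite (_ : _ - _ = dotV y z *+ 2 + enorm z ^+ 2); last by ring.
  rewrite (le_trans (ler_normD _ _))// normrMn (ger0_norm (sqr_ge0 _)) mulr2n; nra.
apply: lerD.
- apply: le_trans (gaussV_slope_le x z d1); apply: ler_wpM2r => //; exact: gaussV_ge0.
- apply: le_trans (gaussV_slope_le y z d1); apply: ler_wpM2r => //; exact: gaussV_ge0.
Qed.

Lemma bessel_kernelN (s : R) x : bessel_kernel s (- x) = bessel_kernel s x.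
Proof. by rewrite /bessel_kernel enormN. Qed.

Lemma bessel_kernel_ge0 (s : R) x : 0 < s -> 0 <= bessel_kernel s x.
Proof.
move=> s0; rewrite bessel_kernelE mulr_ge0 ?(ltW (bessel_cst_gt0 s0))//.
by apply: Rintegral_ge0 => d _; apply: mulr_ge0; [exact: gaussV_ge0|exact: wt_ge0].
Qed.

(** An inequality only, because [bessel_kernel] takes the value 0 where the integral on the right is
    infinite. *)
Lemma bessel_kernel_le (s : R) x : 0 < s ->
  ((bessel_kernel s x)%:E <= (bessel_cst s)%:E * \int[leb]_d (gaussV d x * wt s d)%:E)%E.
Proof.
move=> s0; rewrite bessel_kernelE EFinM lee_wpmul2l ?lee_fin ?(ltW (bessel_cst_gt0 s0))//.
have : (0 <= \int[leb]_d (gaussV d x * wt s d)%:E)%E.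
  by apply: integral_ge0 => d _; rewrite lee_fin; apply: mulr_ge0; [exact: gaussV_ge0|exact: wt_ge0].
by rewrite /Rintegral; case: (\int[leb]_d _)%E => [r||]//=; rewrite leey.
Qed.

Lemma measurable_bessel_kernel (s : R) :
  measurable_fun setT (bessel_kernel s : V -> R).
Proof.
pose F (p : V * measurableTypeR R) := (gaussV p.2 (0 - (p.1 : 'rV[R]_n)) * wt s p.2)%:E.
have mF : measurable_fun setT F by apply/measurable_EFinP; exact: measurable_gauss_wt.
have F0 p : (0 <= F p)%E by rewrite lee_fin; apply: mulr_ge0; [exact: gaussV_ge0|exact: wt_ge0].
have -> : (bessel_kernel s : V -> R) = (fun x => bessel_cst s * fine (fubini_F leb F x)).
  have E (x : V) : fubini_F leb F x = (\int[leb]_d (gaussV d (x : 'rV[R]_n) * wt s d)%:E)%E.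
    by apply: eq_integral => d _; rewrite /F/= sub0r gaussVN.
  by apply/funext => x; rewrite E bessel_kernelE.
apply: measurable_funM => //; apply: measurableT_comp => //.
exact: measurable_fun_fubini_tonelli_F.
Qed.

Lemma measurable_sub2 : measurable_fun setT
  (fun p : V * V => ((p.1 : 'rV[R]_n) - (p.2 : 'rV[R]_n) : V)).
Proof.
apply: measurable_rV => i; under eq_fun do rewrite !mxE.
by apply: measurable_funB;
  [exact: (measurableT_comp (measurable_coord i) measurable_fst)
  |exact: (measurableT_comp (measurable_coord i) measurable_snd)].
Qed.

(** Dominates the displacement factor of [gaussV_lip]; the summand 1 makes it also dominate the
    plain kernel. *)
Definition moment x : R := 1 + enorm x + enorm x ^+ 2.

Lemma moment_ge1 x : 1 <= moment x.
Proof. by rewrite /moment -addrA lerDl addr_ge0 ?enorm_ge0 ?sqr_ge0. Qed.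

Lemma moment_ge0 x : 0 <= moment x.
Proof. exact: le_trans (moment_ge1 x). Qed.

Lemma measurable_moment : measurable_fun setT (moment : V -> R).
Proof.
apply: measurable_funD; last by apply: measurable_funX; exact: measurable_enorm.
by apply: measurable_funD => //; exact: measurable_enorm.
Qed.

Lemma moment_gaussV_le (d : R) x : 0 < d ->
  moment x * gaussV d x <= 2 `^ (n%:R / 2) * (1 + Num.sqrt d + d) * gaussV (2 * d) x.
Proof.
move=> d0; rewrite /moment.
have h1 := enorm_gaussV_le x d0; have h2 := enorm_sqr_gaussV_le x d0.
have h3 : gaussV d x <= 2 `^ (n%:R / 2) * gaussV (2 * d) x.
  have := @gaussV_le R n d (2 * d) x d0; rewrite (_ : 2 * d / d = 2); last by field; rewrite gt_eqF.
  by apply; lra.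
rewrite (_ : _ * gaussV d x = gaussV d x + enorm x * gaussV d x + enorm x ^+ 2 * gaussV d x); last by ring.
rewrite (_ : _ * gaussV (2 * d) x = 2 `^ (n%:R / 2) * gaussV (2 * d) x + 2 `^ (n%:R / 2) * Num.sqrt d * gaussV (2 * d) x + 2 `^ (n%:R / 2) * d * gaussV (2 * d) x); last by ring.
by apply: lerD => //; exact: lerD.
Qed.

Lemma wt_moment (s d : R) : 0 < d ->
  (1 + Num.sqrt d + d) * wt s d = wt s d + wt (s + 1) d + wt (s + 2) d.
Proof.
move=> d0; rewrite /wt /pospow d0 -powR12_sqrt ?(ltW d0)//.
rewrite (_ : (s + 1) / 2 - 1 = 2^-1 + (s / 2 - 1)); last by field.
rewrite (_ : (s + 2) / 2 - 1 = 1 + (s / 2 - 1)); last by field.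
rewrite !(@powRD _ d); do ?by rewrite (gt_eqF d0) implybT.
by rewrite powRr1 ?(ltW d0)//; ring.
Qed.

(** After Tonelli the polynomial factor costs 1 + sqrt d + d and a doubled Gaussian parameter. By
    [wt_moment] these factors only raise the order from s to s+1 and s+2, where the scale integrals
    still converge. *)
Lemma kernel_moment_bound (s : R) : 0 < s -> exists2 C : R, 0 <= C & forall M g x, tame M g ->
  (\int[mu]_y (moment (x - (y : 'rV[R]_n)) * bessel_kernel s (x - (y : 'rV[R]_n)) * `|g y|)%:E <= (C * M)%:E)%E.
Proof.
move=> s0; have B0 := bessel_cst_gt0 s0.
pose e := s / 4; have e0 : 0 < e by rewrite divr_gt0.
have [C C0 HC] := @gconv_abs_bound R n e e0.
pose W (d : R) : R := wt s d + wt (s + 1) d + wt (s + 2) d.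
have W0 d : 0 <= W d by rewrite !addr_ge0 ?wt_ge0.
have iW : leb.-integrable setT (EFin \o (fun d : R => W d * (d `^ e + d `^ (- e)))).
  have H (k : R) : 0 <= k -> leb.-integrable setT (EFin \o (fun d : R => wt (s + k) d * (d `^ e + d `^ (- e)))).
    by move=> k0; apply: wt_pow_integrable; rewrite ?(ltW e0)//; rewrite /e; lra.
  have := integrable_RD (integrable_RD (H 0 (lexx _)) (H 1 ler01)) (H 2 (ler0n _ _)).
  by apply: eq_integrableR => d; rewrite addr0 /W; ring.
pose c2 : R := 2 `^ (n%:R / 2); have c20 : 0 <= c2 by exact: powR_ge0.
pose L := \int[leb]_d (W d * (d `^ e + d `^ (- e))).
have Wd0 (d : R) : 0 <= W d * (d `^ e + d `^ (- e)) by rewrite mulr_ge0// addr_ge0 ?powR_ge0.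
have L0 : 0 <= L by apply: Rintegral_ge0 => d _.
pose c3 := c2 * (C * 2 `^ e); have c30 : 0 <= c3 by rewrite mulr_ge0// mulr_ge0 ?powR_ge0.
exists (bessel_cst s * (c3 * L)); first by rewrite !mulr_ge0 ?(ltW B0).
move=> M g x tg; have [M0 mg _ _] := tg; have [_ ga] := tame_gint (tame_norm tg).
have mxy (f : V -> R) : measurable_fun setT f -> measurable_fun setT (fun y : V => f (x - (y : 'rV[R]_n))).
  by move=> mf; exact: (measurableT_comp mf (measurable_subr_borelV x)).
pose F (p : V * measurableTypeR R) : R :=
  moment (x - (p.1 : 'rV[R]_n)) * (gaussV p.2 (x - (p.1 : 'rV[R]_n)) * wt s p.2) * `|g p.1|.
have mF : measurable_fun setT (EFin \o F).
  apply/measurable_EFinP; apply: measurable_funM; last first.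
    by apply: measurableT_comp => //; exact: (measurableT_comp mg measurable_fst).
  apply: measurable_funM; last exact: measurable_gauss_wt.
  exact: (measurableT_comp (mxy _ measurable_moment) measurable_fst).
have F0 p : (0 <= (EFin \o F) p)%E.
  rewrite lee_fin; apply: mulr_ge0 => //; apply: mulr_ge0; first exact: moment_ge0.
  by apply: mulr_ge0; [exact: gaussV_ge0|exact: wt_ge0].
apply: (@le_trans _ _ (\int[mu]_y ((bessel_cst s)%:E * fubini_F leb (EFin \o F) y))%E).
  apply: ge0_le_integral => //.
  - move=> y _; rewrite lee_fin; apply: mulr_ge0 => //; apply: mulr_ge0; first exact: moment_ge0.
    exact: bessel_kernel_ge0.
  - apply/measurable_EFinP; apply: measurable_funM; last exact: measurableT_comp.
    by apply: measurable_funM; apply: mxy; [exact: measurable_moment|exact: measurable_bessel_kernel].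
  - by apply: measurable_funeM; exact: measurable_fun_fubini_tonelli_F.
  move=> y _; rewrite /fubini_F/=.
  pose k := moment (x - (y : 'rV[R]_n)) * `|g y|.
  have k0 : 0 <= k by apply: mulr_ge0 => //; exact: moment_ge0.
  have FE d : (F (y, d))%:E = (k%:E * (gaussV d (x - (y : 'rV[R]_n)) * wt s d)%:E)%E.
    by rewrite -EFinM /F /k/=; congr EFin; ring.
  under eq_integral do rewrite FE.
  rewrite ge0_integralZl_EFin//; last 2 first.
  - by move=> d _; rewrite lee_fin; apply: mulr_ge0; [exact: gaussV_ge0|exact: wt_ge0].
  - by apply/measurable_EFinP; exact: measurable_gauss_wt1.
  rewrite (_ : moment _ * _ * _ = k * bessel_kernel s (x - (y : 'rV[R]_n))); last by rewrite /k; ring.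
  rewrite EFinM muleCA lee_wpmul2l ?lee_fin//; exact: bessel_kernel_le.
rewrite ge0_integralZl_EFin ?(ltW B0)//; last 2 first.
- by move=> y _; apply: integral_ge0 => d _; exact: F0.
- exact: measurable_fun_fubini_tonelli_F.
rewrite -mulrA EFinM lee_wpmul2l ?lee_fin ?(ltW B0)//.
rewrite [leLHS](fubini_tonelli (m1 := mu) (m2 := leb) (EFin \o F) mF F0).
apply: (@le_trans _ _ (\int[leb]_d (c3 * M * (W d * (d `^ e + d `^ (- e))))%:E)%E).
  apply: ge0_le_integral => //.
  - by move=> d _; apply: integral_ge0 => y _; exact: F0.
  - exact: (measurable_fun_fubini_tonelli_G (EFin \o F)).
  - by have /integrableP[] := integrable_RZl (c3 * M) iW.
  move=> d _; rewrite /fubini_G.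
  have [d0|d0] := leP (d : R) 0.
    under eq_integral do rewrite /F/= wt_eq0// mulr0 mulr0 mul0r.
    by rewrite integral0 lee_fin mulr_ge0// mulr_ge0.
  have d20 : 0 < 2 * d by rewrite mulr_gt0.
  have wE := wt_moment s d0; rewrite -/(W d) in wE.
  apply: (@le_trans _ _ (\int[mu]_y ((c2 * W d)%:E * (gaussV (2 * d) (x - (y : 'rV[R]_n)) * `|g y|)%:E))%E).
    apply: ge0_le_integral => //.
    - exact: (measurableT_comp mF (measurable_pair2 _)).
    - by apply: measurable_funeM; have /integrableP[] := ga (2 * d) x d20.
    move=> y _; rewrite -EFinM lee_fin /F/=.
    have := moment_gaussV_le (x - (y : 'rV[R]_n)) d0; set z := x - _ => h.
    rewrite [leLHS](_ : _ = moment z * gaussV d z * (wt s d * `|g y|)); last by ring.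
    rewrite [leRHS](_ : _ = c2 * (1 + Num.sqrt d + d) * gaussV (2 * d) z * (wt s d * `|g y|)); last by rewrite -wE; ring.
    by apply: ler_wpM2r => //; apply: mulr_ge0 => //; exact: wt_ge0.
  rewrite ge0_integralZl_EFin; last 4 first.
  - exact: measurableT.
  - by move=> y _; rewrite lee_fin; apply: mulr_ge0 => //; exact: gaussV_ge0.
  - by have /integrableP[] := ga (2 * d) x d20.
  - exact: mulr_ge0.
  rewrite integrable_EFinK; last exact: ga.
  rewrite -EFinM lee_fin.
  have h := HC M g x (2 * d) tg d20; rewrite /gconv in h.
  apply: (@le_trans _ _ (c2 * W d * (C * M * ((2 * d) `^ e + (2 * d) `^ (- e))))).
    by apply: ler_wpM2l => //; exact: mulr_ge0.
  rewrite (_ : c3 * M * _ = c2 * W d * (C * M * (2 `^ e * (d `^ e + d `^ (- e))))); last by rewrite /c3; ring.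
  apply: ler_wpM2l; first exact: mulr_ge0.
  apply: ler_wpM2l; first exact: mulr_ge0.
  rewrite !powRM ?(ltW d0)// mulrDr lerD2l; apply: ler_wpM2r; first exact: powR_ge0.
  by apply: ler_powR; [rewrite ler1n|lra].
rewrite integrable_EFinK; last exact: integrable_RZl.
by rewrite lee_fin RintegralZl// -/L; lra.
Qed.

End KernelMoments.

(** * Self-adjointness of the Bessel potential up to a vanishing error *)

Section KernelMeans.
Variables (R : realType) (n : nat).
Notation mu := (lebV R n).
Notation V := (borelV R n).
Notation leb := (@lebesgue_measure R).
Implicit Types (g u v : V -> R) (x z h : 'rV[R]_n).

Lemma powR_ge1 (d q : R) : 1 <= d -> 0 <= q -> 1 <= d `^ q.
Proof. by move=> d1 q0; rewrite -[leLHS](powRr0 d); exact: ler_powR. Qed.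

Lemma kernel_bound (s : R) : 0 < s -> exists2 C : R, 0 <= C & forall M g x, tame M g ->
  (\int[mu]_y (bessel_kernel s (x - (y : 'rV[R]_n)) * `|g y|)%:E <= (C * M)%:E)%E.
Proof.
move=> s0; have [C C0 HC] := @kernel_moment_bound R n s s0; exists C => // M g x tg.
have [M0 mg _ _] := tg; apply: le_trans (HC M g x tg).
have mK := measurableT_comp (@measurable_bessel_kernel R n s) (measurable_subr_borelV x).
have mm := measurableT_comp (@measurable_moment R n) (measurable_subr_borelV x).
have mng : measurable_fun setT (fun y => `|g y|) by exact: measurableT_comp.
apply: ge0_le_integral => //.
- by move=> y _; rewrite lee_fin mulr_ge0// bessel_kernel_ge0.
- by apply/measurable_EFinP; exact: measurable_funM.
- by apply/measurable_EFinP; apply: measurable_funM => //; exact: measurable_funM.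
move=> y _; rewrite lee_fin; apply: ler_wpM2r => //.
by rewrite ler_peMl ?bessel_kernel_ge0// moment_ge1.
Qed.

Lemma bessel_integrable (s M : R) g x : 0 < s -> tame M g ->
  mu.-integrable setT (EFin \o (fun y : V => bessel_kernel s (x - (y : 'rV[R]_n)) * g y)).
Proof.
move=> s0 tg; have [C C0 HC] := kernel_bound s0; have [M0 mg _ _] := tg.
have mK := measurableT_comp (@measurable_bessel_kernel R n s) (measurable_subr_borelV x).
have mng : measurable_fun setT (fun y => `|g y|) by exact: measurableT_comp.
apply: (@integrable_dom _ _ _ mu _ (fun y : V => bessel_kernel s (x - (y : 'rV[R]_n)) * `|g y|)).
- exact: measurable_funM.
- by move=> y; rewrite normrM ger0_norm ?bessel_kernel_ge0.
apply: ge0_integrable; first exact: measurable_funM.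
  by move=> y; rewrite mulr_ge0// bessel_kernel_ge0.
by rewrite (le_lt_trans (HC _ _ _ tg))// ltry.
Qed.

Lemma bessel_potentialE (s M : R) g x : 0 < s -> tame M g ->
  bessel_potential s g x = \int[mu]_y (bessel_kernel s (x - (y : 'rV[R]_n)) * g y).
Proof. by move=> s0 tg; rewrite /bessel_potential iint_sE//; exact: bessel_integrable tg. Qed.

Lemma Rfubini_norm_le (f : V * V -> R) (c : R) : measurable_fun setT f ->
  (\int[mu]_x \int[mu]_y `|f (x, y)|%:E <= c%:E)%E -> `|\int[mu]_x \int[mu]_y f (x, y)| <= c.
Proof.
move=> mf fc; have fi : (\int[mu]_x \int[mu]_y `|f (x, y)|%:E < +oo)%E by rewrite (le_lt_trans fc)// ltry.
have iF := integrable_Rfubini (m1 := mu) (m2 := mu) mf fi.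
rewrite -lee_fin EFin_normr_Rintegral//; apply: le_trans fc.
have mnf : measurable_fun setT (fun p : V * V => `|f p|%:E) by apply/measurable_EFinP; exact: measurableT_comp.
apply: (le_trans (le_abse_integral mu measurableT _)); first by case/integrableP : iF.
apply: ge0_le_integral => //.
- by apply: measurableT_comp => //; case/integrableP : iF.
- exact: (measurable_fun_fubini_tonelli_F (fun p : V * V => `|f p|%:E)).
have fabs (e : \bar R) : (`|(fine e)%:E| <= `|e|)%E by case: e => [r||]//=; rewrite normr0 leey.
move=> x _; apply: (@le_trans _ _ `|\int[mu]_y (f (x, y))%:E|%E); first exact: fabs.
apply: (le_abse_integral mu measurableT).
by apply/measurable_EFinP; exact: (measurableT_comp mf (measurable_pair1 _)).
Qed.

(** The exponent is -1/2 from the slope of the weight plus 1/4 from the growth of the Gaussian mean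
    of |g|, which is [gconv_abs_bound] with e = 1/4. *)
Lemma kernel_lip_bound (s : R) : 0 < s -> exists2 C : R, 0 <= C & forall M g (d : R), tame M g -> 1 <= d ->
  (\int[mu \x mu]_p (`|gaussV d (p.1 : 'rV[R]_n) - gaussV d (p.2 : 'rV[R]_n)| *
     (bessel_kernel s ((p.1 : 'rV[R]_n) - (p.2 : 'rV[R]_n)) * `|g p.2|))%:E
   <= (C * M * d `^ (- (1 / 4)))%:E)%E.
Proof.
move=> s0; have [C0 C00 HC0] := @gaussV_lip R n.
have [C1 C10 HC1] := @kernel_moment_bound R n s s0.
have q0 : 0 < 1 / 4 :> R by lra.
have [C2 C20 HC2] := @gconv_abs_bound R n (1 / 4) q0.
pose C3 : R := C1 * (2 * 1) * (C2 * (2 `^ (1 / 4) + 1)).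
have C30 : 0 <= C3 by rewrite !mulr_ge0// addr_ge0 ?powR_ge0.
exists (C0 * (C1 + C3)); first by rewrite mulr_ge0// addr_ge0.
move=> M g d tg d1; have [M0 mg _ _] := tg; have [_ ga] := tame_gint (tame_norm tg).
have d0 : 0 < d by exact: lt_le_trans d1.
have d20 : 0 < 2 * d by rewrite mulr_gt0.
have sd0 : 0 < Num.sqrt d by rewrite sqrtr_gt0.
have mK := measurableT_comp (@measurable_bessel_kernel R n s) (@measurable_sub2 R n).
have mm := measurableT_comp (@measurable_moment R n) (@measurable_sub2 R n).
have mng : measurable_fun setT (fun y => `|g y|) by exact: measurableT_comp.
have mg2 : measurable_fun setT (fun p : V * V => `|g p.2|) by exact: (measurableT_comp mng measurable_snd).
have mG c : measurable_fun setT (fun y : V => gaussV c (y : 'rV[R]_n)) by exact: measurable_gaussV.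
have mG1 c : measurable_fun setT (fun p : V * V => gaussV c (p.1 : 'rV[R]_n)) by exact: (measurableT_comp (mG c) measurable_fst).
have mG2 c : measurable_fun setT (fun p : V * V => gaussV c (p.2 : 'rV[R]_n)) by exact: (measurableT_comp (mG c) measurable_snd).
pose H (p : V * V) : R := moment ((p.1 : 'rV[R]_n) - (p.2 : 'rV[R]_n)) * bessel_kernel s ((p.1 : 'rV[R]_n) - (p.2 : 'rV[R]_n)) * `|g p.2|.
have mH : measurable_fun setT H by apply: measurable_funM => //; exact: measurable_funM.
have K0 x : 0 <= bessel_kernel s x by exact: bessel_kernel_ge0.
have H0 p : 0 <= H p by apply: mulr_ge0 => //; apply: mulr_ge0 => //; exact: moment_ge0.
pose F1 (p : V * V) := (gaussV (2 * d) (p.1 : 'rV[R]_n) * H p)%:E.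
pose F2 (p : V * V) := (gaussV (2 * d) (p.2 : 'rV[R]_n) * H p)%:E.
have mF1 : measurable_fun setT F1 by apply/measurable_EFinP; exact: measurable_funM.
have mF2 : measurable_fun setT F2 by apply/measurable_EFinP; exact: measurable_funM.
have F10 p : (0 <= F1 p)%E by rewrite lee_fin; apply: mulr_ge0 => //; exact: gaussV_ge0.
have F20 p : (0 <= F2 p)%E by rewrite lee_fin; apply: mulr_ge0 => //; exact: gaussV_ge0.
have T1 : (\int[mu \x mu]_p F1 p <= (C1 * M)%:E)%E.
  rewrite (fubini_tonelli1 F1)//.
  apply: (@le_trans _ _ (\int[mu]_x ((C1 * M)%:E * (gaussV (2 * d) (x : 'rV[R]_n))%:E))%E).
    apply: ge0_le_integral => //.
    - by move=> x _; apply: integral_ge0 => y _; exact: F10.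
    - exact: measurable_fun_fubini_tonelli_F.
    - by apply: measurable_funeM; exact/measurable_EFinP.
    move=> x _; rewrite /fubini_F/F1/=; under eq_integral do rewrite EFinM.
    rewrite ge0_integralZl_EFin; last 4 first.
    - exact: measurableT.
    - by move=> y _; rewrite lee_fin; exact: H0.
    - by apply/measurable_EFinP; exact: (measurableT_comp mH (measurable_pair1 _)).
    - exact: gaussV_ge0.
    rewrite muleC lee_wpmul2r ?lee_fin ?gaussV_ge0//; exact: HC1.
  rewrite ge0_integralZl_EFin; last 4 first.
  - exact: measurableT.
  - by move=> y _; rewrite lee_fin; exact: gaussV_ge0.
  - exact/measurable_EFinP.
  - exact: mulr_ge0.
  by rewrite ge0_integral_gaussV// mule1.
have T2 : (\int[mu \x mu]_p F2 p <= (C3 * M * d `^ (1 / 4))%:E)%E.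
  rewrite (fubini_tonelli2 F2)//.
  (* With the weight at [y], the integral over [x] is a moment of the kernel alone, that is, the
     bound for the tame constant 1. *)
  have t1 : tame (2 * 1) (cst 1 : V -> R) by apply: bounded_tame => // y; rewrite normr1.
  apply: (@le_trans _ _ (\int[mu]_y ((C1 * (2 * 1))%:E * (gaussV (2 * d) (0 - (y : 'rV[R]_n)) * `|g y|)%:E))%E).
    apply: ge0_le_integral => //.
    - by move=> y _; apply: integral_ge0 => x _; exact: F20.
    - exact: measurable_fun_fubini_tonelli_G.
    - by apply: measurable_funeM; have /integrableP[] := ga (2 * d) 0 d20.
    move=> y _; rewrite /fubini_G/F2/=.
    have E (x : V) : (gaussV (2 * d) (y : 'rV[R]_n) * H (x, y))%:E =
       ((gaussV (2 * d) (y : 'rV[R]_n) * `|g y|)%:E *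
        (moment ((y : 'rV[R]_n) - (x : 'rV[R]_n)) * bessel_kernel s ((y : 'rV[R]_n) - (x : 'rV[R]_n)) * `|cst 1 x|)%:E)%E.
      rewrite -EFinM /H/= normr1 -[y in moment (y - x)]opprK -[y in bessel_kernel s (y - x)]opprK.
      by rewrite -!opprD bessel_kernelN /moment enormN [_ + x]addrC; congr EFin; ring.
    under eq_integral do rewrite E.
    rewrite ge0_integralZl_EFin; last 4 first.
    - exact: measurableT.
    - by move=> x _; rewrite lee_fin; apply: mulr_ge0 => //; apply: mulr_ge0 => //; exact: moment_ge0.
    - apply/measurable_EFinP; apply: measurable_funM; last by apply: measurableT_comp.
      by apply: measurable_funM; [exact: (measurableT_comp (@measurable_moment R n) (measurable_subr_borelV y))
       |exact: (measurableT_comp (@measurable_bessel_kernel R n s) (measurable_subr_borelV y))].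
    - by apply: mulr_ge0 => //; exact: gaussV_ge0.
    rewrite sub0r gaussVN muleC lee_wpmul2r//; last exact: HC1.
    by rewrite lee_fin; apply: mulr_ge0 => //; exact: gaussV_ge0.
  rewrite ge0_integralZl_EFin; last 4 first.
  - exact: measurableT.
  - by move=> y _; rewrite lee_fin; apply: mulr_ge0 => //; exact: gaussV_ge0.
  - by have /integrableP[] := ga (2 * d) 0 d20.
  - by rewrite !mulr_ge0.
  rewrite integrable_EFinK; last exact: ga.
  rewrite -EFinM lee_fin.
  have h := HC2 M g 0 (2 * d) tg d20; rewrite /gconv in h.
  rewrite /C3 -!mulrA; do 3 apply: ler_wpM2l => //; rewrite !mulrA.
  apply: (le_trans h); rewrite -!mulrA; apply: ler_wpM2l => //.
  rewrite mulrCA; apply: ler_wpM2l => //.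
  have p1 : 1 <= d `^ (1 / 4) by apply: powR_ge1 => //; lra.
  rewrite [(2 * d) `^ (1 / 4)]powRM ?(ltW d0)// [leRHS]mulrDl [X in _ <= _ + X]mul1r lerD2l.
  apply: le_trans p1; rewrite -[leRHS](powRr0 (2 * d)).
  by apply: ler_powR; [move: d1; clear; lra|clear; lra].
apply: (@le_trans _ _ (\int[mu \x mu]_p ((C0 / Num.sqrt d)%:E * (F1 p + F2 p)))%E).
  apply: ge0_le_integral => //.
  - by move=> p _; rewrite lee_fin; apply: mulr_ge0 => //; exact: mulr_ge0.
  - apply/measurable_EFinP; apply: measurable_funM; last exact: measurable_funM.
    by apply: measurableT_comp => //; exact: measurable_funB.
  - by apply: measurable_funeM; exact: emeasurable_funD.
  move=> p _; rewrite -EFinD -EFinM lee_fin /H.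
  have := HC0 d p.1 p.2 d1; set z := (p.1 : 'rV[R]_n) - _; set G := gaussV _ _ + gaussV _ _ => h.
  apply: (le_trans (ler_wpM2r (mulr_ge0 (K0 z) (normr_ge0 _)) h)).
  rewrite [leRHS](_ : _ = C0 / Num.sqrt d * moment z * G * (bessel_kernel s z * `|g p.2|)); last by rewrite /G; ring.
  apply: ler_wpM2r; first exact: mulr_ge0.
  apply: ler_wpM2r; first by apply: addr_ge0; exact: gaussV_ge0.
  apply: ler_wpM2l; first by apply: divr_ge0 => //; exact: ltW.
  by rewrite /moment -addrA lerDr.
rewrite ge0_integralZl_EFin; last 4 first.
- exact: measurableT.
- by move=> p _; apply: adde_ge0.
- exact: emeasurable_funD.
- by apply: divr_ge0 => //; exact: ltW.
rewrite ge0_integralD//.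
apply: (@le_trans _ _ ((C0 / Num.sqrt d)%:E * ((C1 * M)%:E + (C3 * M * d `^ (1 / 4))%:E))%E).
  by rewrite lee_wpmul2l ?leeD// lee_fin; apply: divr_ge0 => //; exact: ltW.
rewrite -EFinD -EFinM lee_fin -powR12_sqrt ?(ltW d0)//.
have p1 : 1 <= d `^ (1 / 4) by apply: powR_ge1 => //; lra.
have pE : d `^ 2^-1 = d `^ (1 / 4) * d `^ (1 / 4).
  by rewrite -powRD ?(gt_eqF d0) ?implybT//; congr (_ `^ _); field.
rewrite pE powRN; set t := d `^ (1 / 4) in p1 *; have t0 : 0 < t by apply: lt_le_trans p1.
rewrite [leRHS](_ : _ = C0 / (t * t) * ((C1 + C3) * M * t)); last by field; rewrite gt_eqF.
apply: ler_wpM2l; first by apply: divr_ge0 => //; apply: mulr_ge0; exact: ltW.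
rewrite (_ : (C1 + C3) * M * t = C1 * M * t + C3 * M * t); last by ring.
by rewrite lerD2r ler_peMr// mulr_ge0.
Qed.

Definition gmean (d : R) u := \int[mu]_y (gaussV d (y : 'rV[R]_n) * u y).

Lemma gmean_gconv (d : R) u : gmean d u = gconv u d 0.
Proof. by apply: eq_Rintegral => y _; rewrite sub0r gaussVN. Qed.

Lemma gint_integrable (d : R) u : 0 < d -> gint u ->
  mu.-integrable setT (EFin \o (fun y : V => gaussV d (y : 'rV[R]_n) * u y)).
Proof.
move=> d0 [_ /(_ d 0 d0)]; apply: eq_integrableR => y.
by rewrite sub0r gaussVN.
Qed.

Lemma bounded_gint u (K : R) : measurable_fun setT u -> (forall x, `|u x| <= K) -> gint u.
Proof.
move=> mu_ uK; have K0 : 0 <= K := le_trans (normr_ge0 _) (uK 0).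
exact: tame_gint (bounded_tame mu_ K0 uK).
Qed.

Lemma gmean_le (d : R) u (K : R) : 0 < d -> measurable_fun setT u -> (forall x, `|u x| <= K) ->
  `|gmean d u| <= K.
Proof.
move=> d0 mu_ uK; have K0 : 0 <= K := le_trans (normr_ge0 _) (uK 0).
have iG := gint_integrable d0 (bounded_gint mu_ uK).
have i1 : mu.-integrable setT (EFin \o (fun y : V => gaussV d (y : 'rV[R]_n))).
  apply: (@eq_integrableR _ _ _ mu (fun y : V => gaussV d (0 - (y : 'rV[R]_n)))); last exact: integrable_gaussV.
  by move=> y; rewrite sub0r gaussVN.
have E1 : \int[mu]_y gaussV d (y : 'rV[R]_n) = 1 by rewrite /Rintegral ge0_integral_gaussV.
rewrite -[leRHS]mulr1 -[in leRHS]E1 -RintegralZl//.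
apply: Rintegral_le_norm => //; first exact: integrable_RZl.
by move=> y; rewrite normrM ger0_norm ?gaussV_ge0// mulrC ler_wpM2r ?gaussV_ge0.
Qed.

(** Both means are double integrals of v(x) K(x-y) g(y); they differ only in whether the Gaussian
    weight sits at [x] or at [y], so the error is governed by [kernel_lip_bound]. *)
Lemma gmean_bessel (s : R) : 0 < s -> exists2 C : R, 0 <= C & forall M g K v (d : R), tame M g ->
  measurable_fun setT v -> (forall x, `|v x| <= K) -> 1 <= d ->
  `|gmean d (fun x => bessel_potential s g x * v x) - gmean d (fun x => g x * bessel_potential s v x)|
  <= C * M * K * d `^ (- (1 / 4)).
Proof.
move=> s0; have [C C0 HC] := kernel_lip_bound s0; exists C => // M g K v d tg mv vK d1.
have d0 : 0 < d by exact: lt_le_trans d1.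
have K0 : 0 <= K := le_trans (normr_ge0 _) (vK 0).
have tv := bounded_tame mv K0 vK; have [M0 mg _ _] := tg; have gg := tame_gint tg.
have [C1 C10 HC1] := @bessel_bounded R n s s0.
have [C2 C20 HC2] := kernel_bound s0.
have Bm N f : tame N f -> measurable_fun setT (bessel_potential s f : V -> R).
  by move=> tf; apply: continuous_borelV_measurable; exact: bessel_continuous tf.
have mK := measurableT_comp (@measurable_bessel_kernel R n s) (@measurable_sub2 R n).
have mG : measurable_fun setT (fun y : V => gaussV d (y : 'rV[R]_n)) by exact: measurable_gaussV.
have mG1 := measurableT_comp mG (@measurable_fst _ _ V V).
have mG2 := measurableT_comp mG (@measurable_snd _ _ V V).
have mv1 := measurableT_comp mv (@measurable_fst _ _ V V).
have mg2 := measurableT_comp mg (@measurable_snd _ _ V V).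
pose k (p : V * V) : R := bessel_kernel s ((p.1 : 'rV[R]_n) - (p.2 : 'rV[R]_n)) * g p.2.
have mk : measurable_fun setT k := measurable_funM mK mg2.
pose A (p : V * V) : R := gaussV d (p.1 : 'rV[R]_n) * v p.1 * k p.
pose B (p : V * V) : R := gaussV d (p.2 : 'rV[R]_n) * v p.1 * k p.
have mA : measurable_fun setT A := measurable_funM (measurable_funM mG1 mv1) mk.
have mB : measurable_fun setT B := measurable_funM (measurable_funM mG2 mv1) mk.
have ik (x : V) : mu.-integrable setT (EFin \o (fun y : V => k (x, y))) by exact: bessel_integrable tg.
have AE (x : V) : gaussV d (x : 'rV[R]_n) * (bessel_potential s g x * v x) = \int[mu]_y A (x, y).
  rewrite (bessel_potentialE _ s0 tg) mulrA mulrAC -RintegralZl//; last exact: ik.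
have iA : mu.-integrable setT (EFin \o (fun x : V => \int[mu]_y A (x, y))).
  have : mu.-integrable setT (EFin \o (fun x : V => gaussV d (x : 'rV[R]_n) * (bessel_potential s g x * v x))).
    apply: gint_integrable => //; apply: (@bounded_gint _ (C1 * M * K)).
      by apply: measurable_funM => //; exact: Bm tg.
    by move=> x; rewrite normrM ler_pM// HC1.
  by apply: eq_integrableR.
have iAx (x : V) : mu.-integrable setT (EFin \o (fun y : V => A (x, y))) by exact: (integrable_RZl (gaussV d (x : 'rV[R]_n) * v x) (ik x)).
have iBx (x : V) : mu.-integrable setT (EFin \o (fun y : V => B (x, y))).
  apply: (integrable_dom (g := fun y : V => d `^ (- (n%:R / 2)) * K * `|k (x, y)|)).
  - exact: (measurableT_comp mB (measurable_pair1 _)).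
  - move=> y; rewrite /B/= normrM ler_wpM2r// normrM ler_pM// ger0_norm ?gaussV_ge0//.
    rewrite /gaussV -[leRHS]mulr1 ler_wpM2l ?powR_ge0// -expR0 ler_expR.
    by rewrite !mulNr oppr_le0 divr_ge0 ?(ltW d0)// mulr_ge0 ?sqr_ge0// pi_ge0.
  - by apply: integrable_RZl; exact: integrable_Rnorm.
(* Transposed so that the weighted variable is outermost: absolute integrability then follows from
   that of the weight times g. *)
pose B' (p : V * V) : R := B (p.2, p.1).
have mB' : measurable_fun setT B'.
  by apply: (measurableT_comp mB); apply/measurable_fun_pairP; split; [exact: measurable_snd|exact: measurable_fst].
have B'E (y x : V) : B' (y, x) = gaussV d (y : 'rV[R]_n) * g y * (bessel_kernel s ((y : 'rV[R]_n) - (x : 'rV[R]_n)) * v x).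
  rewrite /B' /B /k/= -[bessel_kernel s (y - x)]bessel_kernelN opprB; ring.
have fi : (\int[mu]_y \int[mu]_x `|B' (y, x)|%:E < +oo)%E.
  apply: (@le_lt_trans _ _ (\int[mu]_y ((C2 * (2 * K))%:E * `|gaussV d (y : 'rV[R]_n) * g y|%:E))%E); last first.
    rewrite ge0_integralZl_EFin; last 4 first.
    - exact: measurableT.
    - by move=> y _; rewrite lee_fin.
    - by apply/measurable_EFinP; apply: measurableT_comp => //; exact: measurable_funM.
    - by rewrite !mulr_ge0.
    by rewrite integrable_EFinK ?ltry//; apply: integrable_Rnorm; exact: gint_integrable.
  have mnB : measurable_fun setT (fun p : V * V => `|B' p|%:E) by apply/measurable_EFinP; exact: measurableT_comp.
  apply: ge0_le_integral => //.
  - by move=> y _; apply: integral_ge0 => x _; rewrite lee_fin.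
  - exact: (measurable_fun_fubini_tonelli_F (fun p : V * V => `|B' p|%:E)).
  - by apply: measurable_funeM; apply/measurable_EFinP; apply: measurableT_comp => //; exact: measurable_funM.
  move=> y _; have E (x : V) : `|B' (y, x)|%:E = (`|gaussV d (y : 'rV[R]_n) * g y|%:E * (bessel_kernel s ((y : 'rV[R]_n) - (x : 'rV[R]_n)) * `|v x|)%:E)%E.
    by rewrite B'E normrM [`|bessel_kernel _ _ * _|]normrM (ger0_norm (bessel_kernel_ge0 _ s0)) -EFinM.
  under eq_integral do rewrite E.
  rewrite ge0_integralZl_EFin; last 4 first.
  - exact: measurableT.
  - by move=> x _; rewrite lee_fin mulr_ge0// bessel_kernel_ge0.
  - apply/measurable_EFinP; apply: measurable_funM; last exact: measurableT_comp.
    exact: (measurableT_comp (@measurable_bessel_kernel R n s) (measurable_subr_borelV y)).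
  - exact: normr_ge0.
  by rewrite muleC lee_wpmul2r ?lee_fin//; exact: HC2.
have BE (y : V) : gaussV d (y : 'rV[R]_n) * (g y * bessel_potential s v y) = \int[mu]_x B' (y, x).
  rewrite (bessel_potentialE _ s0 tv) mulrA -RintegralZl//; last exact: bessel_integrable tv.
  by apply: eq_Rintegral => x _; rewrite B'E.
have -> : gmean d (fun x => bessel_potential s g x * v x) = \int[mu]_x \int[mu]_y A (x, y).
  by apply: eq_Rintegral => x _; rewrite AE.
have -> : gmean d (fun x => g x * bessel_potential s v x) = \int[mu]_x \int[mu]_y B (x, y).
  rewrite -(Rfubini (m1 := mu) (m2 := mu) mB' fi).
  by apply: eq_Rintegral => x _; rewrite BE.
have iB : mu.-integrable setT (EFin \o (fun x : V => \int[mu]_y B (x, y))).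
  exact: (integrable_Rfubini_swap (m1 := mu) (m2 := mu) mB' fi).
pose D (p : V * V) := A p - B p.
have DE (x : V) : \int[mu]_y A (x, y) - \int[mu]_y B (x, y) = \int[mu]_y D (x, y).
  by rewrite -(RintegralB measurableT (iAx x) (iBx x)).
rewrite -(RintegralB measurableT iA iB); under eq_Rintegral do rewrite DE.
have mD : measurable_fun setT D := measurable_funB mA mB.
apply: (Rfubini_norm_le mD).
have mnD : measurable_fun setT (fun p : V * V => `|D p|%:E).
  by apply/measurable_EFinP; exact: (measurableT_comp (@normr_measurable R setT) mD).
rewrite -[leLHS](fubini_tonelli1 (m1 := mu) (m2 := mu) (fun p : V * V => `|D p|%:E) mnD); last first.
  by move=> p; rewrite lee_fin.
pose T (p : V * V) : R := `|gaussV d (p.1 : 'rV[R]_n) - gaussV d (p.2 : 'rV[R]_n)| *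
     (bessel_kernel s ((p.1 : 'rV[R]_n) - (p.2 : 'rV[R]_n)) * `|g p.2|).
have T0 p : 0 <= T p by apply: mulr_ge0 => //; apply: mulr_ge0 => //; exact: bessel_kernel_ge0.
have mT : measurable_fun setT T := measurable_funM
  (measurableT_comp (@normr_measurable R setT) (measurable_funB mG1 mG2))
  (measurable_funM mK (measurableT_comp (@normr_measurable R setT) mg2)).
apply: (@le_trans _ _ (\int[mu \x mu]_p (K%:E * (T p)%:E))%E).
  apply: ge0_le_integral => //.
  - by apply: measurable_funeM; exact/measurable_EFinP.
  move=> p _; rewrite -EFinM lee_fin /D.
  rewrite (_ : A p - B p = (gaussV d (p.1 : 'rV[R]_n) - gaussV d (p.2 : 'rV[R]_n)) * k p * v p.1); last by rewrite /A /B; ring.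
  rewrite normrM mulrC; apply: ler_pM => //.
  by rewrite /T normrM /k [`|bessel_kernel _ _ * _|]normrM (ger0_norm (bessel_kernel_ge0 _ s0)).
rewrite ge0_integralZl_EFin//; last 2 first.
- by move=> p _; rewrite lee_fin.
- exact/measurable_EFinP.
apply: (@le_trans _ _ (K%:E * (C * M * d `^ (- (1 / 4)))%:E)%E).
  by rewrite lee_wpmul2l ?lee_fin//; exact: HC.
by rewrite -EFinM lee_fin le_eqVlt; apply/orP; left; apply/eqP; ring.
Qed.

End KernelMeans.

(** * Errors that vanish as the Gaussian widens *)

Section Vanish.
Variable R : realType.
Implicit Types F G : R -> R.

(** Convergence to 0 at a fixed rate, which makes stability under sums and multiples elementary. The
    exponent is that of [gmean_bessel]; the other errors are of order d^(-1/2) and fit in as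
    well. *)
Definition vanish F := exists2 C : R, 0 <= C & forall d, 1 <= d -> `|F d| <= C * d `^ (- (1 / 4)).

Lemma vanish_le F G (c : R) : 0 <= c -> (forall d, 1 <= d -> `|G d| <= c * `|F d|) -> vanish F -> vanish G.
Proof.
move=> c0 GF [C C0 HC]; exists (c * C); first exact: mulr_ge0.
by move=> d d1; rewrite (le_trans (GF d d1))// -mulrA ler_wpM2l// HC.
Qed.

Lemma vanish_eq F G : (forall d, 1 <= d -> G d = F d) -> vanish F -> vanish G.
Proof. by move=> E; apply: (@vanish_le _ _ 1) => // d d1; rewrite mul1r E. Qed.

Lemma vanishD F G : vanish F -> vanish G -> vanish (fun d => F d + G d).
Proof.
move=> [C C0 HC] [K K0 HK]; exists (C + K); first exact: addr_ge0.
by move=> d d1; rewrite (le_trans (ler_normD _ _))// mulrDl lerD ?HC ?HK.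
Qed.

Lemma vanishZ (c : R) F : vanish F -> vanish (fun d => c * F d).
Proof. by apply: (@vanish_le _ _ `|c|) => // d _; rewrite normrM. Qed.

Lemma vanishB F G : vanish F -> vanish G -> vanish (fun d => F d - G d).
Proof.
move=> vF vG; apply: (vanish_eq _ (vanishD vF (vanishZ (-1) vG))) => d _.
by rewrite mulN1r.
Qed.

Lemma vanish_sum (I : Type) (r : seq I) (F : I -> R -> R) : (forall i, vanish (F i)) ->
  vanish (fun d => \sum_(i <- r) F i d).
Proof.
move=> vF; elim: r => [|i r IH].
  by exists 0 => // d d1; rewrite big_nil normr0 mul0r.
by apply: vanish_eq (vanishD (vF i) IH) => d _; rewrite big_cons.
Qed.

Lemma vanish_sqrt F (C : R) : 0 <= C -> (forall d, 1 <= d -> `|F d| <= C / Num.sqrt d) -> vanish F.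
Proof.
move=> C0 HC; exists C => // d d1; apply: (le_trans (HC d d1)); rewrite ler_wpM2l//.
have d0 : 0 < d by exact: lt_le_trans d1.
rewrite powRN -powR12_sqrt ?(ltW d0)// lef_pV2 ?posrE ?powR_gt0//.
by apply: ler_powR => //; lra.
Qed.

Lemma vanish_small F (e : R) : vanish F -> 0 < e ->
  exists2 D : R, 1 <= D & forall d, D <= d -> `|F d| <= e.
Proof.
move=> [C C0 HC] e0; exists (1 + (C / e) ^+ 4); first by rewrite lerDl exprn_ge0// divr_ge0// ltW.
move=> d dD; have Ce0 : 0 <= C / e by rewrite divr_ge0// ltW.
have d1 : 1 <= d by apply: le_trans dD; rewrite lerDl exprn_ge0.
have d0 : 0 < d by exact: lt_le_trans d1.
apply: (le_trans (HC d d1)); rewrite powRN ler_pdivrMr ?powR_gt0//.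
rewrite mulrC -ler_pdivrMr//.
have -> : C / e = ((C / e) ^+ 4) `^ (1 / 4).
  by rewrite -powR_mulrn// -powRrM (_ : 4%:R * (1 / 4) = 1) ?powRr1//; field.
by apply: ge0_ler_powR; rewrite ?nnegrE ?(ltW d0) ?exprn_ge0//; lra.
Qed.

Lemma vanish_small_fin (F : nat -> R -> R) (J : nat) (e : R) : (forall j, vanish (F j)) -> 0 < e ->
  exists2 D : R, 1 <= D & forall d, D <= d -> forall j, (j < J)%N -> `|F j d| <= e.
Proof.
move=> vF e0; elim: J => [|J [D D1 HD]]; first by exists 1.
have [D' D'1 HD'] := vanish_small (vF J) e0.
exists (Num.max D D'); first by rewrite le_max D1.
move=> d; rewrite ge_max => /andP[Dd D'd] j; rewrite ltnS leq_eqVlt => /orP[/eqP->|jJ].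
  exact: HD'.
exact: HD.
Qed.

End Vanish.

(** * Asymptotic calculus of Gaussian means *)

Section Means.
Variables (R : realType) (n : nat).
Notation mu := (lebV R n).
Notation V := (borelV R n).
Notation leb := (@lebesgue_measure R).
Implicit Types (g u v : V -> R) (x z h a : 'rV[R]_n).

Definition bfun u := measurable_fun setT u /\ exists K : R, forall x, `|u x| <= K.

Lemma bfun_gint u : bfun u -> gint u.
Proof. by move=> [mu_ [K uK]]; exact: bounded_gint uK. Qed.

Lemma bfunM u v : bfun u -> bfun v -> bfun (fun x => u x * v x).
Proof.
move=> [mu_ [K uK]] [mv [L vL]]; split; first exact: measurable_funM.
by exists (K * L) => x; rewrite normrM ler_pM.
Qed.

Lemma bfunB u v : bfun u -> bfun v -> bfun (fun x => u x - v x).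
Proof.
move=> [mu_ [K uK]] [mv [L vL]]; split; first exact: measurable_funB.
by exists (K + L) => x; rewrite (le_trans (ler_normB _ _))// lerD.
Qed.

Lemma bfunZ c u : bfun u -> bfun (fun x => c * u x).
Proof.
move=> [mu_ [K uK]]; split; first exact: measurable_funM.
by exists (`|c| * K) => x; rewrite normrM ler_wpM2l.
Qed.

Lemma bfun_shift u a : bfun u -> bfun (fun x => u ((x : 'rV[R]_n) + a)).
Proof.
move=> [mu_ [K uK]]; split; last by exists K.
exact: (measurableT_comp mu_ (measurable_addr_borelV a)).
Qed.

Lemma bfun_Delta u h : bfun u -> bfun (Delta h u).
Proof. by move=> bu; apply: bfunB; exact: bfun_shift. Qed.

Lemma bfun_iter_Delta u h m : bfun u -> bfun (iter m (Delta h) u).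
Proof. by move=> bu; elim: m => // m IH; rewrite iterS; exact: bfun_Delta. Qed.

Lemma gmeanB (d : R) u v : 0 < d -> gint u -> gint v ->
  gmean d (fun x => u x - v x) = gmean d u - gmean d v.
Proof.
move=> d0 gu gv; rewrite /gmean -RintegralB//; try exact: gint_integrable.
by apply: eq_Rintegral => y _; rewrite mulrBr.
Qed.

Lemma gmeanD (d : R) u v : 0 < d -> gint u -> gint v ->
  gmean d (fun x => u x + v x) = gmean d u + gmean d v.
Proof.
move=> d0 gu gv; rewrite /gmean -RintegralD//; try exact: gint_integrable.
by apply: eq_Rintegral => y _; rewrite mulrDr.
Qed.

Lemma gint_mulr u v : gint u -> bfun v -> gint (fun x => u x * v x).
Proof.
move=> [mu_ iu] [mv [K vK]]; split; first exact: measurable_funM.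
move=> d x d0; have mG := measurable_gaussVx d x.
apply: (integrable_dom (g := fun y : V => `|gaussV d (x - (y : 'rV[R]_n)) * u y| * K)).
- by apply: measurable_funM => //; exact: measurable_funM.
- by move=> y; rewrite mulrA normrM ler_wpM2l.
- by apply: integrable_RZr; apply: integrable_Rnorm; exact: iu.
Qed.

Lemma gmeanZ (d c : R) u : 0 < d -> gint u -> gmean d (fun x => c * u x) = c * gmean d u.
Proof.
move=> d0 gu; rewrite /gmean -RintegralZl//; last exact: gint_integrable.
by apply: eq_Rintegral => y _; rewrite mulrCA.
Qed.

Lemma Delta_half (f : 'rV[R]_n -> R) a : Delta a f (2^-1 *: a) = f a - f 0.
Proof.
rewrite /Delta subrr -scalerDl (_ : 2^-1 + 2^-1 = 1 :> R) ?scale1r//.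
by field.
Qed.

(** A Gaussian mean is a convolution evaluated at 0, so a fixed translation changes it by a first
    difference, of order |a|/sqrt d. *)
Lemma gmean_shift u a : bfun u ->
  vanish (fun d => gmean d (fun x => u ((x : 'rV[R]_n) + a)) - gmean d u).
Proof.
move=> [mu_ [K uK]]; have K0 : 0 <= K := le_trans (normr_ge0 _) (uK 0).
have [C C0 HC] := @gconv_diff1 R n (enorm a).
apply: (@vanish_sqrt _ _ (C * (2 * K) * enorm a)); first by rewrite !mulr_ge0 ?enorm_ge0.
move=> d d1; have d0 : 0 < d by exact: lt_le_trans d1.
have ad : enorm a <= enorm a * Num.sqrt d.
  by rewrite ler_peMr ?enorm_ge0// -[leLHS]sqrtr1 ler_wsqrtr.
have := HC _ _ (2^-1 *: a) _ _ (bounded_tame mu_ K0 uK) d0 ad.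
by rewrite Delta_half !gmean_gconv gconv_shiftE// add0r -[_ * _ / _]mulrA.
Qed.

(** Summation by parts is exact up to translating products by half a step, which a Gaussian mean
    ignores in the limit. *)
Lemma gmean_parts1 u v h : bfun u -> bfun v ->
  vanish (fun d => gmean d (fun x => Delta h u x * v x) + gmean d (fun x => u x * Delta h v x)).
Proof.
move=> bu bv; set a := 2^-1 *: h.
pose p (x : V) := u x * v ((x : 'rV[R]_n) + - a); pose q (x : V) := u x * v ((x : 'rV[R]_n) + a).
have bp : bfun p by apply: bfunM => //; exact: bfun_shift.
have bq : bfun q by apply: bfunM => //; exact: bfun_shift.
apply: vanish_eq (vanishB (gmean_shift a bp) (gmean_shift (- a) bq)) => d d1.
have d0 : 0 < d by exact: lt_le_trans d1.
have -> : (fun x => Delta h u x * v x) = (fun x : V => p ((x : 'rV[R]_n) + a) - q ((x : 'rV[R]_n) + - a)).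
  by apply/funext => x; rewrite /p /q addrK subrK /Delta mulrBl.
have -> : (fun x => u x * Delta h v x) = (fun x : V => q x - p x).
  by apply/funext => x; rewrite /p /q /Delta mulrBr.
rewrite !gmeanB//; try by apply: bfun_gint => //; exact: bfun_shift.
by ring.
Qed.

Lemma gmean_parts u v h m : bfun u -> bfun v ->
  vanish (fun d => gmean d (fun x => iter m (Delta h) u x * v x)
    - (-1) ^+ m * gmean d (fun x => u x * iter m (Delta h) v x)).
Proof.
move=> bu; elim: m v => [|m IH] v bv.
  by exists 0 => // d d1; rewrite expr0 mul1r subrr normr0 mul0r.
have h1 := gmean_parts1 h (bfun_iter_Delta h m bu) bv.
have h2 := IH _ (bfun_Delta h bv).
apply: vanish_eq (vanishB h1 h2) => d _.
by rewrite -(iterSr m (Delta h) v) -(iterS m (Delta h) u) exprS; ring.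
Qed.

Lemma measurable_same_cube :
  measurable [set p : V * V | exists k, @ucube R n k p.1 /\ @ucube R n k p.2].
Proof.
rewrite (_ : [set _ | _] = \bigcup_(k : 'rV[int]_n) (@ucube R n k `*` @ucube R n k)).
  apply: countable_bigcupT_measurable; first exact: countableP.
  by move=> k; apply: measurableX; exact: measurable_ucube.
by apply/seteqP; split => [[x y] [k [xk yk]]|[x y] [k _ [xk yk]]]; exists k.
Qed.

Lemma ucube_unique k k' x : @ucube R n k x -> @ucube R n k' x -> k = k'.
Proof.
move=> xk xk'; apply/rowP => i; have /andP[a b] := xk i; have /andP[c e] := xk' i.
have h1 : (k ord0 i)%:~R < (k' ord0 i + 1)%:~R :> R by rewrite intrD; exact: le_lt_trans e.
have h2 : (k' ord0 i)%:~R < (k ord0 i + 1)%:~R :> R by rewrite intrD; exact: le_lt_trans b.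
by apply/eqP; rewrite eq_le -!ltzD1 -(@ltr_int R) h1 -(@ltr_int R) h2.
Qed.

(** For d >= 1 the weight at [y] is at most C times the weight of parameter 2d at any [x] in the
    same unit cube. Averaging over such [x] and exchanging the integrals replaces the values of [F]
    by its integrals over cubes, with a bound independent of d. *)
Lemma gmean_cube_bound : exists2 C : R, 0 <= C & forall (M d : R) (F : V -> R), 0 <= M ->
  measurable_fun setT F -> (forall y, 0 <= F y) ->
  (forall k, (\int[mu]_y (\1_(@ucube R n k) y * F y)%:E <= M%:E)%E) -> 1 <= d ->
  (\int[mu]_y (gaussV d (y : 'rV[R]_n) * F y)%:E <= (C * M)%:E)%E.
Proof.
pose C : R := 2 `^ (n%:R / 2) * expR (pi * n%:R).
have C0 : 0 <= C by rewrite mulr_ge0 ?powR_ge0 ?expR_ge0.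
exists C => // M d F M0 mF F0 FM d1; have d0 : 0 < d by exact: lt_le_trans d1.
have d20 : 0 < 2 * d by rewrite mulr_gt0.
pose S : set (V * V) := [set p : V * V | exists k, @ucube R n k p.1 /\ @ucube R n k p.2].
have mS : measurable S by exact: measurable_same_cube.
have mG c : measurable_fun setT (fun y : V => gaussV c (y : 'rV[R]_n)) by exact: measurable_gaussV.
have mI : measurable_fun setT (\1_S : V * V -> R) by exact: measurable_indic.
pose cube (x : V) : 'rV[int]_n := \row_i Num.floor ((x : 'rV[R]_n) ord0 i).
have cubeP (x : V) : @ucube R n (cube x) x by exact: ucube_floor.
have SE1 (x y : V) : \1_S (x, y) = \1_(@ucube R n (cube x)) y :> R.
  rewrite !indicE; congr (_%:R); congr (nat_of_bool _); apply/idP/idP; rewrite !in_setE.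
    by move=> [k [/= xk yk]]; rewrite (ucube_unique (cubeP x) xk).
  by move=> xy; exists (cube x).
have SE2 (x y : V) : \1_S (x, y) = \1_(@ucube R n (cube y)) x :> R.
  rewrite !indicE; congr (_%:R); congr (nat_of_bool _); apply/idP/idP; rewrite !in_setE.
    by move=> [k [/= xk yk]]; rewrite (ucube_unique (cubeP y) yk).
  by move=> xy; exists (cube y).
pose H (p : V * V) := (C * gaussV (2 * d) (p.1 : 'rV[R]_n) * (\1_S p * F p.2))%:E.
have mH : measurable_fun setT H.
  apply/measurable_EFinP; apply: measurable_funM.
    by apply: measurable_funM => //; exact: (measurableT_comp (mG _) measurable_fst).
  by apply: measurable_funM => //; exact: (measurableT_comp mF measurable_snd).
have cG0 (x : V) : 0 <= C * gaussV (2 * d) (x : 'rV[R]_n) by apply: mulr_ge0 => //; exact: gaussV_ge0.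
have H0 p : (0 <= H p)%E by rewrite lee_fin; apply: mulr_ge0 => //; exact: mulr_ge0.
have key (x y : V) : \1_S (x, y) * gaussV d (y : 'rV[R]_n) <= C * gaussV (2 * d) (x : 'rV[R]_n) * \1_S (x, y).
  have [/set_mem/= [k [xk yk]]|xy] := boolP ((x, y) \in S); last by rewrite indicE (negbTE xy) mul0r mulr0.
  rewrite mulrC; apply: ler_wpM2r => //.
  rewrite -[y in gaussV d y](subrKC x); apply: (le_trans (gaussV_shift_le _ _ d0)).
  apply: ler_wpM2r; first exact: gaussV_ge0.
  rewrite /C; apply: ler_wpM2l; first exact: powR_ge0.
  rewrite ler_expR -mulrA ler_wpM2l ?pi_ge0// ler_pdivrMr//.
  apply: (le_trans (ucube_enorm yk xk)); by rewrite ler_peMr.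
apply: (@le_trans _ _ (\int[mu]_y \int[mu]_x H (x, y))%E).
  apply: ge0_le_integral => //.
  - by move=> y _; rewrite lee_fin; apply: mulr_ge0 => //; exact: gaussV_ge0.
  - by apply/measurable_EFinP; exact: measurable_funM.
  - exact: (measurable_fun_fubini_tonelli_G H).
  move=> y _; have c0 : 0 <= gaussV d (y : 'rV[R]_n) * F y by apply: mulr_ge0 => //; exact: gaussV_ge0.
  have -> : ((gaussV d (y : 'rV[R]_n) * F y)%:E = \int[mu]_x ((gaussV d (y : 'rV[R]_n) * F y)%:E * (\1_(@ucube R n (cube y)) x)%:E))%E.
    rewrite ge0_integralZl_EFin//; last by apply/measurable_EFinP; exact: measurable_indic_ucube.
    by rewrite integral_indic_ucube mule1.
  apply: ge0_le_integral => //.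
  - by move=> x _; rewrite -EFinM lee_fin mulr_ge0.
  - by apply: measurable_funeM; apply/measurable_EFinP; exact: measurable_indic_ucube.
  - exact: (measurableT_comp mH (measurable_pair2 _)).
  move=> x _; rewrite -EFinM lee_fin -SE2/=.
  rewrite [leLHS](_ : _ = \1_S (x, y) * gaussV d (y : 'rV[R]_n) * F y); last by ring.
  by rewrite [leRHS]mulrA; apply: ler_wpM2r; [exact: F0|exact: key].
rewrite -[leLHS](fubini_tonelli (m1 := mu) (m2 := mu) H mH H0).
apply: (@le_trans _ _ (\int[mu]_x ((C * M)%:E * (gaussV (2 * d) (x : 'rV[R]_n))%:E))%E).
  apply: ge0_le_integral => //.
  - by move=> x _; apply: integral_ge0 => y _; exact: H0.
  - exact: (measurable_fun_fubini_tonelli_F H).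
  - by apply: measurable_funeM; exact/measurable_EFinP.
  move=> x _; rewrite /fubini_F/H/=; under eq_integral do rewrite EFinM SE1.
  rewrite ge0_integralZl_EFin; last 4 first.
  - exact: measurableT.
  - by move=> y _; rewrite lee_fin mulr_ge0.
  - by apply/measurable_EFinP; apply: measurable_funM => //; exact: measurable_indic_ucube.
  - exact: cG0.
  rewrite -[leRHS]EFinM [X in (_ <= X%:E)%E](_ : _ = C * gaussV (2 * d) (x : 'rV[R]_n) * M); last by ring.
  by rewrite [leRHS]EFinM lee_wpmul2l ?lee_fin//; exact: FM.
rewrite ge0_integralZl_EFin; last 4 first.
- exact: measurableT.
- by move=> y _; rewrite lee_fin; exact: gaussV_ge0.
- exact/measurable_EFinP.
- exact: mulr_ge0.
by rewrite ge0_integral_gaussV// mule1.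
Qed.

End Means.

(** * Almost orthogonal waves and Bessel's inequality *)

Section CosineMeans.
Variables (R : realType) (n : nat).
Notation mu := (lebV R n.+1).
Notation V := (borelV R n.+1).
Implicit Types (g u v : V -> R) (w : R).

Lemma bfun_cw w th : bfun (cw w th : V -> R).
Proof. by split; [exact: measurable_cw|exists 1 => x; exact: cw_le1]. Qed.

Lemma gmean_cw w : w != 0 -> vanish (fun d => gmean d (cw w 0 : V -> R)).
Proof.
wlog w0 : w / 0 < w.
  move=> H; rewrite neq_lt => /orP[w0|w0]; last by apply: H => //; rewrite gt_eqF.
  have -> : cw w 0 = cw (- w) 0 :> (V -> R).
    by apply/funext => x; rewrite /cw !addr0 mulNr cosN.
  by apply: H; rewrite ?oppr_gt0// oppr_eq0 lt_eqF.
move=> _; have [C C0 HC] := @phi_decay R n w w0.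
apply: (vanish_sqrt C0) => d d1; rewrite gmean_gconv; exact: HC.
Qed.

Lemma cw_mul w1 w2 (x : 'rV[R]_n.+1) :
  cw w1 0 x * cw w2 0 x = 2^-1 * cw (w1 - w2) 0 x + 2^-1 * cw (w1 + w2) 0 x.
Proof. by rewrite /cw !addr0 mulrBl mulrDl cosB cosD; field. Qed.

Lemma gmean_cw_mul (d : R) w1 w2 : 0 < d ->
  gmean d (fun x : V => cw w1 0 x * cw w2 0 x) =
  2^-1 * gmean d (cw (w1 - w2) 0 : V -> R) + 2^-1 * gmean d (cw (w1 + w2) 0 : V -> R).
Proof.
move=> d0; have G w : gint (cw w 0 : V -> R) by exact: cw_gint.
rewrite -!gmeanZ// -gmeanD//; try by apply: bfun_gint; apply: bfunZ; exact: bfun_cw.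
by apply: eq_Rintegral => x _; rewrite cw_mul.
Qed.

Lemma gmean_cw_orth w1 w2 : 0 < w1 -> 0 < w2 -> w1 != w2 ->
  vanish (fun d => gmean d (fun x : V => cw w1 0 x * cw w2 0 x)).
Proof.
move=> w10 w20 w12.
have h1 : vanish (fun d => gmean d (cw (w1 - w2) 0 : V -> R)) by apply: gmean_cw; rewrite subr_eq0.
have h2 : vanish (fun d => gmean d (cw (w1 + w2) 0 : V -> R)) by apply: gmean_cw; rewrite gt_eqF ?addr_gt0.
apply: vanish_eq (vanishD (vanishZ 2^-1 h1) (vanishZ 2^-1 h2)) => d d1.
by rewrite gmean_cw_mul//; exact: lt_le_trans d1.
Qed.

Lemma gmean_cw_sqr w : 0 < w -> vanish (fun d => gmean d (fun x : V => cw w 0 x * cw w 0 x) - 2^-1).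
Proof.
move=> w0; have h2 : vanish (fun d => gmean d (cw (w + w) 0 : V -> R)).
  by apply: gmean_cw; rewrite gt_eqF ?addr_gt0.
apply: vanish_eq (vanishZ 2^-1 h2) => d d1; have d0 : 0 < d by exact: lt_le_trans d1.
rewrite gmean_cw_mul// (_ : gmean d (cw (w - w) 0 : V -> R) = 1) ?mulr1 1?[_ + _ * _]addrC ?addrK//.
rewrite /gmean /Rintegral -[RHS]/(fine 1%E) -(@ge0_integral_gaussV R n.+1 d d0); congr fine.
by apply: eq_integral => x _; rewrite /cw subrr mul0r addr0 cos0 mulr1.
Qed.

(** Expansion of the weighted integral of (g - \sum_j b_j c_j)^2 >= 0. The coefficients are known to
    exceed [q j] only up to an error vanishing in d, hence the positive part in the hypothesis; [J]
    is fixed first and d taken large afterwards. *)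
Lemma bessel_inequality : exists2 C : R, 0 <= C & forall M g (w q : nat -> R), tame M g ->
  (forall k, (\int[mu]_y (\1_(@ucube R n.+1 k) y * g y ^+ 2)%:E <= M%:E)%E) ->
  (forall j, 0 < w j) -> injective w -> (forall j, 0 <= q j) ->
  (forall j, vanish (fun d => Num.max (q j - `|gmean d (fun x => g x * cw (w j) 0 x)|) 0)) ->
  forall J, \sum_(j < J) q j ^+ 2 <= C * M + 2.
Proof.
have [C C0 HC] := @gmean_cube_bound R n.+1; exists (4 * C); first by rewrite mulr_ge0.
move=> M g w q tg gM w0 winj q0 hv J; have [M0 mg _ _] := tg; have gg := tame_gint tg.
(* With this tolerance the off-diagonal terms add up to at most e J S <= S/2 and are absorbed. *)
pose e : R := (2 * J.+1%:R)^-1; have e0 : 0 < e by rewrite invr_gt0 mulr_gt0.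
have eJ : e * J%:R <= 2^-1.
  rewrite /e mulrC ler_pdivrMr ?mulr_gt0// mulrA mulVf// mul1r ler_nat//.
have e1 : e <= 1.
  rewrite invf_le1 ?mulr_gt0//; have : 1 <= J.+1%:R :> R by rewrite ler1n.
  by lra.
have [D1 D11 H1] := vanish_small_fin J hv e0.
pose F i d := \sum_(j <- iota 0 J | j != i) `|gmean d (fun x : V => cw (w i) 0 x * cw (w j) 0 x)|.
have vF i : vanish (F i).
  apply: (@vanish_eq _ (fun d => \sum_(j <- iota 0 J) (j != i)%:R * `|gmean d (fun x : V => cw (w i) 0 x * cw (w j) 0 x)|)).
    by move=> d _; rewrite /F big_mkcond; apply: eq_bigr => j _; case: (j != i); rewrite ?mul1r ?mul0r.
  apply: vanish_sum => j; have [->|ij] := eqVneq j i.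
    by exists 0 => // d _; rewrite mul0r normr0 mul0r.
  apply: (@vanish_le _ _ _ 1) (gmean_cw_orth (w0 i) (w0 j) _) => //.
    by move=> d _; rewrite !mul1r normr_id.
  by rewrite (inj_eq winj) eq_sym.
have [D2 D21 H2] := vanish_small_fin J vF e0.
pose d := Num.max D1 D2.
have d1 : 1 <= d by rewrite le_max D11.
have d0 : 0 < d by exact: lt_le_trans d1.
pose P (y : V) : R := gaussV d (y : 'rV[R]_n.+1); have P0 y : 0 <= P y by exact: gaussV_ge0.
pose c (j : 'I_J) : V -> R := cw (w j) 0.
pose b (j : 'I_J) : R := gmean d (fun x => g x * c j x).
pose m (i j : 'I_J) : R := gmean d (fun x => c i x * c j x).
have qb (j : 'I_J) : q j <= `|b j| + e.
  have := H1 d _ j (ltn_ord j); rewrite le_max lexx => /(_ isT) h.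
  by rewrite -lerBlDl (le_trans _ (le_trans (ler_norm _) h))// le_max lexx.
have mij (i j : 'I_J) : i != j -> `|m i j| <= e.
  move=> ij; have := H2 d _ i (ltn_ord i); rewrite le_max lexx orbT => /(_ isT).
  apply: le_trans; apply: le_trans (ler_norm _); rewrite /F big_mkcond/= (bigD1_seq (val j)) ?iota_uniq//=; last first.
  - by rewrite mem_iota/= add0n.
  rewrite ifT; last by rewrite eq_sym.
  by rewrite lerDl sumr_ge0// => k _; case: ifP.
(* The limit is 1/2, but the crude bound 1 suffices: the diagonal adds at most S against -2 S from
   the cross term. *)
have mii (i : 'I_J) : `|m i i| <= 1.
  apply: gmean_le => //; first by apply: measurable_funM; exact: measurable_cw.
  by move=> x; rewrite normrM mulr_ile1// cw_le1.
have ig2 : (\int[mu]_y (P y * g y ^+ 2)%:E <= (C * M)%:E)%E.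
  by apply: HC => // [|y]; [exact: measurable_funX|exact: sqr_ge0].
have mP : measurable_fun setT P by exact: measurable_gaussV.
have i0 : mu.-integrable setT (EFin \o (fun y => P y * g y ^+ 2)).
  apply: ge0_integrable; first by apply: measurable_funM => //; exact: measurable_funX.
    by move=> y; rewrite mulr_ge0 ?sqr_ge0.
  by rewrite (le_lt_trans ig2)// ltry.
have i1 (j : 'I_J) : mu.-integrable setT (EFin \o (fun y => b j * (P y * (g y * c j y)))).
  by apply: integrable_RZl; apply: gint_integrable => //; apply: gint_mulr => //; exact: bfun_cw.
have i2 (i j : 'I_J) : mu.-integrable setT (EFin \o (fun y => b i * b j * (P y * (c i y * c j y)))).
  apply: integrable_RZl; apply: gint_integrable => //; apply: bfun_gint.
  by apply: bfunM; exact: bfun_cw.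
have [s1 is1] := Rintegral_sum (index_enum 'I_J) predT i1.
have i2s (i : 'I_J) := Rintegral_sum (index_enum 'I_J) predT (i2 i).
have [s2 is2] := Rintegral_sum (index_enum 'I_J) predT (fun i => (i2s i).2).
pose G := \int[mu]_y (P y * g y ^+ 2).
have GM : G <= C * M by rewrite -lee_fin -integrable_EFinK.
pose S := \sum_(j < J) b j ^+ 2.
have S0 : 0 <= S by apply: sumr_ge0 => j _; exact: sqr_ge0.
have key : 0 <= G - 2 * S + \sum_(i < J) \sum_(j < J) b i * b j * m i j.
  have : 0 <= \int[mu]_y (P y * (g y - \sum_(j < J) b j * c j y) ^+ 2).
    by apply: Rintegral_ge0 => y _; rewrite mulr_ge0 ?sqr_ge0.
  rewrite (@eq_Rintegral _ _ _ mu setT (fun y : V => P y * g y ^+ 2 - 2 * (\sum_(j < J) b j * (P y * (g y * c j y)))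
     + \sum_(i < J) \sum_(j < J) b i * b j * (P y * (c i y * c j y)))); last first.
    move=> y _; set T := \sum_(j < J) b j * c j y.
    have -> : \sum_(j < J) b j * (P y * (g y * c j y)) = P y * g y * T.
      by rewrite /T mulr_sumr; apply: eq_bigr => j _; ring.
    have -> : \sum_(i < J) \sum_(j < J) b i * b j * (P y * (c i y * c j y)) = P y * (T * T).
      rewrite {1}/T mulr_suml mulr_sumr; apply: eq_bigr => i _.
      by rewrite /T !mulr_sumr; apply: eq_bigr => j _; ring.
    by ring.
  rewrite RintegralD//; last by apply: integrable_RB => //; exact: integrable_RZl.
  rewrite RintegralB//; last exact: integrable_RZl.
  rewrite RintegralZl// s1 s2 -/G.
  have -> : \sum_(j < J) \int[mu]_x (b j * (P x * (g x * c j x))) = S.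
    apply: eq_bigr => j _; rewrite RintegralZl; first by rewrite expr2.
    - exact: measurableT.
    - by apply: gint_integrable => //; apply: gint_mulr => //; exact: bfun_cw.
  congr (0 <= _ + _); apply: eq_bigr => i _; rewrite (i2s i).1.
  apply: eq_bigr => j _; rewrite RintegralZl//.
  by apply: gint_integrable => //; apply: bfun_gint; apply: bfunM; exact: bfun_cw.
have off : \sum_(i < J) \sum_(j < J) b i * b j * m i j <= S + e * J%:R * S.
  have H i : \sum_(j < J) b i * b j * m i j <= b i ^+ 2 + e * (J%:R * b i ^+ 2 / 2 + S / 2).
    have -> : J%:R * b i ^+ 2 / 2 + S / 2 = \sum_(j < J) (b i ^+ 2 / 2 + b j ^+ 2 / 2).
      by rewrite big_split/= sumr_const card_ord -mulr_suml -[(b i ^+ 2 / 2) *+ J]mulr_natl -/S mulrA.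
    rewrite mulr_sumr (bigD1 i)//= [in leRHS](bigD1 i)//= addrA; apply: lerD.
      have h := mii i; have : 0 <= b i ^+ 2 by exact: sqr_ge0.
      move=> bi; apply: (@le_trans _ _ (b i ^+ 2)).
        by rewrite -expr2 -[leRHS]mulr1 ler_wpM2l// (le_trans (ler_norm _)).
      by rewrite lerDl mulr_ge0 ?(ltW e0)// addr_ge0// divr_ge0.
    apply: ler_sum => j ji; apply: (le_trans (ler_norm _)); rewrite normrM mulrC.
    apply: ler_pM => //; first by rewrite mij// eq_sym.
    rewrite normrM -(real_normK (num_real (b i))) -(real_normK (num_real (b j))).
    by have := sqr_ge0 (`|b i| - `|b j|); rewrite sqrrB mulr2n; clear; lra.
  apply: (le_trans (ler_sum _ (fun i _ => H i))).
  rewrite big_split/= -/S lerD2l -mulr_sumr big_split/= sumr_const card_ord -!mulr_suml -mulr_sumr -/S.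
  by rewrite -[(S / 2) *+ J]mulr_natl; clear; lra.
have SG : S <= 2 * G.
  have : e * J%:R * S <= 2^-1 * S by rewrite ler_wpM2r.
  by move: key off; clear; lra.
(* From (|b| + e)^2 <= 2 b^2 + 2 e^2 and e^2 <= e; summed over j, the terms 2 e stay below 1. *)
apply: (@le_trans _ _ (\sum_(j < J) (2 * b j ^+ 2 + 2 * e))).
  apply: ler_sum => j _; have hq := qb j; have hq0 := q0 j.
  apply: (@le_trans _ _ ((`|b j| + e) ^+ 2)); first by rewrite ler_sqr// nnegrE addr_ge0// ltW.
  rewrite -(real_normK (num_real (b j))); have := sqr_ge0 (`|b j| - e); rewrite sqrrB sqrrD.
  have : e ^+ 2 <= e by rewrite expr2 ler_piMl// ltW.
  by rewrite !mulr2n; clear; lra.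
rewrite big_split/= -mulr_sumr -/S sumr_const card_ord -[(2 * e) *+ J]mulr_natl.
by move: SG GM eJ; clear; lra.
Qed.

End CosineMeans.

(** * Sums of lacunary differences *)

Section LacunarySums.
Variable R : realType.
Implicit Types s t : R.

Definition lam s : R := 2^-1 `^ s.

Lemma lam_gt0 s : 0 < lam s.
Proof. by rewrite powR_gt0// invr_gt0. Qed.

Lemma lam_ge0 s : 0 <= lam s.
Proof. exact: ltW (lam_gt0 s). Qed.

Lemma lam_lt1 s : 0 < s -> lam s < 1.
Proof.
move=> s0; have := @gt0_ltr_powR R s s0 2^-1 1; rewrite !nnegrE invr_ge0 powR1.
by apply => //; lra.
Qed.

Lemma lamX s j : lam s ^+ j = (2^-1 ^+ j) `^ s.
Proof. by rewrite -powR_mulrn ?powR_ge0// /lam powRAC powR_mulrn// invr_ge0. Qed.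

Lemma lamE s : lam s = 2 `^ (- s).
Proof. by rewrite /lam -powR_inv1// -powRrM mulN1r. Qed.

Lemma lam2_gt1 s (m : nat) : s < m%:R -> 1 < lam s * 2 ^+ m.
Proof.
move=> sm; rewrite lamE -powR_mulrn// -powRD ?pnatr_eq0 ?implybT//.
have s0 : 0 < - s + m%:R by rewrite addrC subr_gt0.
have := @gt0_ltr_powR R _ s0 1 2; rewrite !nnegrE ler01 ler0n powR1.
by apply => //; lra.
Qed.

Lemma lam_geo s K : 0 < s -> \sum_(0 <= j < K) lam s ^+ j <= (1 - lam s)^-1.
Proof.
move=> s0; have l1 := lam_lt1 s0; rewrite big_mkord -div1r ler_pdivlMr ?subr_gt0// mulrC.
have := subrX1 (lam s) K; have : 0 <= lam s ^+ K by rewrite exprn_ge0 ?lam_ge0.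
by set A := \sum_(i < K) _; lra.
Qed.

(** Bounds the amplitude |2 sin(w t/2)|^m of the m-th difference with step length t of the wave of
    frequency w = pi 2^j. *)
Definition lacterm (m : nat) t j : R := Num.min 2 (pi * 2 ^+ j * t) ^+ m.

Lemma lacterm_le m t j : 0 <= t -> lacterm m t j <= 2 ^+ m.
Proof.
move=> t0; apply: lerXn2r; rewrite ?nnegrE ?ge_min ?lexx//.
by rewrite le_min ler0n !mulr_ge0 ?exprn_ge0 ?pi_ge0.
Qed.

(** Self-similarity replaces splitting the sum at frequency 1/t: doubling [t] shifts the index by
    one, so for t <= 1/2 the sum is its first term plus [lam s] times the sum at 2t. For t > 1/2 a
    geometric series is enough. *)
Lemma lac_sum_le s (m : nat) : 0 < s -> s < m%:R -> exists2 C : R, 0 <= C & forall K t, 0 < t <= 1 ->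
  \sum_(0 <= j < K) lam s ^+ j * lacterm m t j <= C * t `^ s.
Proof.
move=> s0 sm; have l0 := lam_gt0 s; have l1 := lam_lt1 s0; have p0 := pi_gt0 R.
have r1 := lam2_gt1 sm; set r := lam s * 2 ^+ m in r1.
pose C' : R := 2 ^+ m / (1 - lam s).
have C'0 : 0 <= C' by rewrite divr_ge0 ?exprn_ge0// subr_ge0 ltW.
(* Solves D r = pi^m + D: the induction closes only with the correction -D t^m, which pays for the
   first term because r > 1, that is, s < m. *)
pose D : R := pi ^+ m / (r - 1).
have rr : 0 < r - 1 by rewrite subr_gt0.
have D0 : 0 <= D by rewrite divr_ge0 ?exprn_ge0 ?(ltW p0)// ltW.
pose C : R := (C' + D) * 2 `^ s.
have s21 : 1 <= 2 `^ s by apply: powR_ge1; [rewrite ler1n|exact: ltW].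
have CD : D <= C by rewrite /C; apply: (@le_trans _ _ ((C' + D) * 1)); [lra|rewrite ler_wpM2l// addr_ge0].
have C0 : 0 <= C by exact: le_trans CD.
exists C => //.
suff H K t : 0 < t <= 1 -> \sum_(0 <= j < K) lam s ^+ j * lacterm m t j <= C * t `^ s - D * t ^+ m.
  move=> K t t01; rewrite (le_trans (H K t t01))// gerBl mulr_ge0// exprn_ge0// ltW//.
  by case/andP : t01.
elim: K t => [|K IH] t /andP[t0 t1].
  rewrite big_geq// subr_ge0; apply: ler_pM => //; first by rewrite exprn_ge0// ltW.
  rewrite -powR_mulrn ?(ltW t0)//; apply: ger_powR; [by rewrite t0|exact: ltW].
have [t2|t2] := leP t 2^-1.
  rewrite big_nat_recl// expr0 mul1r.
  under eq_bigr => j _.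
    rewrite exprS -mulrA (_ : lacterm m t j.+1 = lacterm m (2 * t) j); last first.
      by rewrite /lacterm exprS; congr (Num.min _ _ ^+ _); ring.
    over.
  rewrite -mulr_sumr.
  have t20 : 0 < 2 * t <= 1 by rewrite mulr_gt0//=; lra.
  have {IH} := IH _ t20; set T := \sum_(0 <= j < K) _ => IH.
  have h1 : lacterm m t 0 <= pi ^+ m * t ^+ m.
    rewrite /lacterm expr0 mulr1 -exprMn; apply: lerXn2r; rewrite ?nnegrE ?ge_min ?lexx ?orbT//.
      by rewrite le_min ler0n mulr_ge0// ltW.
    by rewrite mulr_ge0// ltW.
  have h2 : lam s * T <= C * t `^ s - D * r * t ^+ m.
    apply: (le_trans (ler_wpM2l (ltW l0) IH)); rewrite exprMn powRM ?(ltW t0)//.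
    have E : lam s * 2 `^ s = 1 by rewrite lamE powRN mulVf// gt_eqF// powR_gt0.
    rewrite mulrBr (_ : lam s * (C * _) = lam s * 2 `^ s * (C * t `^ s)); last by ring.
    by rewrite E mul1r /r le_eqVlt; apply/orP; left; apply/eqP; ring.
  have DE : D * r = pi ^+ m + D by rewrite /D; field; rewrite gt_eqF.
  rewrite DE in h2; have := lerD h1 h2; rewrite mulrDl.
  by set a := pi ^+ m * _; set b := D * _; set c := C * _; set e := _ + lam s * T; lra.
apply: (@le_trans _ _ C').
  apply: (@le_trans _ _ (\sum_(0 <= j < K.+1) lam s ^+ j * 2 ^+ m)).
    by apply: ler_sum => j _; rewrite ler_wpM2l ?exprn_ge0 ?(ltW l0)// lacterm_le// ltW.
  by rewrite -mulr_suml mulrC ler_wpM2l ?exprn_ge0//; exact: lam_geo.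
have h1 : C' + D <= C * t `^ s.
  rewrite /C -mulrA -[leLHS]mulr1 ler_wpM2l ?addr_ge0// -powRM// ?(ltW t0)//.
  by apply: powR_ge1; [lra|exact: ltW].
have h2 : D * t ^+ m <= D by rewrite -[leRHS]mulr1 ler_wpM2l// exprn_ile1// ltW.
by lra.
Qed.

End LacunarySums.

(** * Lacunary series in Lambda_s and their partial sums *)

Section Lacunary.
Variables (R : realType) (n : nat) (s : R).
Hypothesis s0 : 0 < s.
Notation mu := (lebV R n.+1).
Notation V := (borelV R n.+1).
Implicit Types (a : nat -> R) (A : R) (x h : 'rV[R]_n.+1).

Notation freq := (@freq R).

Definition lacs a K x : R := \sum_(0 <= j < K) a j * lam s ^+ j * cw (freq j) 0 x.

Definition lac a x : R := limn (fun K => lacs a K x).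

Lemma cvg_lacs a A x : (forall j, `|a j| <= A) -> lacs a ^~ x @ \oo --> lac a x.
Proof.
move=> aA; have A0 : 0 <= A := le_trans (normr_ge0 _) (aA 0%N).
have l1 := lam_lt1 s0; have l0 := lam_ge0 s.
apply: (@normed_cvg _ R^o (fun j => a j * lam s ^+ j * cw (freq j) 0 x)).
apply: (@series_le_cvg _ _ (geometric A (lam s))).
- by move=> j; exact: normr_ge0.
- by move=> j; rewrite /= mulr_ge0 ?exprn_ge0.
- move=> j; rewrite /= !normrM (ger0_norm (exprn_ge0 _ l0)) -[leRHS]mulr1.
  by rewrite ler_pM ?cw_le1// ?mulr_ge0 ?exprn_ge0// ler_wpM2r ?exprn_ge0.
- by apply: is_cvg_geometric_series; rewrite ger0_norm.
Qed.

Lemma cvg_norm_le (u : nat -> R) (l B : R) : u @ \oo --> l -> (forall K, `|u K| <= B) -> `|l| <= B.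
Proof.
move=> ul uB; apply: (cvgr_to_le (cvg_norm ul)).
by near=> K; exact: uB.
Unshelve. all: by end_near. Qed.

Lemma cvg_iter_Delta (F : nat -> 'rV[R]_n.+1 -> R) f h m :
  (forall x, F ^~ x @ \oo --> f x) ->
  forall x, (fun K => iter m (Delta h) (F K) x) @ \oo --> iter m (Delta h) f x.
Proof.
by move=> Ff; elim: m => [|m IH] x; [exact: Ff|apply: cvgB; exact: IH].
Qed.

Lemma iter_Delta_sum (r : seq nat) (c : nat -> R) (f : nat -> 'rV[R]_n.+1 -> R) h m x :
  iter m (Delta h) (fun x => \sum_(j <- r) c j * f j x) x =
  \sum_(j <- r) c j * iter m (Delta h) (f j) x.
Proof.
elim: m x => // m IH x; rewrite iterS {1}/Delta !IH -sumrB.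
by apply: eq_bigr => j _; rewrite -mulrBr.
Qed.

Lemma lacs_le a A K x : (forall j, `|a j| <= A) -> `|lacs a K x| <= A / (1 - lam s).
Proof.
move=> aA; have A0 : 0 <= A := le_trans (normr_ge0 _) (aA 0%N).
apply: (le_trans (ler_norm_sum _ _ _)).
apply: (@le_trans _ _ (\sum_(0 <= j < K) A * lam s ^+ j)).
  apply: ler_sum => j _; rewrite !normrM (ger0_norm (exprn_ge0 _ (lam_ge0 s))) -[leRHS]mulr1.
  by rewrite ler_pM ?cw_le1// ?mulr_ge0 ?exprn_ge0 ?lam_ge0// ler_wpM2r ?exprn_ge0 ?lam_ge0.
by rewrite -mulr_sumr ler_wpM2l// lam_geo.
Qed.

Lemma lac_le a A x : (forall j, `|a j| <= A) -> `|lac a x| <= A / (1 - lam s).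
Proof. by move=> aA; apply: cvg_norm_le (@cvg_lacs a A x aA) _ => K; exact: lacs_le. Qed.

(** Bounded term by term on partial sums and passed to the limit. As for potentials, s' = s gives
    the norm and s' < 1 gives continuity. *)
Lemma lac_diff_bound (s' : R) (m : nat) : 0 < s' -> s' <= s -> s' < m%:R ->
  exists2 C : R, 0 <= C & forall a A x h, (forall j, `|a j| <= A) -> 0 < enorm h <= 1 ->
  `|iter m (Delta h) (lac a) x| <= C * A * enorm h `^ s'.
Proof.
move=> s'0 s's s'm; have [C C0 HC] := lac_sum_le s'0 s'm; exists C => // a A x h aA h01.
have A0 : 0 <= A := le_trans (normr_ge0 _) (aA 0%N).
have [h0 _] := andP h01.
have cl := @cvg_iter_Delta (lacs a) (lac a) h m (fun x => @cvg_lacs a A x aA) x.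
apply: (cvg_norm_le cl) => K.
rewrite /lacs iter_Delta_sum (le_trans (ler_norm_sum _ _ _))//.
apply: (@le_trans _ _ (\sum_(0 <= j < K) A * (lam s' ^+ j * lacterm m (enorm h) j))); last first.
  by rewrite -mulr_sumr [C * A]mulrC -mulrA ler_wpM2l// HC.
apply: ler_sum => j _; rewrite iter_Delta_cw normrM [`|a j * _|]normrM (ger0_norm (exprn_ge0 _ (lam_ge0 s))) -[leLHS]mulrA.
apply: ler_pM; rewrite ?mulr_ge0 ?exprn_ge0 ?lam_ge0//.
apply: ler_pM; rewrite ?mulr_ge0 ?exprn_ge0 ?lam_ge0//.
  apply: lerXn2r; rewrite ?nnegrE ?lam_ge0//.
  by apply: ger_powR => //; rewrite invr_gt0 ltr0n/= invf_le1// ler1n.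
rewrite normrM -[leRHS]mulr1; apply: ler_pM => //; last exact: cw_le1.
rewrite normrX /lacterm; apply: lerXn2r; rewrite ?nnegrE// ?le_min ?ler0n ?mulr_ge0 ?exprn_ge0 ?pi_ge0 ?enorm_ge0//.
rewrite normrM (ger0_norm (ler0n _ 2)); apply/andP; split.
  by rewrite -[leRHS]mulr1 ler_wpM2l// sin_max.
have := normr_sin_le (freq j * h ord0 ord0 / 2).
rewrite [X in _ <= X -> _]normrM [`|freq j * _|]normrM [`|2^-1|]ger0_norm ?invr_ge0// (gtr0_norm (freq_gt0 R j)) => hs.
have hc : freq j * `|h ord0 ord0| <= freq j * enorm h by rewrite ler_wpM2l ?(ltW (freq_gt0 R j))// coord_le_enorm.
by rewrite -/(freq j); lra.
Qed.

Lemma lac_continuous a A : (forall j, `|a j| <= A) -> continuous (lac a).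
Proof.
move=> aA; have A0 : 0 <= A := le_trans (normr_ge0 _) (aA 0%N).
pose s' := Num.min s 2^-1.
have s'0 : 0 < s' by rewrite lt_min s0/=; lra.
have s's : s' <= s by rewrite ge_min lexx.
have s'1 : s' < 1%:R by rewrite (@le_lt_trans _ _ 2^-1)//; [rewrite ge_min lexx orbT|lra].
have [C C0 HC] := lac_diff_bound s'0 s's s'1.
apply: (@holder_continuous _ _ _ (C * A) s') => //; first by rewrite mulr_ge0.
by move=> x h h01; exact: HC.
Qed.

Lemma lac_bfun a A : (forall j, `|a j| <= A) -> bfun (lac a : V -> R).
Proof.
move=> aA; split; last by exists (A / (1 - lam s)) => x; exact: lac_le.
by apply: continuous_borelV_measurable; exact: lac_continuous aA.
Qed.

Lemma lac_lambda_norm : exists2 C : R, 0 <= C & forall a A, (forall j, `|a j| <= A) ->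
  (lambda_norm s (lac a) <= (C * A)%:E)%E.
Proof.
have sm : s < (Num.truncn s).+1%:R by have /andP[] := truncn_itv (ltW s0).
have [C C0 HC] := lac_diff_bound s0 (lexx s) sm.
exists ((1 - lam s)^-1 + C); first by rewrite addr_ge0// invr_ge0 subr_ge0 ltW// lam_lt1.
move=> a A aA; rewrite mulrDl [X in X + _]mulrC; apply: lambda_norm_le => [x|x h h01].
  exact: lac_le.
exact: HC.
Qed.

Lemma lac_Lambda a A : (forall j, `|a j| <= A) -> Lambda n.+1 s (lac a).
Proof.
move=> aA; split; first exact: lac_continuous aA.
by have [C C0 HC] := lac_lambda_norm; rewrite (le_lt_trans (HC a A aA))// ltry.
Qed.

Lemma lac_tail a A K : (forall j, `|a j| <= A) ->
  (fun x => lac a x - lacs a K x) = lac (fun j => if (j < K)%N then 0 else a j).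
Proof.
move=> aA; have A0 : 0 <= A := le_trans (normr_ge0 _) (aA 0%N).
pose a' j := if (j < K)%N then 0 else a j.
have a'A j : `|a' j| <= A by rewrite /a'; case: ifP => // _; rewrite normr0.
apply/funext => x; apply/esym/cvg_lim => //.
have h : (fun L => lacs a L x - lacs a K x) @ \oo --> lac a x - lacs a K x.
  by apply: cvgB; [exact: cvg_lacs aA|exact: cvg_cst].
apply: cvg_trans h; apply: near_eq_cvg; near=> L.
have KL : (K <= L)%N by near: L; exists K.
rewrite /lacs [X in X - _](big_cat_nat (n := K))//= [in RHS](big_cat_nat (n := K))//=.
rewrite addrAC subrr add0r [X in _ = X + _](_ : _ = 0) ?add0r; last first.
  by rewrite big_nat big1// => j /andP[_ jK]; rewrite jK !mul0r.
by rewrite !big_nat; apply: eq_bigr => j /andP[Kj _]; rewrite ltnNge Kj.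
Unshelve. all: by end_near. Qed.

Lemma lac_tail_le a A K x : (forall j, `|a j| <= A) ->
  `|lac a x - lacs a K x| <= A * lam s ^+ K / (1 - lam s).
Proof.
move=> aA; have A0 : 0 <= A := le_trans (normr_ge0 _) (aA 0%N).
have h : (fun L => lacs a (K + L) x - lacs a K x) @ \oo --> lac a x - lacs a K x.
  apply: cvgB; last exact: cvg_cst.
  have := cvg_lacs (x := x) aA; rewrite -(cvg_shiftn K) => h.
  by apply: cvg_trans h; apply: near_eq_cvg; near=> L; rewrite /= addnC.
apply: (cvg_norm_le h) => L.
rewrite /lacs [X in X - _](big_cat_nat (n := K))//= ?leq_addr// addrAC subrr add0r.
apply: (le_trans (ler_norm_sum _ _ _)).
rewrite -{1}[K]add0n big_addn addKn.
apply: (@le_trans _ _ (\sum_(0 <= j < L) A * lam s ^+ K * lam s ^+ j)).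
  apply: ler_sum => j _; rewrite !normrM (ger0_norm (exprn_ge0 _ (lam_ge0 s))) -[leRHS]mulr1.
  apply: ler_pM; rewrite ?cw_le1// ?mulr_ge0 ?exprn_ge0 ?lam_ge0//.
  by rewrite addnC exprD mulrA ler_wpM2r ?exprn_ge0 ?lam_ge0// ler_wpM2r ?exprn_ge0 ?lam_ge0.
by rewrite -mulr_sumr ler_wpM2l ?lam_geo// mulr_ge0 ?exprn_ge0 ?lam_ge0.
Unshelve. all: by end_near. Qed.

(** A finite sum of waves is the potential of the same sum with coefficients divided by the
    eigenvalues, which are positive; that preimage is bounded, hence in bmo. *)
Lemma lacs_Jbmo a K : Jbmo n.+1 s (lacs a K).
Proof.
pose b j : R := a j * lam s ^+ j / besselc n s (freq j).
pose g (y : V) : R := \sum_(0 <= j < K) b j * cw (freq j) 0 y.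
have mg : measurable_fun setT g.
  apply: measurable_sum => j; apply: measurable_funM => //; exact: measurable_cw.
have gB y : `|g y| <= \sum_(0 <= j < K) `|b j|.
  rewrite (le_trans (ler_norm_sum _ _ _))//; apply: ler_sum => j _.
  by rewrite normrM -[leRHS]mulr1 ler_wpM2l// cw_le1.
exists g; split; first exact: bounded_bmo gB.
have B0 : 0 <= \sum_(0 <= j < K) `|b j| by exact: sumr_ge0.
apply/funext => x; rewrite (bessel_potentialE x s0 (bounded_tame mg B0 gB)).
have ib j : mu.-integrable setT (EFin \o (fun y : V => b j * (bessel_kernel s (x - (y : 'rV[R]_n.+1)) * cw (freq j) 0 y))).
  exact: (integrable_RZl (b j) (bessel_integrable x s0 (cw_tame n (freq j) 0))).
have [E _] := Rintegral_sum (index_iota 0 K) predT ib.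
rewrite (@eq_Rintegral _ _ _ mu setT (fun y : V => \sum_(0 <= j < K) b j * (bessel_kernel s (x - (y : 'rV[R]_n.+1)) * cw (freq j) 0 y))); last first.
  by move=> y _; rewrite /g mulr_sumr; apply: eq_bigr => j _; rewrite mulrCA.
rewrite E; apply: eq_bigr => j _; rewrite RintegralZl//; last exact: (bessel_integrable x s0 (cw_tame n (freq j) 0)).
rewrite -(bessel_potentialE x s0 (cw_tame n (freq j) 0)) bessel_cw// /b; field.
by rewrite gt_eqF// besselc_gt0.
Qed.

End Lacunary.

(** * Square summability near the range of the Bessel potential *)

Section Separation.
Variables (R : realType) (n : nat) (s : R).
Hypothesis s0 : 0 < s.
Notation mu := (lebV R n.+1).
Notation V := (borelV R n.+1).
Notation m := (Num.truncn s).+1.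
Notation lac := (@lac R n s).
Notation lacs := (@lacs R n s).
Notation om := (@freq R).
Implicit Types (a : nat -> R) (g : V -> R) (x h : 'rV[R]_n.+1).

Lemma gmean_lacs a K j : (j < K)%N ->
  vanish (fun d => gmean d (fun x : V => lacs a K x * cw (om j) 0 x) - a j * lam s ^+ j / 2).
Proof.
move=> jK.
pose F i d : R := a i * lam s ^+ i * (gmean d (fun x : V => cw (om i) 0 x * cw (om j) 0 x) - (i == j)%:R / 2).
have vF i : vanish (F i).
  apply: vanishZ; have [->|ij] := eqVneq i j.
    by have := @gmean_cw_sqr R n _ (freq_gt0 R j); apply: vanish_eq => d _; rewrite div1r.
  have := @gmean_cw_orth R n _ _ (freq_gt0 R i) (freq_gt0 R j); rewrite (inj_eq (@freq_inj R)) => /(_ ij).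
  by apply: vanish_eq => d _; rewrite mul0r subr0.
apply: vanish_eq (vanish_sum (index_iota 0 K) vF) => d d1.
have d0 : 0 < d by exact: lt_le_trans d1.
have ii i : mu.-integrable setT (EFin \o (fun y : V => a i * lam s ^+ i * (gaussV d (y : 'rV[R]_n.+1) * (cw (om i) 0 y * cw (om j) 0 y)))).
  apply: integrable_RZl; apply: gint_integrable => //; apply: bfun_gint.
  by apply: bfunM; exact: bfun_cw.
have [E _] := Rintegral_sum (index_iota 0 K) predT ii.
have -> : gmean d (fun x : V => lacs a K x * cw (om j) 0 x) =
    \sum_(0 <= i < K) a i * lam s ^+ i * gmean d (fun x : V => cw (om i) 0 x * cw (om j) 0 x).
  rewrite {1}/gmean (@eq_Rintegral _ _ _ mu setT (fun y : V => \sum_(0 <= i < K)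
     a i * lam s ^+ i * (gaussV d (y : 'rV[R]_n.+1) * (cw (om i) 0 y * cw (om j) 0 y)))); last first.
    by move=> y _; rewrite /lacs mulr_suml mulr_sumr; apply: eq_bigr => i _; ring.
  rewrite E; apply: eq_bigr => i _; rewrite RintegralZl//.
  by apply: gint_integrable => //; apply: bfun_gint; apply: bfunM; exact: bfun_cw.
rewrite /F; under [RHS]eq_bigr do rewrite mulrBr.
rewrite sumrB; congr (_ - _).
rewrite (bigD1_seq j) ?iota_uniq ?mem_index_iota//= eqxx big1 ?addr0 ?div1r//.
by move=> i /negbTE ->; rewrite mul0r mulr0.
Qed.

(** Test against the j-th wave, in units of a_j lam^j. The series contributes 1/2, cutting its tail
    costs 1/8, and the remainder [e] costs at most 1/8 up to a vanishing error, since half-period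
    differences moved onto the wave multiply it by 2^m. At least 1/4 is left for the potential;
    division by the eigenvalue bounds the coefficient of [g] below by a multiple of a_j, and
    Bessel's inequality applies. *)
Lemma lac_close_summable a g : (forall j, 0 <= a j <= 1) -> bmo g ->
  (forall j x h, enorm h = 2^-1 ^+ j ->
    `|iter m (Delta h) (fun x => lac a x - bessel_potential s g x) x| <= a j / 4 * lam s ^+ j) ->
  exists B : R, forall J, \sum_(j < J) a j ^+ 2 <= B.
Proof.
move=> a01 bg close; have [M tg gM] := bmo_tame bg; have [M0 mg _ _] := tg.
have aA j : `|a j| <= 1 by have /andP[a0 a1] := a01 j; rewrite ger0_norm.
have l0 := lam_gt0 s; have l1 := lam_lt1 s0.
have [Cb Cb0 HCb] := @besselc_le R n s s0.
have [Cm Cm0 HCm] := @gmean_bessel R n.+1 s s0.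
have [Ci Ci0 HCi] := @bessel_inequality R n.
have [C1 C10 HC1] := @bessel_bounded R n.+1 s s0.
have bf : bfun (lac a : V -> R) by exact: lac_bfun aA.
have bb : bfun (bessel_potential s g : V -> R).
  split; last by exists (C1 * M) => x; exact: HC1.
  by apply: continuous_borelV_measurable; exact: bessel_continuous tg.
pose e (x : V) : R := lac a x - bessel_potential s g x.
have be : bfun e by exact: bfunB.
(* The 4 comes from 1/2 - 1/8 - 1/8 = 1/4, and [Cb] from the upper bound on the eigenvalue; the
   added 1 keeps [Q] positive. *)
pose Q : R := 4 * (Cb + 1); have Q0 : 0 < Q by rewrite mulr_gt0// ltr_wpDl.
exists (Q ^+ 2 * (Ci * M + 2)) => J.
have : \sum_(j < J) (a j / Q) ^+ 2 <= Ci * M + 2.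
  apply: (HCi M g om (fun j => a j / Q)) => //; first exact: freq_gt0.
  - exact: freq_inj.
  - by move=> j; have /andP[a0 _] := a01 j; rewrite divr_ge0// ltW.
  move=> j; have /andP[a0 _] := a01 j.
  (* Set apart because the tail can be made smaller than a multiple of a_j only when a_j > 0. *)
  have [aj|aj] := eqVneq (a j) 0.
    by exists 0 => // d _; rewrite aj mul0r sub0r max_r ?normr0 ?mul0r// oppr_le0.
  have aj0 : 0 < a j by rewrite lt_neqAle eq_sym aj.
  set c := besselc n s (om j); have c0 : 0 < c by exact: besselc_gt0.
  have cC : c <= Cb * lam s ^+ j by rewrite lamX; exact: HCb.
  have lj0 : 0 < lam s ^+ j by rewrite exprn_gt0.
  (* The truncation index may depend on [j]; only the rate in d matters for [vanish]. *)
  have [K [jK tK]] : exists K, (j < K)%N /\ lam s ^+ K / (1 - lam s) <= a j * lam s ^+ j / 8.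
    pose ep := a j * lam s ^+ j / 8 * (1 - lam s).
    have ep0 : 0 < ep by rewrite mulr_gt0 ?subr_gt0// divr_gt0// mulr_gt0.
    have : (lam s ^+ k @[k --> \oo] --> (0 : R)).
      have := @cvg_geometric R 1 (lam s); rewrite ger0_norm ?(ltW l0)// => /(_ l1).
      by apply: cvg_trans; apply: near_eq_cvg; near=> k; rewrite /= mul1r.
    move=> /cvgr0_norm_le /(_ _ ep0) [N _ HN]; exists (maxn N j.+1); split; first by rewrite leq_max leqnn orbT.
    rewrite ler_pdivrMr ?subr_gt0// -/ep (le_trans (ler_norm _))//.
    by apply: (HN (maxn N j.+1)); rewrite /= leq_maxl.
  (* With this phase, [m] half-period differences of [v] give 2^m times the cosine wave itself. *)
  pose v : V -> R := cw (om j) (- (m%:R * (pi / 2))).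
  have bv : bfun v by exact: bfun_cw.
  have V1 := gmean_lacs a jK.
  have V2 := gmean_parts (step R n j) m be bv.
  have V3 : vanish (fun d => gmean d (fun x : V => bessel_potential s g x * cw (om j) 0 x) -
      c * gmean d (fun x => g x * cw (om j) 0 x)).
    exists (Cm * M * 1); first by rewrite !mulr_ge0.
    move=> d d1; have d0 : 0 < d by exact: lt_le_trans d1.
    have := HCm M g 1 (cw (om j) 0 : V -> R) d tg (measurable_cw _ _) (cw_le1 _ _) d1.
    rewrite [X in `|_ - X|](_ : _ = c * gmean d (fun x => g x * cw (om j) 0 x))//.
    rewrite -gmeanZ//; last by apply: gint_mulr; [exact: tame_gint tg|exact: bfun_cw].
    by apply: eq_Rintegral => x _; rewrite bessel_cw// -/c; ring.
  pose F d : R := `|gmean d (fun x : V => lacs a K x * cw (om j) 0 x) - a j * lam s ^+ j / 2| +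
    `|gmean d (fun x => iter m (Delta (step R n j)) e x * v x)
      - (-1) ^+ m * gmean d (fun x => e x * iter m (Delta (step R n j)) v x)| +
    `|gmean d (fun x : V => bessel_potential s g x * cw (om j) 0 x) -
      c * gmean d (fun x => g x * cw (om j) 0 x)|.
  have vF : vanish F.
    have vN (G : R -> R) : vanish G -> vanish (fun d => `|G d|).
      by apply: (@vanish_le _ _ _ 1) => // d _; rewrite mul1r normr_id.
    by apply: vanishD; [apply: vanishD|]; exact: vN.
  apply: (vanish_le (ltW (_ : 0 < c^-1)) _ vF); first by rewrite invr_gt0.
  move=> d d1; have d0 : 0 < d by exact: lt_le_trans d1.
  have F0 : 0 <= F d by rewrite !addr_ge0.
  rewrite (ger0_norm F0) [leLHS]ger0_norm; last by rewrite le_max lexx orbT.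
  rewrite ge_max; apply/andP; split; last by rewrite mulr_ge0// invr_ge0 ltW.
  rewrite [leRHS]mulrC ler_pdivlMr//.
  set b := `|gmean d (fun x => g x * cw (om j) 0 x)|.
  pose fS := gmean d (fun x : V => lacs a K x * cw (om j) 0 x).
  pose fL := gmean d (fun x : V => lac a x * cw (om j) 0 x).
  pose fE := gmean d (fun x : V => e x * cw (om j) 0 x).
  pose fB := gmean d (fun x : V => bessel_potential s g x * cw (om j) 0 x).
  have EB : fL - fE = fB.
    rewrite /fL /fE /fB -gmeanB//; [|by apply: bfun_gint; apply: bfunM => //; exact: bfun_cw..].
    by apply: eq_Rintegral => x _; rewrite /e; ring.
  have H1 : `|fL - fS| <= a j * lam s ^+ j / 8.
    have bS : bfun (lacs a K : V -> R).
      split; last by exists (1 / (1 - lam s)) => x; exact: lacs_le aA.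
      apply: measurable_sum => i; apply: measurable_funM => //; exact: measurable_cw.
    rewrite /fL /fS -gmeanB//; [|by apply: bfun_gint; apply: bfunM => //; exact: bfun_cw..].
    apply: gmean_le => //.
      by apply: measurable_funB; apply: measurable_funM; [exact: bf.1|exact: measurable_cw|exact: bS.1|exact: measurable_cw].
    move=> x; rewrite -mulrBl normrM.
    apply: le_trans tK; rewrite -[leRHS]mulr1; apply: ler_pM => //; last exact: cw_le1.
    by have := lac_tail_le s0 K x aA; rewrite mul1r.
  have H2 : `|fE| <= a j * lam s ^+ j / 8 + `|gmean d (fun x => iter m (Delta (step R n j)) e x * v x)
      - (-1) ^+ m * gmean d (fun x => e x * iter m (Delta (step R n j)) v x)|.
    have EE : gmean d (fun x => e x * iter m (Delta (step R n j)) v x) = 2 ^+ m * fE.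
      rewrite /fE -gmeanZ//; last by apply: bfun_gint; apply: bfunM => //; exact: bfun_cw.
      by apply: eq_Rintegral => x _; rewrite iter_Delta_step_cw; ring.
    have D1 : `|gmean d (fun x => iter m (Delta (step R n j)) e x * v x)| <= a j / 4 * lam s ^+ j.
      apply: gmean_le => //.
        by apply: measurable_funM; [exact: (bfun_iter_Delta _ _ be).1|exact: bv.1].
      move=> x; rewrite normrM -[leRHS]mulr1; apply: ler_pM => //; last exact: cw_le1.
      by apply: close; exact: enorm_step.
    rewrite EE; set A := gmean d _ in D1 *.
    have : `|(-1) ^+ m * (2 ^+ m * fE)| = 2 ^+ m * `|fE|.
      by rewrite !normrM normrX normrN1 expr1n mul1r ger0_norm// exprn_ge0.
    set W := (-1) ^+ m * _ => WE.
    (* The order of the difference is at least 1, so 2^m >= 2; this halves the hypothesis a_j/4 to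
       the 1/8 of the budget. *)
    have h1 : 2 * `|fE| <= `|W|.
      by rewrite WE ler_wpM2r// exprS ler_peMr// exprn_ege1// ler1n.
    have h2 : `|W| <= `|A| + `|A - W|.
      by rewrite -{1}(subKr A W) (le_trans (ler_normB _ _)).
    by move: h1 h2 D1 (normr_ge0 (A - W)); set N := `|A - W|; clear; lra.
  have H3 : a j * lam s ^+ j / 4 <= c * b + F d.
    have g1 : a j * lam s ^+ j / 2 - `|fS - a j * lam s ^+ j / 2| <= fS.
      by have := ler_norm (a j * lam s ^+ j / 2 - fS); rewrite distrC; clear; lra.
    have g2 : fS - a j * lam s ^+ j / 8 <= fL.
      by move: H1 (ler_norm (fS - fL)); rewrite [`|fS - fL|]distrC; clear; lra.
    have g3 : fB <= c * b + `|fB - c * gmean d (fun x => g x * cw (om j) 0 x)|.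
      have := ler_norm (fB - c * gmean d (fun x => g x * cw (om j) 0 x)).
      have : c * gmean d (fun x => g x * cw (om j) 0 x) <= c * b by rewrite ler_wpM2l ?(ltW c0)// ler_norm.
      by clear; lra.
    have g4 := ler_norm fE.
    rewrite /F -/fS -/fB; set N2 := `|_ - (-1) ^+ m * _| in H2 *.
    by move: g1 g2 g3 g4 H2 EB; clear; lra.
  have H4 : a j / Q * c <= a j * lam s ^+ j / 4.
    rewrite /Q (_ : a j / (4 * (Cb + 1)) * c = a j / 4 * (c / (Cb + 1))); last first.
      by field; rewrite gt_eqF// ltr_wpDl.
    rewrite [leRHS]mulrAC ler_wpM2l ?divr_ge0// ler_pdivrMr ?ltr_wpDl//.
    by apply: (le_trans cC); rewrite mulrC ler_wpM2l ?(ltW lj0)// lerDl.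
  by rewrite mulrBl lerBlDr [b * c]mulrC; move: H3 H4; clear; lra.
rewrite (_ : \sum_(j < J) (a j / Q) ^+ 2 = Q ^- 2 * \sum_(j < J) a j ^+ 2); last first.
  by rewrite mulr_sumr; apply: eq_bigr => j _; rewrite expr_div_n mulrC.
by rewrite ler_pdivrMl ?exprn_gt0.
Unshelve. all: by end_near. Qed.

End Separation.

(** * The inclusions and the harmonic test sequence *)

Section Main.
Variables (R : realType) (n : nat) (s : R).
Hypothesis s0 : 0 < s.

Definition root_seq (j : nat) : R := (Num.sqrt j.+1%:R)^-1.

Lemma root_seq_itv j : 0 <= root_seq j <= 1.
Proof.
have h : 1 <= Num.sqrt j.+1%:R :> R by rewrite -[leLHS]sqrtr1 ler_wsqrtr// ler1n.
have h0 : 0 < Num.sqrt j.+1%:R :> R by exact: lt_le_trans h.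
by rewrite invr_ge0 (ltW h0)/= invf_le1.
Qed.

Lemma root_seq_sqr_unbounded (B : R) : ~ forall J, \sum_(j < J) root_seq j ^+ 2 <= B.
Proof.
move=> H; apply: (@dvg_harmonic R); apply: nondecreasing_is_cvgn.
  by apply/nondecreasing_seqP => K; rewrite /series/= big_nat_recr//= lerDl invr_ge0.
exists B => _ [K _ <-]; rewrite /series/= big_mkord; apply: le_trans (H K).
apply: ler_sum => j _; rewrite /root_seq exprVn sqr_sqrtr//.
Qed.

Lemma Jbmo_Lambda : Jbmo n s `<=` Lambda n s.
Proof. by move=> _ [g [bg ->]]; have [M tg _] := bmo_tame bg; exact: bessel_Lambda tg. Qed.

Lemma lambda_norm0_le : (lambda_norm s (fun _ : 'rV[R]_n => 0%R) <= 0)%E.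
Proof.
rewrite -[leRHS]adde0; apply: lambda_norm_le => [x|x h _]; first by rewrite normr0.
by rewrite iter_Delta0 normr0 mul0r.
Qed.

Lemma Jbmo_closure : Jbmo n s `<=` lambda_closure s (Jbmo n s).
Proof.
move=> f Jf; split; first exact: Jbmo_Lambda.
move=> eps eps0; exists f; split => //.
under eq_fun do rewrite subrr.
by rewrite (le_lt_trans lambda_norm0_le).
Qed.

End Main.

(** * Strictness of both inclusions *)

Section Strictness.
Variables (R : realType) (n : nat) (s : R).
Hypothesis s0 : 0 < s.

Lemma lac_root_seq_closure : lambda_closure s (Jbmo n.+1 s) (@lac R n s (@root_seq R)).
Proof.
have aA j : `|@root_seq R j| <= 1 by have /andP[a0 a1] := @root_seq_itv R j; rewrite ger0_norm.
split; first exact: lac_Lambda aA.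
move=> eps eps0; have [C C0 HC] := @lac_lambda_norm R n s s0.
(* The tail coefficients are at most 1/sqrt(K+1), and K+1 > (C/eps)^2 brings the norm of the tail
   below [eps]. *)
pose K := Num.truncn ((C / eps) ^+ 2).
exists (lacs s (@root_seq R) K); split; first exact: lacs_Jbmo.
rewrite (@lac_tail R n s s0 _ 1 K aA).
have tA j : `|if (j < K)%N then 0 else @root_seq R j| <= (Num.sqrt K.+1%:R)^-1.
  case: ifPn => [_|]; first by rewrite normr0 invr_ge0 sqrtr_ge0.
  rewrite -leqNgt => Kj; have /andP[a0 _] := @root_seq_itv R j; rewrite ger0_norm//.
  by rewrite lef_pV2 ?posrE ?sqrtr_gt0// ler_wsqrtr// ler_nat.
rewrite (le_lt_trans (HC _ _ tA))// lte_fin ltr_pdivrMr ?sqrtr_gt0// mulrC -ltr_pdivrMr//.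
have Ce : 0 <= C / eps by rewrite divr_ge0// ltW.
rewrite -[ltLHS](ger0_norm Ce) -sqrtr_sqr ltr_sqrt//.
by have /andP[] := truncn_itv (sqr_ge0 (C / eps)).
Qed.

Lemma lac_root_seq_notin : ~ Jbmo n.+1 s (@lac R n s (@root_seq R)).
Proof.
move=> [g [bg fg]].
have [|B] := @lac_close_summable R n s s0 (@root_seq R) g (@root_seq_itv R) bg.
  move=> j x h _.
  have -> : (fun x => lac s (@root_seq R) x - bessel_potential s g x) = (fun=> 0).
    by apply/funext => y; rewrite fg subrr.
  have /andP[a0 _] := @root_seq_itv R j.
  by rewrite iter_Delta0 normr0 mulr_ge0 ?divr_ge0// exprn_ge0// lam_ge0.
exact: root_seq_sqr_unbounded.
Qed.

Lemma lac_one_notin : ~ lambda_closure s (Jbmo n.+1 s) (@lac R n s (fun=> 1)).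
Proof.
(* The tolerance 1/4 is the one allowed by [lac_close_summable] for coefficients equal to 1. *)
move=> [_ /(_ 4^-1)]; rewrite invr_gt0 ltr0n => /(_ isT) [_ [[g [bg ->]] close]].
(* The two sample values only ensure that both suprema in the norm are finite reals. *)
have [||||A [B [SA SB A0 B0]]] := @ereal_sup_add_fin R _ _
  (`|lac s (fun=> 1) (0 : 'rV[R]_n.+1) - bessel_potential s g 0|%:E)
  ((`|iter (Num.truncn s).+1 (Delta (@step R n 0)) (fun x => lac s (fun=> 1) x - bessel_potential s g x) 0| / 1 `^ s)%:E) _ _ _ _ (lt_trans close (ltry _)).
- by exists 0.
- by exists 0, (@step R n 0), 1; rewrite ltr01 lexx enorm_step expr0.
- by rewrite lee_fin.
- by rewrite lee_fin divr_ge0// powR_ge0.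
have B4 : B <= 4^-1.
  move: close; rewrite /lambda_norm SA SB -EFinD lte_fin; lra.
have [||D] := @lac_close_summable R n s s0 (fun=> 1) g _ bg.
- by move=> j; rewrite ler01 lexx.
- move=> j x h hj; have t0 : 0 < 2^-1 ^+ j :> R by rewrite exprn_gt0// invr_gt0.
  have : ((`|iter (Num.truncn s).+1 (Delta h) (fun x => lac s (fun=> 1) x - bessel_potential s g x) x| / (2^-1 ^+ j) `^ s)%:E <= B%:E)%E.
    rewrite -SB; apply: ereal_sup_ubound; exists x, h, (2^-1 ^+ j); split => //.
    by rewrite t0 exprn_ile1// ?invr_ge0// invf_le1// ler1n.
  rewrite lee_fin ler_pdivrMr ?powR_gt0// -lamX => /le_trans; apply.
  by rewrite div1r ler_wpM2r// exprn_ge0// lam_ge0.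
(* With all coefficients 1 the partial sums are [J], which exceeds any bound. *)
move=> H; have := H (Num.truncn D).+1; rewrite expr1n sumr_const card_ord leNgt => /negP; apply.
have [D0|D0] := leP 0 D; first by have /andP[] := truncn_itv D0.
by rewrite (lt_le_trans D0).
Qed.

End Strictness.

Theorem mainTheorem12 (R : realType) (n : nat) (s : R) :
  (0 < n)%N -> 0 < s ->
  Jbmo n s `<` lambda_closure s (Jbmo n s) /\
  lambda_closure s (Jbmo n s) `<` Lambda n s.
Proof.
case: n => // n _ s0; split; split.
- exact: Jbmo_closure.
- by move=> /(_ _ (lac_root_seq_closure n s0)); exact: lac_root_seq_notin.
- by move=> f [].
- move=> H; apply: (@lac_one_notin R n s s0); apply: H.
  by apply: (@lac_Lambda R n s s0 _ 1) => j; rewrite normr1.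
Qed.
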